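(* Let $f$ be a strongly additive function. Suppose that $\sigma^2=\sigma^2(f;x)\to\infty$ as $x\to\infty$ and that $0\le f(p)\le O(1)$ for all primes $p$. Suppose that for some distribution function $\Psi$ of compact support on $\mathbb{R}_{\ge0}$ (that is, $\Psi(\alpha)-\Psi(0)=1$ for some $\alpha>0$), $$\frac1x\,\#\left\{n\le x: \frac{f(n)-\mu(f;x)}{\sigma(f;x)}\ge\Delta\right\}\sim\mathbb{P}\left(\mathcal{Z}_\Psi(\sigma^2)\ge\Delta\sigma\right)$$ uniformly in $1\le\Delta\ll_\varepsilon\sigma^{1-\varepsilon}$. Then $$\frac1{\sigma^2(f;x)}\sum_{\substack{p\le x\\ f(p)\le t}}\frac{f(p)^2}{p}\Big(1-\frac1p\Big)$$ converges weakly to the distribution function $\Psi$ as $x\to\infty$ (i.e. converges to $\Psi(t)$ at all continuity points $t$ of $\Psi$).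
   Context: Strongly additive: $f(p^k)=f(p)$ for all primes $p$ and $k\ge1$, and $f(mn)=f(m)+f(n)$ for $(m,n)=1$. Here $$\mu(f;x)=\sum_{p\le x}\frac{f(p)}{p},\qquad \sigma^2(f;x)=\sum_{p\le x}\frac{f(p)^2}{p}\Big(1-\frac1p\Big),\quad \sigma=\sigma(f;x)\ge0.$$ For a distribution function $\Psi$ and $u>0$, $\mathcal{Z}_\Psi(u)$ denotes a random variable with distribution determined by $$\mathbb{E}\big[e^{it\mathcal{Z}_\Psi(u)}\big]=\exp\left(u\int_{\mathbb{R}}\frac{e^{itx}-itx-1}{x^2}\,d\Psi(x)\right)\quad(t\in\mathbb{R}),$$ the integrand at $x=0$ being interpreted as its limit $-t^2/2$. ''Uniformly in $1\le\Delta\ll_\varepsilon\sigma^{1-\varepsilon}$'' means: for every fixed $\varepsilon>0$ and every constant $K>0$ (possibly depending on $\varepsilon$), the ratio of the two sides tends to $1$ as $x\to\infty$ uniformly over $1\le\Delta\le K\sigma^{1-\varepsilon}$. *)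

(* Defs.v *)
From HB Require Import structures.
From mathcomp Require Export all_boot all_order all_algebra.
From mathcomp Require Export all_classical all_reals all_analysis.
From mathcomp Require Export complex.

Set Implicit Arguments.
Unset Strict Implicit.
Unset Printing Implicit Defensive.

Export Order.TTheory GRing.Theory Num.Theory.
Export numFieldNormedType.Exports.

Local Open Scope classical_set_scope.
Local Open Scope ring_scope.
Local Open Scope complex_scope.

Section AdditiveFunctions.
Context {R : realType}.
Implicit Types (f : nat -> R) (x t Delta : R).

(* The value [f 0] is unconstrained and never used below. *)
Definition strongly_additive f : Prop :=
  (forall p k : nat, prime p -> (1 <= k)%N -> f (p ^ k)%N = f p) /\
  (forall m n : nat, (0 < m)%N -> (0 < n)%N -> coprime m n ->
     f (m * n)%N = f m + f n).

(* The cutoff [x] is real; for [0 <= x] and [n : nat], [n <= x] is equivalent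
   to [n < (Num.truncn x).+1]. *)
Definition add_mean f x : R :=
  \sum_(0 <= p < (Num.truncn x).+1 | prime p) f p / p%:R.

Definition add_variance f x : R :=
  \sum_(0 <= p < (Num.truncn x).+1 | prime p)
    f p ^+ 2 / p%:R * (1 - p%:R^-1).

Definition add_sigma f x : R := Num.sqrt (add_variance f x).

Definition tail_density f x Delta : R :=
  (count (fun n => Delta <= (f n - add_mean f x) / add_sigma f x)
     (index_iota 1 (Num.truncn x).+1))%:R / x.

Definition prime_values_cdf f x t : R :=
  (add_variance f x)^-1 *
  \sum_(0 <= p < (Num.truncn x).+1 | prime p && (f p <= t))
    f p ^+ 2 / p%:R * (1 - p%:R^-1).

End AdditiveFunctions.

Section CharacteristicFunctions.
Context {R : realType}.

Definition cexp (z : R[i]) : R[i] :=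
  (expR (complex.Re z) * cos (complex.Im z)) +i*
  (expR (complex.Re z) * sin (complex.Im z)).

Definition cintegral d (T : measurableType d)
    (mu : {measure set T -> \bar R}) (g : T -> R[i]) : R[i] :=
  (\int[mu]_w complex.Re (g w)) +i* (\int[mu]_w complex.Im (g w)).

Definition char_fun d (T : measurableType d) (P : probability T R)
    (X : {RV P >-> R}) (t : R) : R[i] :=
  cintegral P (fun w => cexp (0 +i* (t * X w))).

Definition levy_integrand (t x : R) : R[i] :=
  if x == 0 then (- t ^+ 2 / 2)%:C
  else (cexp (0 +i* (t * x)) - 0 +i* (t * x) - 1) / (x ^+ 2)%:C.

(* [cumulativeBounded 0 1] is the library's type of distribution functions:
   nondecreasing, right-continuous, with limits 0 and 1 at -oo and +oo. *)
Definition is_Z_Psi (Psi : cumulativeBounded (0 : R) (1 : R)) (u : R)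
    d (T : measurableType d) (P : probability T R) (Z : {RV P >-> R}) : Prop :=
  forall t : R,
    char_fun Z t =
    cexp (u%:C *
          cintegral (lebesgue_stieltjes_measure Psi) (levy_integrand t)).

End CharacteristicFunctions.

(* [L x D / M x D] tends to 1 as [x] tends to infinity, uniformly in
   [1 <= D <= K * s x `^ (1 - e)], for all fixed [e, K > 0].  Since
   [y / 0 = 0], the condition forces [M x D != 0] in the range. *)
Definition equiv_uniformly {R : realType} (s : R -> R) (L M : R -> R -> R) :
    Prop :=
  forall e K : R, 0 < e -> 0 < K ->
  forall eta : R, 0 < eta ->
  \forall x \near +oo, forall D : R, 1 <= D -> D <= K * s x `^ (1 - e) ->
    `| L x D / M x D - 1 | < eta.

(* Main.v *)
Require Import Defs.
From mathcomp Require Import ring lra zify measurable_realfun.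

Set Implicit Arguments.
Unset Strict Implicit.
Unset Printing Implicit Defensive.

(** Write V = sigma^2(f; x), let X = f(n) - mu(f; x) with n uniform in [1, x],
    and let Y = Z_Psi(V).  The distribution function of the conclusion has
    moments
      m_k(x) = V^-1 * sum_(p <= x) f(p)^(k+2) / p * (1 - 1/p),
    and Psi has moments m_k.  All masses sit in one compact interval, so it is
    enough that m_k(x) tends to m_k for every k; polynomials approximating a
    step function then give weak convergence ([step_poly],
    [weak_convergence]).

    These moments are visible in the moment generating functions.  For small
    s > 0 the logarithm of E e^(sX) is V * sum_(k >= 2) m_(k-2)(x) s^k / k!
    up to O(1) ([additive_mgf_bounds]), and the logarithm of E e^(sY) is the
    same expression formed with the m_k ([levy_law_mgf]); in both cases the
    series is used through its truncations, with an error V * O(s^N).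

    - For X the argument is elementary.  With h(p) = e^(s f(p)) - 1 >= 0, the
      sum of e^(s f(n)) is the sum over squarefree d of h(d) floor(x / d).
      Bounding the floor by x / d gives x * prod_p (1 + h(p)/p) from above.
      From below, floor(x / d) >= x / (2d) * (1 - log d / log x), and since h
      is small the term in log d costs only a constant factor.

    - For Y only the characteristic function is given.  Its expansions at 0 to
      every order determine all moments of Y, the even ones by Fatou's lemma
      applied to the remainders of the cosine series, which have a constant
      sign ([even_moments]).  Divided by factorials, these moments are the
      coefficients in s of exp (V * sum_(k >= 2) m_(k-2) s^k / k!); they are
      nonnegative, and the generating function is bounded by summing them.

    Take now s = sigma^-e with e > 0 small.  Both generating functions are then
    carried, up to constant factors, by the values D * sigma with
    1 <= D <= K * sigma^(1-e), which is the range where the two tails are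
    equivalent; hence the generating functions agree up to a constant factor
    ([mgf_compare]).  Therefore
      V * |sum_(k >= 3) (m_(k-2)(x) - m_(k-2)) s^k / k!| = O(1),
    and, decreasing e at each stage, the differences m_k(x) - m_k are shown one
    after the other to be O(sigma^-kappa) for some kappa = kappa(k) > 0
    ([moments_rate]). *)

Local Open Scope classical_set_scope.
Local Open Scope ring_scope.

(** * Taylor polynomials and their remainders *)

Section Taylor.
Context {R : realType}.
Implicit Types (c : nat -> R) (N n k : nat) (y t : R) (z : R[i]).

(** Exponential normalisation: differentiating shifts the sequence [c]. *)
Definition taylor_poly c N : {poly R} := \poly_(k < N) (c k / k`!%:R).

Lemma deriv_taylor_poly c N :
  (taylor_poly c N.+1)^`() = taylor_poly (fun k => c k.+1) N.
Proof.
apply/polyP => k; rewrite coef_deriv !coef_poly ltnS.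
case: ifP => kN; last by rewrite mul0rn.
rewrite factS natrM -[LHS]mulr_natr -mulrA; congr (_ * _).
by rewrite invfM mulrAC mulVf ?mul1r// pnatr_eq0.
Qed.

Lemma horner_taylor_poly0 c N : c 0%N = 0 -> (taylor_poly c N).[0] = 0.
Proof.
by move=> c0; rewrite horner_coef0 coef_poly; case: ifP => // _; rewrite c0 mul0r.
Qed.

Lemma horner_taylor_polyS0 c N : (taylor_poly c N.+1).[0] = c 0%N.
Proof. by rewrite horner_coef0 coef_poly /= fact0 divr1. Qed.

Lemma taylor_polyS c N y :
  (taylor_poly c N.+1).[y] = (taylor_poly c N).[y] + c N / N`!%:R * y ^+ N.
Proof. by rewrite /taylor_poly !horner_poly big_ord_recr. Qed.

Lemma eq_taylor_poly c c' N : c =1 c' -> taylor_poly c N = taylor_poly c' N.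
Proof. by move=> cc'; apply/polyP => k; rewrite !coef_poly cc'. Qed.

Lemma taylor_polyB (a b : R) c c' N y :
  (taylor_poly (fun k => a * c k - b * c' k) N).[y] =
  a * (taylor_poly c N).[y] - b * (taylor_poly c' N).[y].
Proof.
rewrite /taylor_poly !horner_poly !mulr_sumr -sumrB.
by apply: eq_bigr => k _; ring.
Qed.

Lemma is_derive_sub_taylor (F F' : R -> R) c N y :
  is_derive y 1 F (F' y) ->
  is_derive y 1 (fun w => F w - (taylor_poly c N.+1).[w])
    (F' y - (taylor_poly (fun k => c k.+1) N).[y]).
Proof.
move=> dF; rewrite -deriv_taylor_poly.
apply: is_deriveB.
Qed.

Lemma mean_value_from0 (F F' : R -> R) y :
  (forall w : R, is_derive w 1 F (F' w)) -> F 0 = 0 -> 0 <= y ->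
  exists2 c, 0 <= c <= y & F y = F' c * y.
Proof.
move=> dF F0 y0.
have cF : {within `[0, y], continuous F}%classic.
  apply: continuous_subspaceT => w.
  apply: differentiable_continuous; apply/derivable1_diffP.
  exact: ex_derive.
have [c cy] := MVT_segment y0 (fun w _ => dF w) cF.
by rewrite F0 !subr0 => ->; exists c => //; move: cy; rewrite in_itv.
Qed.

Lemma ge0_from0 (F F' : R -> R) :
  (forall w : R, is_derive w 1 F (F' w)) -> F 0 = 0 ->
  (forall w, 0 <= w -> 0 <= F' w) -> forall y, 0 <= y -> 0 <= F y.
Proof.
move=> dF F0 F'0 y y0; have [c /andP[c0 _] ->] := mean_value_from0 dF F0 y0.
by rewrite mulr_ge0// F'0.
Qed.

Definition exp_poly N := taylor_poly (fun _ => 1) N.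

(** The remainder of order [N.+1] is a primitive of that of order [N], so both
    bounds propagate by the mean value theorem. *)
Lemma expR_taylor N y : 0 <= y ->
  0 <= expR y - (exp_poly N).[y] <= y ^+ N * expR y.
Proof.
elim: N y => [|N IH] y y0.
  by rewrite /exp_poly /taylor_poly poly_def big_ord0 horner0 subr0 expr0 mul1r expR_ge0 lexx.
have dF (w : R) : is_derive w 1 (fun w => expR w - (exp_poly N.+1).[w])
    (expR w - (exp_poly N).[w]) by apply: is_derive_sub_taylor.
have F0 : expR 0 - (exp_poly N.+1).[0] = 0 :> R.
  by rewrite /exp_poly horner_taylor_polyS0 expR0 subrr.
have [c /andP[c0 cy] ->] := mean_value_from0 dF F0 y0.
have /andP[h1 h2] := IH c c0.
rewrite mulr_ge0//= exprSr -mulrA [y * _]mulrC mulrA ler_wpM2r//.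
by rewrite (le_trans h2)// ler_pM ?exprn_ge0 ?expR_ge0// ?ler_expR// lerXn2r ?nnegrE.
Qed.

(** Each remainder of e^-y is minus the derivative of the next one, whence
    alternating signs. *)
Lemma expRN_taylor N y : 0 <= y ->
  0 <= (-1) ^+ N * (expR (- y) - (taylor_poly (fun k => (-1) ^+ k) N).[y]).
Proof.
elim: N y => [|N IH] y y0.
  by rewrite /taylor_poly poly_def big_ord0 horner0 subr0 expr0 mul1r expR_ge0.
rewrite exprS -mulrA; set G := _ * (_ - _).
have dF (w : R) : is_derive w 1
    (fun w => expR (- w) - (taylor_poly (fun k => (-1) ^+ k) N.+1).[w])
    (- expR (- w) - (taylor_poly (fun k => (-1) ^+ k.+1) N).[w]).
  apply: (@is_derive_sub_taylor _ (fun w => - expR (- w))).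
  have := @is_derive1_comp _ expR -%R w (expR (- w)) (-1).
  rewrite mulrN1; apply.
have F0 : expR (- 0) - (taylor_poly (fun k => (-1) ^+ k) N.+1).[0] = 0 :> R.
  by rewrite horner_taylor_polyS0 oppr0 expR0 subrr.
have [c /andP[c0 cy]] := mean_value_from0 dF F0 y0.
rewrite /G => ->; have := mulr_ge0 (IH c c0) y0.
suff -> : (taylor_poly (fun k => (-1) ^+ k.+1) N).[c] =
    - (taylor_poly (fun k => (-1) ^+ k) N).[c] :> R by move=> h; nra.
rewrite /taylor_poly !horner_poly -sumrN; apply: eq_bigr => k _.
by rewrite exprS !mulN1r !mulNr.
Qed.

(** Keeping an even number of terms makes this true for negative [y] too, so
    that it can be integrated against a law on the whole line. *)
Lemma le_exp_poly_double k y : (exp_poly k.*2).[y] <= expR y.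
Proof.
have [y0|/ltW y0] := leP 0 y.
  by have /andP[] := expR_taylor k.*2 y0; rewrite subr_ge0.
have := @expRN_taylor k.*2 (- y); rewrite oppr_ge0 => /(_ y0).
rewrite -muln2 exprM sqrr_sign mul1r opprK subr_ge0; apply: le_trans.
rewrite le_eqVlt; apply/orP; left; apply/eqP.
rewrite /exp_poly /taylor_poly !horner_poly; apply: eq_bigr => j _.
have e : (-1) ^+ j * (-1) ^+ j = 1 :> R by rewrite -expr2 sqrr_sign.
by rewrite [in RHS](exprNn y) [RHS]mulrACA e !mul1r.
Qed.

End Taylor.

(** * Sums of multiplicative functions that are at least 1 *)

Section Multiplicative.
Context {R : realType}.
Implicit Types (h : nat -> R) (l : seq nat) (N d : nat).

(** The condition [d %| n] is there for an induction on the list of primes: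
    expanding the factor of one prime [p] turns [d] into [d] or [d * p]. *)
Definition divisor_product h l N d : R :=
  \sum_(1 <= n < N.+1 | (d %| n)%N) \prod_(p <- l | (p %| n)%N) (1 + h p).

Lemma divisor_product_cons h p l N d : coprime d p ->
  divisor_product h (p :: l) N d =
    divisor_product h l N d + h p * divisor_product h l N (d * p).
Proof.
move=> dp; rewrite /divisor_product mulr_sumr.
rewrite [X in _ + X]big_mkcond/= [X in X + _]big_mkcond/= [LHS]big_mkcond/=.
rewrite -big_split/=; apply: eq_bigr => n _.
rewrite big_cons Gauss_dvd//.
case: (d %| n)%N => /=; last by rewrite addr0.
by case: ifP => _; rewrite ?addr0// mulrDl mul1r.
Qed.

Lemma divisor_product_nil h N d :
  divisor_product h [::] N d = (N %/ d)%:R.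
Proof.
rewrite /divisor_product divn_count_dvd natr_sum big_mkcond/=.
by apply: eq_bigr => n _; rewrite big_nil; case: (_ %| _)%N.
Qed.

Lemma divn_le_ratio N d : (0 < d)%N -> (N %/ d)%:R <= N%:R / d%:R :> R.
Proof.
by move=> d0; rewrite ler_pdivlMr ?ltr0n// -natrM ler_nat leq_divM.
Qed.

Lemma divn_ge_half_ratio N d : (0 < d <= N)%N ->
  N%:R / d%:R / 2 <= (N %/ d)%:R :> R.
Proof.
move=> /andP[d0 dN]; rewrite ler_pdivrMr// ler_pdivrMr ?ltr0n//.
rewrite -!natrM ler_nat.
have := ltn_ceil N d0; have : (0 < N %/ d)%N by rewrite divn_gt0.
by set q := (N %/ d)%N; nia.
Qed.

Definition distinct_primes l := uniq l && all prime l.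

Lemma distinct_primes_cons p l :
  distinct_primes (p :: l) -> [/\ p \notin l, prime p & distinct_primes l].
Proof. by move=> /andP[/=/andP[? ?] /andP[? ?]]; split => //; apply/andP. Qed.

Lemma coprime_distinct_prime p l q :
  prime p -> distinct_primes l -> p \notin l -> q \in l -> coprime p q.
Proof.
move=> pp /andP[_ /allP lp] pl ql; rewrite prime_coprime//.
by rewrite dvdn_prime2// ?lp//; apply: contra pl => /eqP ->.
Qed.

Lemma le_divisor_product h l N d : (forall p, prime p -> 0 <= h p) ->
  distinct_primes l -> (0 < d)%N -> {in l, forall p, coprime d p} ->
  divisor_product h l N d <= N%:R / d%:R * \prod_(p <- l) (1 + h p / p%:R).
Proof.
move=> h0; elim: l d => [|p l IH] d.
  by rewrite divisor_product_nil big_nil mulr1 => _ d0 _; exact: divn_le_ratio.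
move=> /distinct_primes_cons[pl pp dl] d0 dcop.
have p0 : (0 < p)%N by exact: prime_gt0.
rewrite divisor_product_cons ?dcop ?mem_head// big_cons.
have {}dcop : {in l, forall q, coprime d q}.
  by move=> q ql; rewrite dcop// inE ql orbT.
have H1 := IH d dl d0 dcop.
have /(IH _ dl) H2 : (0 < d * p)%N by rewrite muln_gt0 d0.
have /H2 {}H2 : {in l, forall q, coprime (d * p) q}.
  by move=> q ql; rewrite coprimeMl dcop//= (coprime_distinct_prime pp dl).
have := lerD H1 (ler_wpM2l (h0 p pp) H2).
move/le_trans; apply; rewrite natrM invfM le_eqVlt; apply/orP; left; apply/eqP.
set P := \prod_(_ <- _) _; ring.
Qed.

Lemma prod_ge1 (F : nat -> R) l : (forall p, p \in l -> 0 <= F p) ->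
  1 <= \prod_(p <- l) (1 + F p).
Proof.
move=> F0; rewrite big_seq_cond; apply: (big_ind (fun x => 1 <= x)) => //.
  by move=> x y x1 y1; rewrite -[1]mulr1 ler_pM.
by move=> p /andP[pl _]; rewrite lerDl F0.
Qed.

(** The quotient [N %/ d] is at least N / (2d) * (1 - log d / log N): for
    [d <= N] it is at least N / (2d), and for [d > N] the bound is not positive.
    This minorant is additive in log d, which lets the induction on [l] charge
    to each prime its average contribution to log d. *)
Lemma ge_divisor_product h l N d : (1 < N)%N ->
  (forall p, prime p -> 0 <= h p) ->
  distinct_primes l -> (0 < d)%N -> {in l, forall p, coprime d p} ->
  N%:R / d%:R / 2 * \prod_(p <- l) (1 + h p / p%:R) *
   (1 - ln d%:R / ln N%:R
      - \sum_(p <- l) h p / p%:R * (ln p%:R / ln N%:R))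
  <= divisor_product h l N d.
Proof.
move=> N1 h0.
have lN : 0 < ln N%:R :> R by rewrite ln_gt0// ltr1n.
elim: l d => [|p l IH] d.
  rewrite divisor_product_nil !big_nil mulr1 subr0 => _ d0 _.
  case: (leqP d N) => dN.
    apply: le_trans (divn_ge_half_ratio _); last by rewrite d0.
    rewrite ler_piMr ?divr_ge0//.
    by rewrite gerBl divr_ge0 ?(ltW lN)// ln_ge0 ?ler1n.
  apply: (@le_trans _ _ 0) => //; rewrite mulr_ge0_le0 ?divr_ge0//.
  rewrite subr_le0 ler_pdivlMr// mul1r ler_ln ?posrE ?ltr0n// ?ler_nat; lia.
move=> /distinct_primes_cons[pl pp dl] d0 dcop.
have p0 : (0 < p)%N by exact: prime_gt0.
rewrite divisor_product_cons ?dcop ?mem_head// !big_cons.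
have {}dcop : {in l, forall q, coprime d q}.
  by move=> q ql; rewrite dcop// inE ql orbT.
have H1 := IH d dl d0 dcop.
have /(IH _ dl) H2 : (0 < d * p)%N by rewrite muln_gt0 d0.
have /H2 {}H2 : {in l, forall q, coprime (d * p) q}.
  by move=> q ql; rewrite coprimeMl dcop//= (coprime_distinct_prime pp dl).
apply: le_trans (lerD H1 (ler_wpM2l (h0 p pp) H2)).
have P1 : 1 <= \prod_(q <- l) (1 + h q / q%:R).
  by apply: prod_ge1 => q ql; rewrite divr_ge0// h0//; case/andP: dl => _ /allP; exact.
move: P1; set P := \prod_(_ <- _) _; set S := \sum_(_ <- _) _ => P1.
rewrite natrM lnM ?posrE ?ltr0n// invfM.
have w0 : 0 <= h p / p%:R by rewrite divr_ge0// h0.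
have a0 : 0 <= ln p%:R / ln N%:R :> R.
  by rewrite divr_ge0 ?(ltW lN)// ln_ge0 ?ler1n.
have c0 : 0 <= N%:R / d%:R / 2 * P :> R.
  by rewrite mulr_ge0// ?divr_ge0// (le_trans _ P1).
rewrite -subr_ge0.
set w := h p / p%:R in w0 *; set a := ln p%:R / ln N%:R in a0 *.
rewrite [X in 0 <= X](_ : _ = N%:R / d%:R / 2 * P * (w * w * a)).
  by rewrite mulr_ge0// mulr_ge0// mulr_ge0.
rewrite mulrDl -/a /w; ring.
Qed.

Definition primes_upto N := [seq p <- index_iota 0 N.+1 | prime p].

Lemma distinct_primes_upto N : distinct_primes (primes_upto N).
Proof. by rewrite /distinct_primes filter_uniq ?iota_uniq// filter_all. Qed.

Lemma prod_distinct_primes_dvd l n : distinct_primes l ->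
  (\prod_(p <- l | (p %| n)%N) p %| n)%N.
Proof.
elim: l => [|p l IH]; first by rewrite big_nil dvd1n.
move=> /distinct_primes_cons[pl pp dl]; rewrite big_cons.
case: ifP => [pn|_]; last exact: IH.
rewrite Gauss_dvd ?pn ?IH// big_seq_cond.
apply: (big_ind (coprime p)) => [|x y px py|q /andP[ql _]].
- exact: coprimen1.
- by rewrite coprimeMr px.
- exact: (coprime_distinct_prime pp dl).
Qed.

Lemma sum_ln_distinct_primes_le l n : distinct_primes l -> (0 < n)%N ->
  \sum_(p <- l | (p %| n)%N) ln p%:R <= ln n%:R :> R.
Proof.
move=> dl n0.
have -> : \sum_(p <- l | (p %| n)%N) ln p%:R
    = ln (\prod_(p <- l | (p %| n)%N) p)%:R :> R.
  have : all prime l by case/andP: dl.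
  elim: l {dl} => [|p l IH]; first by rewrite !big_nil ln1.
  move=> /= /andP[pp al]; rewrite !big_cons; case: ifP => _; rewrite IH//.
  rewrite natrM lnM ?posrE ?ltr0n ?(prime_gt0 pp)//.
  rewrite big_seq_cond prodn_cond_gt0// => q /andP[ql _].
  by rewrite prime_gt0//; move/allP: al; exact.
have dv := prod_distinct_primes_dvd n dl.
rewrite ler_ln ?posrE ?ltr0n ?ler_nat//; last exact: dvdn_gt0 dv.
exact: dvdn_leq.
Qed.

(** Chebyshev's argument: log n is at least the sum of log p over the primes
    dividing n; sum this over n <= N. *)
Lemma sum_ln_div_le N :
  \sum_(p <- primes_upto N) ln p%:R / p%:R <= 2 * ln N%:R :> R.
Proof.
case: (posnP N) => [->|N0].
  rewrite /primes_upto/= big_nil mulr_ge0//.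
  by rewrite ln0.
have H : \sum_(p <- primes_upto N) ln p%:R * (N %/ p)%:R
   <= \sum_(1 <= n < N.+1) ln n%:R :> R.
  under eq_bigr do rewrite divn_count_dvd natr_sum mulr_sumr.
  rewrite exchange_big/= big_nat_cond [leRHS]big_nat_cond; apply: ler_sum.
  move=> n /andP[/andP[n0 nN] _].
  apply: le_trans (sum_ln_distinct_primes_le (distinct_primes_upto N) n0).
  rewrite [leRHS]big_mkcond/=; apply: ler_sum => p _.
  by case: (_ %| _)%N; rewrite ?mulr1 ?mulr0.
have H2 : \sum_(1 <= n < N.+1) ln n%:R <= N%:R * ln N%:R :> R.
  have -> : N%:R * ln N%:R = \sum_(1 <= n < N.+1) ln N%:R :> R.
    by rewrite sumr_const_nat subn1 mulr_natl.
  rewrite big_nat_cond [leRHS]big_nat_cond; apply: ler_sum => n /andP[/andP[n0 nN] _].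
  by rewrite ler_ln ?posrE ?ltr0n// ler_nat.
have H3 : N%:R / 2 * \sum_(p <- primes_upto N) ln p%:R / p%:R <=
    \sum_(p <- primes_upto N) ln p%:R * (N %/ p)%:R :> R.
  rewrite mulr_sumr big_seq_cond [leRHS]big_seq_cond; apply: ler_sum => p.
  rewrite mem_filter mem_index_iota/= ltnS => /andP[/andP[pp pN] _].
  have := @divn_ge_half_ratio N p; rewrite (prime_gt0 pp) pN => /(_ isT).
  have l0 : 0 <= ln p%:R :> R by rewrite ln_ge0// ler1n prime_gt0.
  move=> /(ler_wpM2l l0); apply: le_trans.
  by rewrite le_eqVlt; apply/orP; left; apply/eqP; ring.
have := le_trans H3 (le_trans H H2).
rewrite -mulrA ler_pM2l ?ltr0n//.
by rewrite mulrC ler_pdivrMr// mulrC.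
Qed.

(** For [h <= 1/4] the total charge in [ge_divisor_product] is at most 1/2, by
    [sum_ln_div_le]. *)
Lemma sum_divisor_product_bounds h N : (1 < N)%N ->
  (forall p, prime p -> 0 <= h p <= 4^-1) ->
  N%:R / 4 * \prod_(p <- primes_upto N) (1 + h p / p%:R) <=
  \sum_(1 <= n < N.+1) \prod_(p <- primes_upto N | (p %| n)%N) (1 + h p)
  <= N%:R * \prod_(p <- primes_upto N) (1 + h p / p%:R).
Proof.
move=> N1 h14; set S := \sum_(1 <= n < _) _.
set Q := \prod_(p <- _) (1 + h p / p%:R).
have h0 p : prime p -> 0 <= h p by move=> /h14/andP[].
have -> : S = divisor_product h (primes_upto N) N 1.
  by apply: eq_bigl => n; rewrite dvd1n.
have cop : {in primes_upto N, forall p, coprime 1 p} by move=> p _; rewrite coprime1n.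
have := @le_divisor_product h _ N 1 h0 (distinct_primes_upto N) erefl cop.
have := @ge_divisor_product h _ N 1 N1 h0 (distinct_primes_upto N) erefl cop.
rewrite !divr1 ln1 mul0r subr0 -/Q => H ->; rewrite andbT.
apply: le_trans H.
have Q0 : 0 <= Q.
  apply: (le_trans ler01); apply: prod_ge1 => p; rewrite mem_filter => /andP[pp _].
  by rewrite divr_ge0// h0.
have lN : 0 < ln N%:R :> R by rewrite ln_gt0// ltr1n.
have : \sum_(p <- primes_upto N) h p / p%:R * (ln p%:R / ln N%:R) <= 2^-1.
  apply: (@le_trans _ _ (\sum_(p <- primes_upto N) (4^-1 / ln N%:R) * (ln p%:R / p%:R))).
    rewrite big_seq_cond [leRHS]big_seq_cond; apply: ler_sum => p.
    rewrite mem_filter => /andP[/andP[pp _] _].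
    have l0 : 0 <= ln p%:R :> R by rewrite ln_ge0// ler1n prime_gt0.
    have /andP[_ hp] := h14 _ pp.
    rewrite [leLHS](_ : _ = h p * (ln p%:R / p%:R / ln N%:R)); last by ring.
    rewrite [leRHS](_ : _ = 4^-1 * (ln p%:R / p%:R / ln N%:R)); last by ring.
    by rewrite ler_wpM2r// divr_ge0 ?(ltW lN)// divr_ge0.
  rewrite -mulr_sumr -mulrA.
  rewrite (_ : 2^-1 = 4^-1 * 2); last by field.
  rewrite ler_pM2l// mulrC ler_pdivrMr//.
  exact: sum_ln_div_le.
set s := \sum_(_ <- _) _ => sle.
rewrite (_ : N%:R / 4 * Q = N%:R / 2 * Q * 2^-1); last by field.
apply: ler_wpM2l; [|lra].
by rewrite mulr_ge0.
Qed.

End Multiplicative.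

Section StronglyAdditive.
Context {R : realType}.
Variables (f : nat -> R).
Hypothesis fadd : strongly_additive f.

(** Strip from [n] the full power of its least prime factor. *)
Lemma strongly_additiveE n N : (0 < n <= N)%N ->
  f n = \sum_(p <- primes_upto N | (p %| n)%N) f p.
Proof.
case: fadd => fpow fmul.
have f1 : f 1%N = 0.
  have := fmul 1%N 1%N isT isT isT; rewrite mul1n => /eqP.
  by rewrite -subr_eq0 opprD addNKr oppr_eq0 => /eqP.
elim/ltn_ind: n => n IH /andP[n0 nN].
have [n1|n1] := leqP n 1.
  have -> : n = 1%N by apply/eqP; rewrite eqn_leq n1.
  rewrite f1 big_seq_cond big_pred0// => p.
  by rewrite mem_filter dvdn1; apply/negP => /andP[/andP[pp _] /eqP p1]; move: pp; rewrite p1.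
set p := pdiv n; have pp : prime p by exact: pdiv_prime.
have pn : (p %| n)%N by exact: pdiv_dvd.
have k0 : (0 < logn p n)%N by rewrite logn_gt0 mem_primes pp n0.
set r := (n`_p^')%N.
have r0 : (0 < r)%N by exact: part_gt0.
have nE : n = (p ^ logn p n * r)%N by rewrite -p_part partnC.
have cpr : coprime (p ^ logn p n) r by rewrite -p_part coprime_partC.
have prN : ~~ (p %| r)%N.
  by rewrite -prime_coprime// -(coprime_pexpl _ _ k0).
have rn : (r < n)%N.
  rewrite [X in (_ < X)%N]nE ltn_Pmull// -(exp1n (logn p n)) ltn_exp2r//.
  exact: prime_gt1.
have fn : f n = f p + f r by rewrite {1}nE fmul// ?expn_gt0 ?prime_gt0// fpow.
have dvE q : prime q -> (q %| n)%N = (q == p) || (q %| r)%N.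
  move=> qp; rewrite nE Euclid_dvdM// Euclid_dvdX// k0 andbT.
  by rewrite dvdn_prime2.
rewrite fn (IH r rn) ?r0 ?(leq_trans (ltnW rn))//.
rewrite [RHS]big_mkcond [RHS](bigD1_seq p)/=; last 2 first.
- by rewrite mem_filter pp mem_index_iota/= ltnS (leq_trans _ nN)// dvdn_leq.
- by case/andP: (distinct_primes_upto N).
rewrite pn; congr (_ + _).
rewrite big_mkcond [RHS]big_mkcond big_seq_cond [RHS]big_seq_cond.
apply: eq_bigr => q; rewrite mem_filter => /andP[/andP[qp _] _].
by rewrite (dvE _ qp); case: eqVneq => [->|//] /=; rewrite (negbTE prN).
Qed.

End StronglyAdditive.

(** * The moment generating function of an additive function *)

Section AdditiveMgf.
Context {R : realType}.
Implicit Types (m : nat -> R) (N : nat) (s x : R).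

(** Truncation of the power series in s of the integral of
    (e^(su) - 1 - su) / u^2 against a law with moments [m]. *)
Definition levy_poly m N : {poly R} :=
  \poly_(k < N) (if (1 < k)%N then m (k - 2)%N / k`!%:R else 0).

Definition additive_mgf (f : nat -> R) x s : R :=
  (\sum_(1 <= n < (Num.truncn x).+1) expR (s * (f n - add_mean f x))) / x.

(** The k-th moment of the law with distribution function
    [prime_values_cdf f x]. *)
Definition prime_moment (f : nat -> R) x k : R :=
  (add_variance f x)^-1 * \sum_(0 <= p < (Num.truncn x).+1 | prime p)
    f p ^+ k.+2 / p%:R * (1 - p%:R^-1).

Lemma sum_primes_upto (G : nat -> R) n :
  \sum_(0 <= p < n.+1 | prime p) G p = \sum_(p <- primes_upto n) G p.
Proof. by rewrite big_filter. Qed.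

Lemma sum_inv_sqr_le n : \sum_(p <- primes_upto n) (p%:R ^+ 2)^-1 <= 2 :> R.
Proof.
apply: (@le_trans _ _ (\sum_(1 <= p < n.+1) (p%:R ^+ 2)^-1)).
  rewrite big_filter [leRHS]big_nat_cond /index_iota subn0 subn1/= big_cons/=.
  rewrite big_mkcond big_seq_cond [leRHS]big_mkcond [leRHS]big_seq_cond.
  apply: ler_sum => p.
  rewrite mem_iota => /andP[/andP[p0 pn] _].
  rewrite p0 add1n in pn *; rewrite /= pn; case: ifP => // _.
suff : \sum_(1 <= p < n.+1) (p%:R ^+ 2)^-1 <= 2 - n%:R^-1 :> R.
  by move/le_trans; apply; rewrite gerBl invr_ge0.
elim: n => [|[_|n IH]]; first by rewrite big_geq// invr0; lra.
  by rewrite big_nat1 expr1n !invr1; lra.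
rewrite big_nat_recr//= (le_trans (lerD IH (lexx _)))//.
have e : n.+2%:R = n.+1%:R + 1 :> R by rewrite natr1.
have : 0 < n.+1%:R :> R by [].
rewrite e; set t := n.+1%:R => t0.
rewrite -subr_ge0 (_ : _ - _ = (t * (t + 1) ^+ 2)^-1).
  by rewrite invr_ge0 mulr_ge0 ?exprn_ge0 ?addr_ge0// ltW.
field; apply/andP; split; lra.
Qed.

Lemma expR_le_inv (y : R) : y < 1 -> expR y <= (1 - y)^-1.
Proof.
move=> y1; rewrite -[y in expR y]opprK expRN lef_pV2 ?posrE ?expR_gt0 ?subr_gt0//.
exact: expR_ge1Dx.
Qed.

Lemma le_expR_quad (w : R) : 0 <= w -> expR (w - w ^+ 2) <= 1 + w.
Proof.
move=> w0; have w1 : 0 < 1 + w by lra.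
apply: (@le_trans _ _ (expR (w / (1 + w)))).
  rewrite ler_expR ler_pdivlMr//.
  have := mulr_ge0 w0 (mulr_ge0 w0 w0); rewrite expr2; nra.
rewrite (le_trans (expR_le_inv _))//; first by rewrite ltr_pdivrMr//; lra.
rewrite le_eqVlt; apply/orP; left; apply/eqP; field; rewrite gt_eqF//=; lra.
Qed.

Lemma additive_mgfE f x s : strongly_additive f ->
  additive_mgf f x s = expR (- (s * add_mean f x)) / x *
  \sum_(1 <= n < (Num.truncn x).+1)
     \prod_(p <- primes_upto (Num.truncn x) | (p %| n)%N) (1 + (expR (s * f p) - 1)).
Proof.
move=> fadd; rewrite /additive_mgf mulrAC; congr (_ * _); rewrite mulr_sumr.
rewrite big_nat_cond [RHS]big_nat_cond; apply: eq_bigr => n /andP[nN _].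
rewrite mulrBr addrC expRD; congr (_ * _).
rewrite (strongly_additiveE fadd nN) mulr_sumr expR_sum.
by apply: eq_bigr => p _; rewrite addrC subrK.
Qed.

Lemma exp_poly_drop2 N (y : R) : (1 < N)%N ->
  \sum_(k < N) (if (1 < k)%N then (k`!%:R)^-1 * y ^+ k else 0) =
  (exp_poly N).[y] - 1 - y.
Proof.
case: N => [|[|N]] // _; rewrite /exp_poly /taylor_poly horner_poly.
rewrite !big_ord_recl/= !add0r !fact0 !divr1 expr0 expr1 !mul1r.
set S := (X in _ = 1 + (y + X) - 1 - y).
have -> : 1 + (y + S) - 1 - y = S by ring.
by apply: eq_bigr => k _; rewrite div1r.
Qed.

Lemma variance_levy_poly f N x s : (1 < N)%N -> add_variance f x != 0 ->
  add_variance f x * (levy_poly (prime_moment f x) N).[s] =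
  \sum_(p <- primes_upto (Num.truncn x))
    ((exp_poly N).[s * f p] - 1 - s * f p) / p%:R * (1 - p%:R^-1).
Proof.
move=> N1 V0; rewrite horner_poly mulr_sumr.
under [RHS]eq_bigr do rewrite -exp_poly_drop2// !mulr_suml.
rewrite [RHS]exchange_big/=; apply: eq_bigr => k _.
case: ifP => k1; last by rewrite mul0r mulr0 big1// => p _; rewrite !mul0r.
rewrite /prime_moment sum_primes_upto -!mulrA mulVKf// mulr_suml.
apply: eq_bigr => p _.
rewrite (_ : (k - 2).+2 = k); last by move: k1; lia.
by rewrite exprMn; ring.
Qed.

(** With h(p) = e^(s f(p)) - 1, the mean of e^(s (f(n) - mu)) is within constant
    factors of e^(-s mu) * prod (1 + h(p)/p), and this product within constant
    factors of exp (sum h(p)/p).  What remains in the exponent is the sum of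
    (e^(s f(p)) - 1 - s f(p)) / p.  The quadratic errors and the passage from
    1/p to (1 - 1/p)/p cost O(1), because the sum of 1/p^2 converges. *)
Lemma additive_mgf_bounds (f : nat -> R) (C : R) : strongly_additive f ->
  (forall p, prime p -> 0 <= f p <= C) ->
  exists s0 : R, [/\ 0 < s0, s0 <= 1 & forall N, (1 < N)%N ->
    exists2 B : R, 0 <= B & forall x s, 2 <= x -> 0 < add_variance f x ->
    0 <= s <= s0 ->
    expR (add_variance f x * (levy_poly (prime_moment f x) N).[s])
      <= 8 * expR 1 * additive_mgf f x s /\
    additive_mgf f x s <= 8 * expR 1 *
    expR (add_variance f x * ((levy_poly (prime_moment f x) N).[s] + B * s ^+ N))].
Proof.
move=> fadd fC.
have C0 : 0 <= C by have /andP[/le_trans] := fC 2%N isT; apply.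
have C1 : 0 < 8 * (C + 1) by rewrite mulr_gt0// ltr_wpDl.
(* with this bound, e^(s f p) <= e^(1/8) <= 5/4 *)
exists (8 * (C + 1))^-1; split; first by rewrite invr_gt0.
  rewrite invf_le1//; lra.
move=> N N1; exists (C ^+ (N - 2) * expR C).
  by rewrite mulr_ge0 ?exprn_ge0 ?expR_ge0.
move=> x s x2 V0 /andP[s0 s1].
have sC (p : nat) : prime p -> 0 <= s * f p <= 8^-1.
  move=> /fC/andP[f0 f1]; rewrite mulr_ge0//=.
  apply: (@le_trans _ _ ((8 * (C + 1))^-1 * (C + 1))).
    by rewrite ler_pM//; lra.
  by rewrite invfM mulfVK// gt_eqF// ltr_wpDl.
have s1' : s <= 1 by rewrite (le_trans s1)// invf_le1//; lra.
pose h (p : nat) := expR (s * f p) - 1.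
have h14 p : prime p -> 0 <= h p <= 4^-1.
  move=> /sC/andP[y0 y1]; rewrite subr_ge0 -expR0 ler_expR y0/=.
  rewrite lerBlDr (le_trans (expR_le_inv _))//; first lra.
  rewrite expR0; apply: (@le_trans _ _ ((7 / 8)^-1)); last by rewrite invf_div; lra.
  rewrite lef_pV2 ?posrE; lra.
set n := Num.truncn x.
have n1 : (1 < n)%N by rewrite /n truncn_gt_nat.
have /andP[nx xn] : n%:R <= x < n.+1%:R.
  by apply: truncn_itv; exact: le_trans (ler0n R 2) x2.
have := sum_divisor_product_bounds n1 h14.
set S := (X in _ <= X <= _); set Q := \prod_(p <- _) _.
move=> /andP[Sl Su].
pose r p := expR (s * f p) - 1 - s * f p.
have rp p : prime p -> 0 <= r p <= 4^-1.
  move=> pp; have /andP[_ h1] := h14 _ pp; have /andP[y0 _] := sC _ pp.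
  rewrite /r; apply/andP; split; first by rewrite -addrA -opprD subr_ge0 expR_ge1Dx.
  by rewrite (le_trans _ h1)// gerBl.
set L' := \sum_(p <- primes_upto n) r p / p%:R.
set L := \sum_(p <- primes_upto n) r p / p%:R * (1 - p%:R^-1).
have le_primes (F G : nat -> R) : (forall p, prime p -> F p <= G p) ->
    \sum_(p <- primes_upto n) F p <= \sum_(p <- primes_upto n) G p.
  move=> FG; rewrite big_seq_cond [leRHS]big_seq_cond; apply: ler_sum => p.
  by rewrite mem_filter => /andP[/andP[/FG]].
have pV p : prime p -> 0 <= (p%:R^-1 : R) <= 1.
  by move=> pp; rewrite invr_ge0 ler0n/= invf_le1 ?ler1n ?ltr0n prime_gt0.
have LL' : L <= L' <= L + 1.
  have -> : L' = L + \sum_(p <- primes_upto n) r p / p%:R ^+ 2.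
    by rewrite -big_split/=; apply: eq_bigr => p _; rewrite -exprVn; ring.
  rewrite lerDl lerD2l; apply/andP; split.
    apply: (@le_trans _ _ (\sum_(p <- primes_upto n) 0)); first by rewrite big1.
    apply: le_primes => p pp; have /andP[r0 _] := rp _ pp.
    by rewrite mulr_ge0// invr_ge0 exprn_ge0.
  apply: (@le_trans _ _ (4^-1 * 2)); last lra.
  apply: le_trans (ler_wpM2l _ (sum_inv_sqr_le n)) => //.
  rewrite mulr_sumr; apply: le_primes => p pp; have /andP[_ r1] := rp _ pp.
  by rewrite ler_wpM2r// invr_ge0 exprn_ge0.
have w0 p : prime p -> 0 <= p%:R^-1 * (1 - p%:R^-1) :> R.
  by move=> /pV/andP[p0 p1]; rewrite mulr_ge0// subr_ge0.
have y0 p : prime p -> 0 <= s * f p by move=> /sC/andP[].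
have LV : add_variance f x * (levy_poly (prime_moment f x) N).[s] <= L.
  rewrite variance_levy_poly ?gt_eqF//; apply: le_primes => p pp.
  rewrite -!mulrA ler_wpM2r ?w0// /r !lerB//.
  by have /andP[] := expR_taylor N (y0 p pp); rewrite subr_ge0.
have VL : L <= add_variance f x *
    ((levy_poly (prime_moment f x) N).[s] + C ^+ (N - 2) * expR C * s ^+ N).
  rewrite mulrDr variance_levy_poly ?gt_eqF// /add_variance sum_primes_upto -/n.
  rewrite mulr_suml -big_split/=; apply: le_primes => p pp.
  rewrite [leRHS](_ : _ = ((exp_poly N).[s * f p] - 1 - s * f p +
      f p ^+ 2 * (C ^+ (N - 2) * expR C * s ^+ N)) *
    (p%:R^-1 * (1 - p%:R^-1))); last by ring.
  rewrite -mulrA ler_wpM2r ?w0// /r.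
  have /andP[_ ey] := expR_taylor N (y0 p pp).
  have /andP[f0 f1] := fC p pp.
  suff : (s * f p) ^+ N * expR (s * f p) <=
      f p ^+ 2 * (C ^+ (N - 2) * expR C * s ^+ N) by lra.
  have -> : (s * f p) ^+ N = f p ^+ 2 * (f p ^+ (N - 2) * s ^+ N).
    by rewrite exprMn mulrA -exprD subnKC// mulrC.
  rewrite -(mulrA (f p ^+ 2)) ler_wpM2l ?exprn_ge0// -mulrA [leRHS](_ : _ = C ^+ (N - 2) * (s ^+ N * expR C)); last by ring.
  rewrite ler_pM ?mulr_ge0 ?exprn_ge0 ?expR_ge0// ?lerXn2r ?nnegrE//.
  rewrite ler_wpM2l ?exprn_ge0// ler_expR (le_trans _ f1)//.
  by rewrite ler_piMl.
have muE : s * add_mean f x = \sum_(p <- primes_upto n) s * f p / p%:R.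
  rewrite /add_mean sum_primes_upto mulr_sumr.
  by apply: eq_bigr => p _; rewrite mulrA.
have hr p : h p / p%:R = r p / p%:R + s * f p / p%:R.
  by rewrite -mulrDl /r subrK.
have sumh : \sum_(p <- primes_upto n) h p / p%:R = L' + s * add_mean f x.
  by rewrite muE -big_split/=; apply: eq_bigr => p _; rewrite hr.
have le_prod_primes (F G : nat -> R) : (forall p, prime p -> 0 <= F p <= G p) ->
    \prod_(p <- primes_upto n) F p <= \prod_(p <- primes_upto n) G p.
  move=> FG; rewrite big_seq_cond [leRHS]big_seq_cond; apply: ler_prod => p.
  by rewrite mem_filter => /andP[/andP[/FG]].
have hp0 p : prime p -> 0 <= h p / p%:R.
  by move=> /h14/andP[h0 _]; rewrite divr_ge0.
have Qu : expR (- (s * add_mean f x)) * Q <= expR L'.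
  rewrite -[L'](addrK (s * add_mean f x)) -sumh addrC expRD.
  rewrite ler_wpM2l ?expR_ge0// expR_sum; apply: le_prod_primes => p pp.
  by rewrite expR_ge1Dx andbT addr_ge0// hp0.
have Ql : expR (L' - 1) <= expR (- (s * add_mean f x)) * Q.
  apply: (@le_trans _ _ (expR (- (s * add_mean f x)) *
     expR (\sum_(p <- primes_upto n) (h p / p%:R - (h p / p%:R) ^+ 2)))).
    rewrite -expRD ler_expR sumrB sumh.
    rewrite [leRHS](_ : _ = L' - \sum_(p <- primes_upto n) (h p / p%:R) ^+ 2); last by ring.
    rewrite lerB//; apply: (@le_trans _ _ (4^-1 * 2)); last lra.
    apply: le_trans (ler_wpM2l _ (sum_inv_sqr_le n)) => //.
    rewrite mulr_sumr; apply: le_primes => p pp; have /andP[h0 h1] := h14 _ pp.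
    by rewrite expr_div_n ler_wpM2r ?invr_ge0 ?exprn_ge0// expr2; nra.
  rewrite ler_wpM2l ?expR_ge0// expR_sum; apply: le_prod_primes => p pp.
  by rewrite expR_ge0 le_expR_quad// hp0.
have x0 : 0 < x by lra.
have nx1 : n%:R / x <= 1 by rewrite ler_pdivrMr// mul1r.
have nx2 : 2^-1 <= n%:R / x.
  rewrite ler_pdivlMr// mulrC ler_pdivrMr//.
  have : (n.+1 <= n * 2)%N by rewrite muln2 -addnn -addn1 leq_add2l ltnW.
  by rewrite -(ler_nat R) natrM; exact: le_trans (ltW xn).
have e0 := expR_gt0 (- (s * add_mean f x)).
have mgfE : additive_mgf f x s = expR (- (s * add_mean f x)) / x * S.
  by rewrite additive_mgfE.
rewrite mgfE.
have E1 : 0 < expR 1 :> R by exact: expR_gt0.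
set E := expR (- _) in Qu Ql e0 mgfE *.
have Q0 : 0 <= E * Q by rewrite (le_trans _ Ql)// expR_ge0.
split.
  apply: (@le_trans _ _ (expR 1 * expR (L' - 1))).
    rewrite -expRD addrC subrK ler_expR (le_trans LV)//.
    by case/andP: LL'.
  apply: (@le_trans _ _ (expR 1 * (E * Q))); first by rewrite ler_pM2l.
  rewrite [leRHS](_ : _ = expR 1 * ((8 * E / x) * S)); last by ring.
  rewrite ler_pM2l//.
  apply: (@le_trans _ _ ((8 * E / x) * (n%:R / 4 * Q))); last first.
    by rewrite ler_wpM2l// !mulr_ge0 ?invr_ge0 ?(ltW x0) ?(ltW e0).
  rewrite (_ : 8 * E / x * (n%:R / 4 * Q) = (E * Q) * (2 * (n%:R / x))); last by field; exact: lt0r_neq0.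
  rewrite ler_peMr// -ler_pdivrMl// mulr1//.
apply: (@le_trans _ _ (1 * (E * Q))).
  rewrite mul1r (le_trans (ler_wpM2l _ Su))//; first by rewrite mulr_ge0 ?invr_ge0 ?(ltW x0) ?(ltW e0).
  rewrite (_ : E / x * (n%:R * Q) = (E * Q) * (n%:R / x)); last by ring.
  by rewrite ler_piMr.
rewrite mul1r (le_trans Qu)// (@le_trans _ _ (expR (L + 1)))//.
  by rewrite ler_expR; case/andP: LL'.
rewrite expRD mulrC ler_pM ?expR_ge0// ?ler_expR//.
by rewrite ler_peMl ?expR_ge0//; lra.
Qed.
End AdditiveMgf.

(** * Taylor's formula for the complex exponential *)

Section ComplexTaylor.
Local Open Scope complex_scope.
Local Notation normc := ComplexField.Normc.normc.
Local Notation Re := complex.Re.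
Local Notation Im := complex.Im.
Context {R : realType}.
Implicit Types (N n k : nat) (y t : R) (z w : R[i]) (p : {poly R}).

Lemma ReD z w : Re (z + w) = Re z + Re w. Proof. by case: z; case: w. Qed.
Lemma ImD z w : Im (z + w) = Im z + Im w. Proof. by case: z; case: w. Qed.
Lemma ReM z w : Re (z * w) = Re z * Re w - Im z * Im w.
Proof. by case: z => a b; case: w. Qed.
Lemma ImM z w : Im (z * w) = Re z * Im w + Im z * Re w.
Proof. by case: z => a b; case: w => c d /=. Qed.
Lemma ReN z : Re (- z) = - Re z. Proof. by case: z. Qed.
Lemma ImN z : Im (- z) = - Im z. Proof. by case: z. Qed.

Lemma Re_sum I (r : seq I) (P : pred I) (F : I -> R[i]) :
  Re (\sum_(i <- r | P i) F i) = \sum_(i <- r | P i) Re (F i).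
Proof. by elim/big_rec2: _ => // i x y _ <-; rewrite ReD. Qed.
Lemma Im_sum I (r : seq I) (P : pred I) (F : I -> R[i]) :
  Im (\sum_(i <- r | P i) F i) = \sum_(i <- r | P i) Im (F i).
Proof. by elim/big_rec2: _ => // i x y _ <-; rewrite ImD. Qed.

Lemma normc_ge0 z : 0 <= normc z.
Proof. by case: z => a b /=; exact: sqrtr_ge0. Qed.

Lemma normc_real y : normc y%:C = `|y|.
Proof. by rewrite /= expr0n/= addr0 sqrtr_sqr. Qed.

Lemma normcX z n : normc (z ^+ n) = normc z ^+ n.
Proof.
elim: n => [|n IH]; first by rewrite !expr0 ComplexField.Normc.normc1.
by rewrite !exprS ComplexField.Normc.normcM IH.
Qed.

Lemma Re_le_normc z : `|Re z| <= normc z.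
Proof.
by case: z => a b /=; rewrite -[leLHS]sqrtr_sqr ler_sqrt ?addr_ge0 ?sqr_ge0// lerDl sqr_ge0.
Qed.
Lemma Im_le_normc z : `|Im z| <= normc z.
Proof.
by case: z => a b /=; rewrite -[leLHS]sqrtr_sqr ler_sqrt ?addr_ge0 ?sqr_ge0// lerDr sqr_ge0.
Qed.

Lemma normc_le_ReIm z : normc z <= `|Re z| + `|Im z|.
Proof.
case: z => a b /=.
rewrite -[leRHS]ger0_norm ?addr_ge0// -[leRHS]sqrtr_sqr ler_sqrt ?sqr_ge0//.
rewrite sqrrD !real_normK ?num_real// addrAC lerDl mulrn_wge0// mulr_ge0//.
Qed.

Lemma normc_sum I (r : seq I) (P : pred I) (F : I -> R[i]) :
  normc (\sum_(i <- r | P i) F i) <= \sum_(i <- r | P i) normc (F i).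
Proof.
apply: (big_ind2 (fun z (y : R) => normc z <= y)) => //.
  by rewrite ComplexField.Normc.normc0.
by move=> z y w t zy wt; rewrite (le_trans (le_normcD z w))// lerD.
Qed.

Definition cexp_poly N z : R[i] := \sum_(k < N) z ^+ k / (k`!%:R).

Lemma natfact_neq0 k : (k`!%:R : R) != 0.
Proof. by rewrite pnatr_eq0 -lt0n fact_gt0. Qed.

Lemma Re_divn z k : Re (z / k%:R) = Re z / k%:R.
Proof.
rewrite -(rmorph_nat (real_complex R)) -fmorphV; case: z => a b /=.
by rewrite mulr0 subr0.
Qed.
Lemma Im_divn z k : Im (z / k%:R) = Im z / k%:R.
Proof.
rewrite -(rmorph_nat (real_complex R)) -fmorphV; case: z => a b /=.
by rewrite mulr0 add0r.
Qed.

(** Along the ray t z the derivatives of the two remainders of order [N.+1] are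
    linear combinations of those of order [N], so real calculus is enough. *)
Definition re_rem z N t : R :=
  expR (t * Re z) * cos (t * Im z) - (taylor_poly (fun k => Re (z ^+ k)) N).[t].
Definition im_rem z N t : R :=
  expR (t * Re z) * sin (t * Im z) - (taylor_poly (fun k => Im (z ^+ k)) N).[t].

Lemma is_derive_re_rem z N t :
  is_derive t 1 (re_rem z N.+1) (Re z * re_rem z N t - Im z * im_rem z N t).
Proof.
rewrite /re_rem /im_rem.
have -> : Re z * (expR (t * Re z) * cos (t * Im z) -
     (taylor_poly (fun k : nat => Re (z ^+ k)) N).[t]) -
  Im z * (expR (t * Re z) * sin (t * Im z) -
     (taylor_poly (fun k : nat => Im (z ^+ k)) N).[t]) =
  (Re z * (expR (t * Re z) * cos (t * Im z)) - Im z * (expR (t * Re z) * sin (t * Im z)))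
   - (taylor_poly (fun k => Re (z ^+ k.+1)) N).[t].
  rewrite (eq_taylor_poly N (_ : (fun k => Re (z ^+ k.+1)) =1
    (fun k => Re z * Re (z ^+ k) - Im z * Im (z ^+ k)))).
    by rewrite taylor_polyB; ring.
  by move=> k; rewrite exprS ReM.
apply: (@is_derive_sub_taylor _ _ (fun t => Re z * (expR (t * Re z) * cos (t * Im z)) - Im z * (expR (t * Re z) * sin (t * Im z)))).
have dl (a : R) : is_derive t 1 (fun u : R => u * a) a.
  apply: (is_derive_eq (@is_deriveM _ _ (@id R) (cst a) t 1 1 0 _ _)).
  by rewrite scaler0 add0r; exact: mulr1.
have d1 := @is_derive1_comp _ expR (fun u => u * Re z) t _ _ (is_derive_expR _) (dl _).
have d2 := @is_derive1_comp _ cos (fun u => u * Im z) t _ _ (is_derive_cos _) (dl _).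
have d4 := @is_deriveM _ _ _ _ t 1 _ _ d1 d2.
apply: (is_derive_eq d4); rewrite /= /GRing.scale/=; ring.
Qed.

Lemma is_derive_im_rem z N t :
  is_derive t 1 (im_rem z N.+1) (Re z * im_rem z N t + Im z * re_rem z N t).
Proof.
rewrite /re_rem /im_rem.
have -> : Re z * (expR (t * Re z) * sin (t * Im z) -
     (taylor_poly (fun k : nat => Im (z ^+ k)) N).[t]) +
  Im z * (expR (t * Re z) * cos (t * Im z) -
     (taylor_poly (fun k : nat => Re (z ^+ k)) N).[t]) =
  (Re z * (expR (t * Re z) * sin (t * Im z)) + Im z * (expR (t * Re z) * cos (t * Im z)))
   - (taylor_poly (fun k => Im (z ^+ k.+1)) N).[t].
  rewrite (eq_taylor_poly N (_ : (fun k => Im (z ^+ k.+1)) =1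
    (fun k => Re z * Im (z ^+ k) - (- Im z) * Re (z ^+ k)))).
    by rewrite taylor_polyB; ring.
  by move=> k; rewrite exprS ImM mulNr opprK.
apply: (@is_derive_sub_taylor _ _ (fun t => Re z * (expR (t * Re z) * sin (t * Im z)) + Im z * (expR (t * Re z) * cos (t * Im z)))).
have dl (a : R) : is_derive t 1 (fun u : R => u * a) a.
  apply: (is_derive_eq (@is_deriveM _ _ (@id R) (cst a) t 1 1 0 _ _)).
  by rewrite scaler0 add0r; exact: mulr1.
have d1 := @is_derive1_comp _ expR (fun u => u * Re z) t _ _ (is_derive_expR _) (dl _).
have d2 := @is_derive1_comp _ sin (fun u => u * Im z) t _ _ (is_derive_sin _) (dl _).
have d4 := @is_deriveM _ _ _ _ t 1 _ _ d1 d2.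
apply: (is_derive_eq d4); rewrite /= /GRing.scale/=; ring.
Qed.

(** Only [Re z] occurs in an exponential: for imaginary [z] the bound is a power
    and can be integrated against any law with finite moments. *)
Lemma re_im_rem_bound z N t : 0 <= t <= 1 ->
  let K := expR `|Re z| * (`|Re z| + `|Im z|) ^+ N in
  `|re_rem z N t| <= K /\ `|im_rem z N t| <= K.
Proof.
elim: N t => [|N IH] t /andP[t0 t1] K.
  rewrite /K /re_rem /im_rem /taylor_poly !poly_def !big_ord0 !horner0 !subr0 expr0 mulr1.
  have e : expR (t * Re z) <= expR `|Re z|.
    rewrite ler_expR (le_trans (ler_norm _))// normrM ger0_norm//.
    by rewrite ler_piMl.
  rewrite !normrM (ger0_norm (expR_ge0 _)).
  by split; rewrite -[leRHS]mulr1 ler_pM ?expR_ge0// ?cos_max ?sin_max.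
have r0 : re_rem z N.+1 0 = 0.
  by rewrite /re_rem horner_taylor_polyS0 !mul0r expR0 cos0 mulr1 expr0 subrr.
have i0 : im_rem z N.+1 0 = 0.
  by rewrite /im_rem horner_taylor_polyS0 !mul0r expR0 sin0 mulr0 expr0 subrr.
have [c /andP[c0 ct] ->] := mean_value_from0 (is_derive_re_rem z N) r0 t0.
have [d /andP[d0 dt] ->] := mean_value_from0 (is_derive_im_rem z N) i0 t0.
have [|hr1 hi1] := IH c; first by rewrite c0 (le_trans ct).
have [|hr2 hi2] := IH d; first by rewrite d0 (le_trans dt).
have KE : K = `|Re z| * (expR `|Re z| * (`|Re z| + `|Im z|) ^+ N) +
      `|Im z| * (expR `|Re z| * (`|Re z| + `|Im z|) ^+ N).
  by rewrite /K exprS; ring.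
clearbody K; split; rewrite normrM (ger0_norm t0) -[K]mulr1 ler_pM// KE.
- by rewrite (le_trans (ler_normB _ _))// !normrM lerD// ler_wpM2l.
- by rewrite (le_trans (ler_normD _ _))// !normrM lerD// ler_wpM2l.
Qed.

Lemma cexp_taylor z N :
  normc (cexp z - cexp_poly N z) <= 2 * (expR (normc z) * (2 * normc z) ^+ N).
Proof.
rewrite (le_trans (normc_le_ReIm _))// mulr_natl mulr2n.
have [|h1 h2] := @re_im_rem_bound z N 1; first by rewrite ler01 lexx.
have K : expR `|Re z| * (`|Re z| + `|Im z|) ^+ N <= expR (normc z) * (2 * normc z) ^+ N.
  rewrite ler_pM ?expR_ge0 ?exprn_ge0 ?addr_ge0// ?ler_expR ?Re_le_normc//.
  rewrite lerXn2r ?nnegrE ?addr_ge0 ?mulr_ge0 ?normc_ge0//.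
  by rewrite mulr_natl mulr2n lerD ?Re_le_normc ?Im_le_normc.
have ReE : Re (cexp z - cexp_poly N z) = re_rem z N 1.
  rewrite ReD ReN Re_sum /re_rem !mul1r /taylor_poly horner_poly; congr (_ - _).
  by apply: eq_bigr => k _; rewrite expr1n mulr1 Re_divn.
have ImE : Im (cexp z - cexp_poly N z) = im_rem z N 1.
  rewrite ImD ImN Im_sum /im_rem !mul1r /taylor_poly horner_poly; congr (_ - _).
  by apply: eq_bigr => k _; rewrite expr1n mulr1 Im_divn.
by rewrite ReE ImE lerD// (le_trans _ K).
Qed.

End ComplexTaylor.

(** * The Levy exponent of a compactly supported law *)

Section Moments.
Local Open Scope complex_scope.
Local Notation normc := ComplexField.Normc.normc.
Local Notation Re := complex.Re.
Local Notation Im := complex.Im.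
Context {R : realType} (Psi : cumulativeBounded (0 : R) (1 : R)).
Variable alpha : R.
Hypotheses (alpha0 : 0 < alpha) (Psi_supp : Psi alpha - Psi 0 = 1).

Let mu := lebesgue_stieltjes_measure Psi.
Let D : set R := `]0, alpha].

Lemma stieltjes_itv (a b : R) : a <= b -> mu `]a, b] = (Psi b - Psi a)%:E.
Proof.
move=> ab; rewrite /mu /lebesgue_stieltjes_measure /measure_extension/=.
rewrite measurable_mu_extE/=; last exact: is_ocitv.
by rewrite wlength_itv_bnd.
Qed.

Lemma support_mass1 : mu D = 1%E.
Proof. by rewrite stieltjes_itv ?Psi_supp// ltW. Qed.

Lemma complement_mass0 : mu (~` D) = 0%E.
Proof.
have measurable_support : measurable (D : set (measurableTypeR R)) by exact: measurable_itv.
apply: (eq_trans (probability_setC mu measurable_support)).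
by rewrite -[0%E](subee (isT : 1%E \is a fin_num)); congr (_ - _)%E; exact: support_mass1.
Qed.

Lemma measurable_support : measurable D. Proof. exact: measurable_itv. Qed.

Lemma measurable_inv_real : measurable_fun [set: R] (fun x : R => x^-1).
Proof.
rewrite (_ : (fun x : R => x^-1) = (fun x => if x == 0 then 0 else x^-1)); last first.
  by apply/funext => x; case: eqP => // ->; rewrite invr0.
apply: measurable_fun_if => //.
- exact: measurable_fun_eqr.
- rewrite setTI (_ : _ @^-1` _ = [set x | x != 0]); last first.
    by apply/seteqP; split => x /=; case: (x == 0).
  apply: open_continuous_measurable_fun; first exact: open_neq.
  by move=> x; rewrite inE/= => x0; exact: inv_continuous.
Qed.

Lemma integrable_supp (g : R -> R) (M : R) : measurable_fun setT g ->
  (forall x, D x -> `|g x| <= M) -> mu.-integrable D (EFin \o g).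
Proof.
move=> mg gM; apply: measurable_bounded_integrable => //.
- exact: measurable_support.
- exact: (eq_ind_r (fun z => (z < +oo)%E) (ltry 1) support_mass1).
- exact: measurable_funTS.
- exists M; split; first exact: num_real.
  by move=> y My x /= Dx; rewrite (le_trans (gM _ Dx))// ltW.
Qed.

(** Turns integrals over the line, as in [cintegral], into integrals over the
    bounded set ]0, alpha], where continuous functions are integrable. *)
Lemma Rintegral_supp (g : R -> R) (M : R) : measurable_fun setT g ->
  (forall x, D x -> `|g x| <= M) ->
  \int[mu]_x g x = \int[mu]_(x in D) g x.
Proof.
move=> mg gM; congr fine.
rewrite (@negligible_integral _ _ _ mu setT (~` D))//; last 3 first.
- exact: measurableC measurable_support.
- have mfE : measurable_fun setT (EFin \o g) by exact/measurable_EFinP.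
  apply: (@negligible_integrable _ _ _ mu setT (~` D) _ (measurableC measurable_support)
    measurableT mfE complement_mass0).2.
  rewrite setTD setCK; exact: (integrable_supp mg gM).
- exact: complement_mass0.
by rewrite setTD setCK.
Qed.


Definition moment k : R := \int[mu]_x x ^+ k.

Lemma pow_supp k (x : R) : D x -> 0 <= x ^+ k <= alpha ^+ k.
Proof.
rewrite /D/= in_itv/= => /andP[x0 xa].
by rewrite exprn_ge0 ?(ltW x0)//= lerXn2r ?nnegrE ?(ltW x0) ?(ltW alpha0).
Qed.

Lemma normr_pow_supp k (x : R) : D x -> `|x ^+ k| <= alpha ^+ k.
Proof. by move=> /(pow_supp k)/andP[x0 xa]; rewrite ger0_norm. Qed.

Lemma measurable_pow k : measurable_fun [set: R] (fun x : R => x ^+ k).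
Proof. exact: measurable_funX. Qed.

Lemma momentE k : moment k = \int[mu]_(x in D) x ^+ k.
Proof. exact: (Rintegral_supp (measurable_pow k) (@normr_pow_supp k)). Qed.

Lemma integrable_pow k : mu.-integrable D (EFin \o (fun x : R => x ^+ k)).
Proof. exact: (integrable_supp (measurable_pow k) (@normr_pow_supp k)). Qed.

Lemma Rintegral_cst_supp (c : R) : \int[mu]_(x in D) c = c.
Proof.
rewrite Rintegral_cst; last exact: measurable_support.
by rewrite [fine _](congr1 fine support_mass1) mulr1.
Qed.

Lemma moment_bounds k : 0 <= moment k <= alpha ^+ k.
Proof.
rewrite momentE; apply/andP; split.
  by apply: Rintegral_ge0 => x /(pow_supp k)/andP[].
rewrite -[leRHS]Rintegral_cst_supp; apply: le_Rintegral.
- exact: measurable_support.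
- exact: integrable_pow.
- by apply: (integrable_supp (M := `|alpha ^+ k|)) => //; exact: measurable_cst.
- by move=> x /(pow_supp k)/andP[].
Qed.

Lemma moment0 : moment 0 = 1.
Proof. by rewrite momentE Rintegral_cst_supp. Qed.

Lemma sum_pow_supp (c : nat -> R) n : exists M, forall x, D x ->
  `|\sum_(k < n) c k * x ^+ k| <= M.
Proof.
exists (\sum_(k < n) `|c k| * alpha ^+ k) => x Dx.
rewrite (le_trans (ler_norm_sum _ _ _))//; apply: ler_sum => k _.
by rewrite normrM ler_wpM2l// normr_pow_supp.
Qed.

Lemma measurable_sum_pow (c : nat -> R) n :
  measurable_fun [set: R] (fun x : R => \sum_(k < n) c k * x ^+ k).
Proof.
apply: measurable_sum => k; apply: measurable_funM; first exact: measurable_cst.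
exact: measurable_funX.
Qed.

Lemma integrable_sum_pow (c : nat -> R) n :
  mu.-integrable D (EFin \o (fun x : R => \sum_(k < n) c k * x ^+ k)).
Proof.
have [M] := sum_pow_supp c n; exact: (integrable_supp (measurable_sum_pow c n)).
Qed.

Lemma Rintegral_sum_pow (c : nat -> R) n :
  \int[mu]_(x in D) (\sum_(k < n) c k * x ^+ k) = \sum_(k < n) c k * moment k.
Proof.
elim: n => [|n IH].
  rewrite big_ord0 -[RHS](Rintegral_cst_supp 0); apply: eq_Rintegral => x _.
  by rewrite big_ord0.
rewrite big_ord_recr/= -IH momentE -RintegralZl; [|exact: measurable_support|exact: integrable_pow].
rewrite -RintegralD; [|exact: measurable_support|exact: integrable_sum_pow|].
  by apply: eq_Rintegral => x _; rewrite big_ord_recr.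
apply: (integrable_supp (M := `|c n| * alpha ^+ n)).
  by apply: measurable_funM; [exact: measurable_cst|exact: measurable_funX].
by move=> x Dx; rewrite normrM ler_wpM2l// normr_pow_supp.
Qed.

Lemma Rintegral_poly (p : {poly R}) :
  \int[mu]_(x in D) p.[x] = \sum_(k < size p) p`_k * moment k.
Proof.
rewrite -Rintegral_sum_pow; apply: eq_Rintegral => x _; exact: horner_coef.
Qed.

Lemma Re_divr (z : R[i]) (r : R) : Re (z / r%:C) = Re z / r.
Proof. by rewrite -fmorphV; case: z => a b /=; rewrite mulr0 subr0. Qed.
Lemma Im_divr (z : R[i]) (r : R) : Im (z / r%:C) = Im z / r.
Proof. by rewrite -fmorphV; case: z => a b /=; rewrite mulr0 add0r. Qed.

Lemma Re_levy (t x : R) : Re (levy_integrand t x) =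
  if x == 0 then - t ^+ 2 / 2 else (cos (t * x) - 1) * (x ^+ 2)^-1.
Proof.
rewrite /levy_integrand; case: ifP => // _.
by rewrite Re_divr !ReD !ReN /= expR0 mul1r oppr0 addr0.
Qed.

Lemma Im_levy (t x : R) : Im (levy_integrand t x) =
  if x == 0 then 0 else (sin (t * x) - t * x) * (x ^+ 2)^-1.
Proof.
rewrite /levy_integrand; case: ifP => // _.
by rewrite Im_divr !ImD !ImN /= expR0 mul1r oppr0 addr0.
Qed.

Lemma measurable_levy_aux (F : R -> R) (c : R) : measurable_fun setT F ->
  measurable_fun [set: R] (fun x : R => if x == 0 then c else F x * (x ^+ 2)^-1).
Proof.
move=> mF; apply: measurable_fun_ifT => //; first exact: measurable_fun_eqr.
apply: measurable_funM => //.
apply: (@measurableT_comp _ _ _ _ _ _ (fun x : R => x^-1)); first exact: measurable_inv_real.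
exact: measurable_funX.
Qed.

Lemma measurable_Re_levy (t : R) : measurable_fun [set: R] (fun x => Re (levy_integrand t x)).
Proof.
under eq_fun do rewrite Re_levy; apply: measurable_levy_aux.
apply: measurable_funB => //; apply: measurableT_comp => //.
by apply: continuous_measurable_fun; exact: continuous_cos.
Qed.

Lemma measurable_Im_levy (t : R) : measurable_fun [set: R] (fun x => Im (levy_integrand t x)).
Proof.
under eq_fun do rewrite Im_levy; apply: measurable_levy_aux.
apply: measurable_funB => //; apply: measurableT_comp => //.
by apply: continuous_measurable_fun; exact: continuous_sin.
Qed.

(** Expansion of the integrand in powers of t; the division by x^2 lowers the
    exponent of x by two. *)
Definition levy_taylor n (t x : R) : R[i] :=
  \sum_(k < n) (('i * t%:C) ^+ k.+2 / (k.+2)`!%:R) * (x ^+ k)%:C.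

Lemma levy_taylor_bound n (t x : R) : 0 < t <= 1 -> D x ->
  normc (levy_integrand t x - levy_taylor n t x) <=
    2 * expR alpha * 2 ^+ n.+2 * alpha ^+ n * t ^+ n.+2.
Proof.
move=> /andP[t0 t1]; rewrite /D/= in_itv/= => /andP[x0 xa].
have xn0 : x != 0 by rewrite gt_eqF.
pose z : R[i] := 'i * t%:C * x%:C.
have nz : normc z = t * x.
  by rewrite /z !ComplexField.Normc.normcM !normc_real /= expr0n expr1n add0r sqrtr1 mul1r !gtr0_norm.
have zE : z = 0 +i* (t * x).
  by rewrite /z; apply/eqP; rewrite eq_complex /=; apply/andP; split; apply/eqP; ring.
have -> : levy_integrand t x - levy_taylor n t x =
    (cexp z - cexp_poly n.+2 z) / (x ^+ 2)%:C.
  rewrite /levy_integrand (negbTE xn0) -zE /cexp_poly !big_ord_recl /=.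
  rewrite expr0 expr1 !divr1 /bump /= /levy_taylor.
  rewrite [X in _ = (_ - (1 + (z + X))) / _](_ : _ =
     (\sum_(k < n) ('i * t%:C) ^+ k.+2 / (k.+2)`!%:R * (x ^+ k)%:C) * (x ^+ 2)%:C).
    have x2 : (x ^+ 2)%:C != 0 :> R[i] by rewrite (inj_eq (@complexI R)) expf_neq0.
    set S := \sum_(k < n) _; set X := (x ^+ 2)%:C in x2 *.
    rewrite (_ : _ - (1 + (z + S * X)) = cexp z - z - 1 - S * X); last by ring.
    by rewrite [RHS]mulrBl mulfK.
  rewrite mulr_suml; apply: eq_bigr => k _.
  rewrite /z exprMn -[in RHS]mulrA -rmorphM -exprD addn2 rmorphXn.
  by rewrite !add1n mulrAC.
rewrite -fmorphV ComplexField.Normc.normcM normc_real gtr0_norm ?invr_gt0 ?exprn_gt0//.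
rewrite ler_pdivrMr ?exprn_gt0// (le_trans (cexp_taylor _ _))// nz.
rewrite [leRHS](_ : _ = 2 * (expR alpha * (2 ^+ n.+2 * (t ^+ n.+2 * (alpha ^+ n * x ^+ 2))))); last by ring.
have P0 : 0 <= 2 ^+ n.+2 * (t ^+ n.+2 * x ^+ n.+2).
  by apply: mulr_ge0; [|apply: mulr_ge0]; apply: exprn_ge0 => //; exact: ltW.
rewrite !exprMn ler_pM2l// ler_pM ?expR_ge0//.
  by rewrite ler_expR (le_trans _ xa)// ler_piMl// ltW.
rewrite ler_pM2l ?exprn_gt0// ler_pM2l ?exprn_gt0// -addn2 exprD ler_pM2r ?exprn_gt0//.
by rewrite lerXn2r ?nnegrE ?(ltW x0) ?(ltW alpha0).
Qed.

Lemma Rintegral_close (g h : R -> R) (M B : R) :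
  measurable_fun setT g -> measurable_fun setT h ->
  (forall x, D x -> `|h x| <= M) ->
  (forall x, D x -> `|g x - h x| <= B) ->
  `|\int[mu]_x g x - \int[mu]_(x in D) h x| <= B.
Proof.
move=> mg mh hM ghB.
have gM x : D x -> `|g x| <= B + M.
  move=> Dx; rewrite -[g x](subrK (h x)) (le_trans (ler_normD _ _))//.
  by rewrite lerD ?ghB ?hM.
rewrite (Rintegral_supp mg gM).
have ig := integrable_supp mg gM; have ih := integrable_supp mh hM.
have mgh : measurable_fun setT (fun x => g x - h x) by exact: measurable_funB.
rewrite -RintegralB//; last exact: measurable_support.
rewrite (le_trans (le_normr_Rintegral _ _))//; first exact: measurable_support.
  exact: (integrable_supp mgh ghB).
rewrite -[leRHS]Rintegral_cst_supp; apply: le_Rintegral.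
- exact: measurable_support.
- apply: (integrable_supp (M := B)); first exact: measurableT_comp.
  by move=> x Dx; rewrite normr_id ghB.
- by apply: (integrable_supp (M := `|B|)) => //; exact: measurable_cst.
- exact: ghB.
Qed.

Definition imag_eval (p : {poly R}) (t : R) : R[i] :=
  (map_poly (real_complex R) p).['i * t%:C].

Lemma imag_evalE (p : {poly R}) n (t : R) : (size p <= n)%N ->
  imag_eval p t = \sum_(k < n) (p`_k)%:C * ('i * t%:C) ^+ k.
Proof.
move=> pn; rewrite /imag_eval (@horner_coef_wide _ n).
  by apply: eq_bigr => k _; rewrite coef_map.
by rewrite (leq_trans _ pn)// size_poly.
Qed.

Lemma imag_eval_levy_poly (m : nat -> R) n (t : R) :
  imag_eval (levy_poly m n.+2) t =
  \sum_(k < n) (('i * t%:C) ^+ k.+2 / (k.+2)`!%:R) * (m k)%:C.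
Proof.
rewrite (@imag_evalE _ n.+2) ?size_poly// !big_ord_recl !coef_poly/= !mul0r !add0r.
apply: eq_bigr => k _; rewrite coef_poly /bump/= !add1n !ltnS ltn_ord subn2/=.
rewrite rmorphM fmorphV rmorph_nat; ring.
Qed.

Lemma ReMr (z : R[i]) (r : R) : Re (z * r%:C) = Re z * r.
Proof. by case: z => a b /=; rewrite mulr0 subr0. Qed.
Lemma ImMr (z : R[i]) (r : R) : Im (z * r%:C) = Im z * r.
Proof. by case: z => a b /=; rewrite mulr0 add0r. Qed.

(** Integrate [levy_taylor_bound], which is uniform on the support. *)
Lemma levy_jet n : exists2 B : R, 0 <= B & forall t : R, 0 < t <= 1 ->
  normc (cintegral mu (levy_integrand t) - imag_eval (levy_poly moment n.+2) t)
    <= B * t ^+ n.+2.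
Proof.
exists (2 * (2 * expR alpha * 2 ^+ n.+2 * alpha ^+ n)).
  by do ?[apply: exprn_ge0 | exact: expR_ge0 | exact: ltW | exact: ler0n | apply: mulr_ge0].
move=> t t01; rewrite (le_trans (normc_le_ReIm _))// ReD ImD ReN ImN.
rewrite -(mulrA 2) mulr_natl mulr2n.
have bd x : D x -> normc (levy_integrand t x - levy_taylor n t x) <=
    2 * expR alpha * 2 ^+ n.+2 * alpha ^+ n * t ^+ n.+2.
  by move=> Dx; exact: levy_taylor_bound.
pose cr k : R := Re (('i * t%:C) ^+ k.+2 / (k.+2)`!%:R).
pose ci k : R := Im (('i * t%:C) ^+ k.+2 / (k.+2)`!%:R).
apply: lerD.
- rewrite [X in _ - X](_ : _ = \int[mu]_(x in D) (\sum_(k < n) cr k * x ^+ k)).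
    have [M hM] := sum_pow_supp cr n.
    apply: (Rintegral_close (measurable_Re_levy t) (measurable_sum_pow cr n) hM).
    move=> x Dx; rewrite (le_trans _ (bd x Dx))// (le_trans _ (Re_le_normc _))//.
    rewrite ReD ReN Re_sum; under [in leRHS]eq_bigr do rewrite ReMr.
    exact: lexx.
  rewrite Rintegral_sum_pow imag_eval_levy_poly Re_sum.
  by apply: eq_bigr => k _; rewrite ReMr.
- rewrite [X in _ - X](_ : _ = \int[mu]_(x in D) (\sum_(k < n) ci k * x ^+ k)).
    have [M hM] := sum_pow_supp ci n.
    apply: (Rintegral_close (measurable_Im_levy t) (measurable_sum_pow ci n) hM).
    move=> x Dx; rewrite (le_trans _ (bd x Dx))// (le_trans _ (Im_le_normc _))//.
    rewrite ImD ImN Im_sum; under [in leRHS]eq_bigr do rewrite ImMr.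
    exact: lexx.
  rewrite Rintegral_sum_pow imag_eval_levy_poly Im_sum.
  by apply: eq_bigr => k _; rewrite ImMr.
Qed.

End Moments.

(** * Jets of the characteristic function *)

Section Jets.
Local Open Scope complex_scope.
Local Notation normc := ComplexField.Normc.normc.
Context {R : realType}.
Implicit Types (p q : {poly R}) (t u : R) (z w : R[i]) (m : nat -> R).

Lemma normc_it t : 0 <= t -> normc ('i * t%:C) = t.
Proof.
move=> t0; rewrite ComplexField.Normc.normcM normc_real ger0_norm//=.
by rewrite expr0n expr1n add0r sqrtr1 mul1r.
Qed.

Lemma imag_evalB p q t : imag_eval (p - q) t = imag_eval p t - imag_eval q t.
Proof. by rewrite /imag_eval rmorphB hornerD hornerN. Qed.
Lemma imag_evalX p n t : imag_eval (p ^+ n) t = imag_eval p t ^+ n.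
Proof. by rewrite /imag_eval rmorphXn horner_exp. Qed.
Lemma imag_evalZ (c : R) p t : imag_eval (c *: p) t = c%:C * imag_eval p t.
Proof. by rewrite /imag_eval map_polyZ hornerZ. Qed.
Lemma imag_eval_sum I (r : seq I) (P : pred I) (F : I -> {poly R}) t :
  imag_eval (\sum_(i <- r | P i) F i) t = \sum_(i <- r | P i) imag_eval (F i) t.
Proof. by rewrite /imag_eval rmorph_sum horner_sum. Qed.

Lemma normc_imag_eval p n t : (forall k, (k < n)%N -> p`_k = 0) ->
  0 <= t <= 1 ->
  normc (imag_eval p t) <= (\sum_(k < size p) `|p`_k|) * t ^+ n.
Proof.
move=> pn /andP[t0 t1]; rewrite (imag_evalE _ (leqnn _)) mulr_suml.
rewrite (le_trans (normc_sum _ _ _))//; apply: ler_sum => k _.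
rewrite ComplexField.Normc.normcM normc_real normcX normc_it//.
have [kn|nk] := ltnP k n; first by rewrite pn// normr0 !mul0r.
by rewrite ler_wpM2l// ler_wiXn2l.
Qed.

Lemma normc_subX (M : R) z w j : 1 <= M -> normc z <= M -> normc w <= M ->
  normc (z ^+ j - w ^+ j) <= j%:R * M ^+ j * normc (z - w).
Proof.
move=> M1 zM wM; elim: j => [|j IH].
  by rewrite !expr0 subrr ComplexField.Normc.normc0 !mul0r.
have -> : z ^+ j.+1 - w ^+ j.+1 = z * (z ^+ j - w ^+ j) + (z - w) * w ^+ j.
  by rewrite !exprS; ring.
rewrite (le_trans (le_normcD _ _))// !ComplexField.Normc.normcM normcX.
have d0 := normc_ge0 (z - w); set d := normc (z - w) in IH d0 *.
have Mj : 0 <= M ^+ j by rewrite exprn_ge0// (le_trans ler01).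
have -> : j.+1%:R * M ^+ j.+1 * d = M * (j%:R * M ^+ j * d) + d * (M * M ^+ j).
  by rewrite exprS -natr1; ring.
apply: lerD; first by rewrite ler_pM ?normc_ge0.
rewrite ler_wpM2l//; apply: (@le_trans _ _ (M ^+ j)).
  by rewrite lerXn2r ?nnegrE ?normc_ge0// (le_trans ler01).
by rewrite ler_peMl.
Qed.

(** Its coefficients below order [N] are those of the formal series
    exp (u * levy_poly), since [levy_poly] has no constant term. *)
Definition exp_levy_poly u m N : {poly R} :=
  \sum_(j < N) (u ^+ j / j`!%:R) *: levy_poly m N ^+ j.

(** The exponent is O(t).  So an error O(t^N) results from each of three steps:
    cutting the exponential series at order [N], replacing the exponent by its
    jet, and discarding the coefficients of order at least [N]. *)
Lemma cexp_levy_jet (psi : R -> R[i]) m n u (B : R) : 0 < u -> 0 <= B ->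
  (forall t, 0 < t <= 1 ->
    normc (psi t - imag_eval (levy_poly m n.+2) t) <= B * t ^+ n.+2) ->
  exists2 B' : R, 0 <= B' & forall t, 0 < t <= 1 ->
    normc (cexp (u%:C * psi t) -
       \sum_(k < n.+2) ((exp_levy_poly u m n.+2)`_k)%:C * ('i * t%:C) ^+ k)
    <= B' * t ^+ n.+2.
Proof.
move=> u0 B0 Hpsi.
set N := n.+2 in Hpsi *; set P := levy_poly m N; set E := exp_levy_poly u m N.
pose Bp := \sum_(k < size P) `|P`_k|.
pose M := 1 + u * (B + Bp).
have Bp0 : 0 <= Bp by apply: sumr_ge0.
have M1 : 1 <= M by rewrite lerDl mulr_ge0 ?addr_ge0// ltW.
have M0 : 0 <= M by exact: le_trans ler01 M1.
pose Q := E - \poly_(k < N) E`_k.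
pose BQ := \sum_(k < size Q) `|Q`_k|.
pose BE := \sum_(j < N) (j%:R * M ^+ j * (u * B)).
exists (2 * (expR M * (2 * M) ^+ N) + BE + BQ).
  rewrite !addr_ge0//.
  - by do ?[apply: exprn_ge0 | exact: expR_ge0 | exact: ler0n | apply: mulr_ge0].
  - by apply: sumr_ge0 => j _; do ?[apply: exprn_ge0 | exact: ltW | exact: ler0n | apply: mulr_ge0].
  - exact: sumr_ge0.
move=> t t01; have /andP[t0 t1] := t01.
have t01' : 0 <= t <= 1 by rewrite ltW.
have tN0 : 0 <= t ^+ N by rewrite exprn_ge0 // ltW.
set a := u%:C * psi t; pose b := u%:C * imag_eval P t.
have ab : normc (a - b) <= u * B * t ^+ N.
  rewrite /a /b -mulrBr ComplexField.Normc.normcM normc_real gtr0_norm//.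
  by rewrite -mulrA ler_pM2l// Hpsi.
have P0 k : (k < 1)%N -> P`_k = 0 by case: k => // _; rewrite coef_poly.
have bt : normc b <= u * Bp * t.
  rewrite /b ComplexField.Normc.normcM normc_real gtr0_norm// -mulrA ler_pM2l//.
  by rewrite -[t in leRHS]expr1; exact: normc_imag_eval.
have tNt : t ^+ N <= t by rewrite -[leRHS]expr1 ler_wiXn2l// ltW.
have at' : normc a <= M * t.
  rewrite -[a](subrK b) (le_trans (le_normcD _ _))//.
  apply: (@le_trans _ _ (u * B * t + u * Bp * t)).
    by rewrite lerD// (le_trans ab)// ler_wpM2l// mulr_ge0// ltW.
  rewrite -mulrDl ler_pM2r// /M mulrDr lerDr//.
have bM : normc b <= M.
  rewrite (le_trans bt)// (@le_trans _ _ (u * Bp))//.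
    by rewrite ler_piMr// mulr_ge0// ltW.
  by rewrite /M mulrDr; have := mulr_ge0 (ltW u0) B0; lra.
have aM : normc a <= M by rewrite (le_trans at')// ler_piMr// (le_trans ler01).
have EE : imag_eval E t = cexp_poly N b.
  rewrite /E /exp_levy_poly imag_eval_sum /cexp_poly; apply: eq_bigr => j _.
  rewrite imag_evalZ imag_evalX -/P /b exprMn rmorphM fmorphV rmorph_nat rmorphXn.
  by rewrite mulrAC.
have QE : imag_eval Q t = imag_eval E t -
    \sum_(k < N) (E`_k)%:C * ('i * t%:C) ^+ k.
  rewrite /Q imag_evalB; congr (_ - _).
  rewrite (imag_evalE _ (size_poly _ _)); apply: eq_bigr => k _.
  by rewrite coef_poly ltn_ord.
have QN k : (k < N)%N -> Q`_k = 0.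
  by move=> kN; rewrite /Q coefB coef_poly kN subrr.
rewrite (_ : cexp a - _ = (cexp a - cexp_poly N a) + (cexp_poly N a - cexp_poly N b) + imag_eval Q t); last first.
  by rewrite QE EE; ring.
rewrite [leRHS]mulrDl [X in _ <= X + _]mulrDl (le_trans (le_normcD _ _))// lerD//; last exact: normc_imag_eval.
rewrite (le_trans (le_normcD _ _))// lerD//.
  rewrite (le_trans (cexp_taylor _ _))// -[leRHS]mulrA ler_pM2l// -[leRHS]mulrA.
  apply: ler_pM; first exact: expR_ge0.
  - by apply: exprn_ge0; apply: mulr_ge0 => //; exact: normc_ge0.
  - by rewrite ler_expR.
  - rewrite -exprMn; apply: lerXn2r; rewrite ?nnegrE.
    + by apply: mulr_ge0 => //; exact: normc_ge0.
    + by apply: mulr_ge0; [apply: mulr_ge0|exact: ltW].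
    + by rewrite -mulrA ler_pM2l.
rewrite /cexp_poly -sumrB (le_trans (normc_sum _ _ _))// mulr_suml.
apply: ler_sum => j _; rewrite -mulrBl ComplexField.Normc.normcM.
have jj : normc (j`!%:R : R[i])^-1 <= 1.
  rewrite ComplexField.Normc.normcV -(rmorph_nat (real_complex R)) normc_real.
  by rewrite ger0_norm// invf_le1 ?ltr0n ?ler1n fact_gt0.
apply: (@le_trans _ _ (normc (a ^+ j - b ^+ j))).
  by rewrite ler_piMr// normc_ge0.
rewrite (le_trans (normc_subX _ M1 aM bM))// -[leRHS]mulrA ler_wpM2l//.
by rewrite mulr_ge0// exprn_ge0// (le_trans ler01).
Qed.

End Jets.

(** * The cosine series, and uniqueness of jets *)

Section Trig.
Local Open Scope complex_scope.
Local Notation normc := ComplexField.Normc.normc.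
Local Notation Re := complex.Re.
Local Notation Im := complex.Im.
Context {R : realType}.
Implicit Types (t y : R) (c : nat -> R) (n j k N : nat).

Definition re_ipow k : R := Re ('i ^+ k).
Definition im_ipow k : R := Im ('i ^+ k).

Lemma re_ipowS k : re_ipow k.+1 = - im_ipow k.
Proof. by rewrite /re_ipow exprS ReM /= mul0r mul1r sub0r. Qed.
Lemma im_ipowS k : im_ipow k.+1 = re_ipow k.
Proof. by rewrite /im_ipow exprS ImM /= mul0r mul1r add0r. Qed.

Lemma ipow_double j : re_ipow j.*2 = (-1) ^+ j /\ im_ipow j.*2 = 0.
Proof.
elim: j => [|j [h1 h2]]; first by rewrite /re_ipow /im_ipow double0 !expr0.
by rewrite doubleS re_ipowS !im_ipowS re_ipowS h1 h2 oppr0 exprS mulN1r.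
Qed.

Lemma ipow_neq0 k : re_ipow k = 0 -> im_ipow k = 0 -> False.
Proof.
move=> r0 i0; have : normc ('i%C ^+ k : R[i]) = 1.
  by rewrite normcX /= expr0n expr1n add0r sqrtr1 expr1n.
have := normc_le_ReIm ('i%C ^+ k : R[i]).
by rewrite -[Re _]/(re_ipow k) -[Im _]/(im_ipow k) r0 i0 normr0 addr0 => + e; rewrite e ler10.
Qed.

Lemma Re_itX t k : Re (('i * t%:C) ^+ k) = re_ipow k * t ^+ k.
Proof. by rewrite exprMn -rmorphXn ReMr. Qed.
Lemma Im_itX t k : Im (('i * t%:C) ^+ k) = im_ipow k * t ^+ k.
Proof. by rewrite exprMn -rmorphXn ImMr. Qed.

Lemma cos_sin_taylor N y :
  `|cos y - (taylor_poly re_ipow N).[y]| <= `|y| ^+ N /\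
  `|sin y - (taylor_poly im_ipow N).[y]| <= `|y| ^+ N.
Proof.
have [|] := @re_im_rem_bound _ ('i * y%:C) N 1; first by rewrite ler01 lexx.
have e1 : Re ('i * y%:C) = 0 by rewrite /= mul0r mulr0 subrr.
have e2 : Im ('i * y%:C) = y by rewrite /= mul0r mul1r add0r.
rewrite /re_rem /im_rem !mul1r e1 e2 expR0 !mul1r normr0 add0r.
rewrite expR0 mul1r.
have -> : (taylor_poly (fun k => Re (('i * y%:C) ^+ k)) N).[1] = (taylor_poly re_ipow N).[y].
  rewrite /taylor_poly !horner_poly; apply: eq_bigr => k _.
  by rewrite Re_itX expr1n mulr1 mulrAC.
have -> // : (taylor_poly (fun k => Im (('i * y%:C) ^+ k)) N).[1] = (taylor_poly im_ipow N).[y].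
rewrite /taylor_poly !horner_poly; apply: eq_bigr => k _.
by rewrite Im_itX expr1n mulr1 mulrAC.
Qed.

Definition cos_poly j : {poly R} := taylor_poly re_ipow j.*2.

Lemma horner_cos_poly j y :
  (cos_poly j).[y] = \sum_(i < j) (-1) ^+ i / (i.*2)`!%:R * y ^+ i.*2.
Proof.
elim: j => [|j IH]; first by rewrite /cos_poly /taylor_poly horner_poly !big_ord0.
rewrite /cos_poly doubleS !taylor_polyS big_ord_recr/= -IH.
have [h1 h2] := ipow_double j.
by rewrite re_ipowS h1 h2 oppr0 !mul0r addr0.
Qed.

(** The sign makes the remainder of the cosine series nonnegative. *)
Definition cos_rem j y : R := (-1) ^+ j * (cos y - (cos_poly j).[y]).

Lemma cos_remN j y : cos_rem j (- y) = cos_rem j y.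
Proof.
rewrite /cos_rem cosN !horner_cos_poly; congr (_ * (_ - _)).
by apply: eq_bigr => i _; rewrite -!muln2 mulnC !exprM sqrrN.
Qed.

Lemma cos_remS j y : cos_rem j.+1 y = y ^+ j.*2 / (j.*2)`!%:R - cos_rem j y.
Proof.
rewrite /cos_rem !horner_cos_poly big_ord_recr/= exprS.
set S := \sum_(i < j) _; set f := (j.*2)`!%:R; set Y := y ^+ j.*2.
have : (-1) ^+ j * (-1) ^+ j = 1 :> R by rewrite -expr2 sqrr_sign.
set s := (-1) ^+ j => e.
by rewrite (_ : Y / f = s * s * (Y / f)); [ring|rewrite e mul1r].
Qed.

Lemma cos_rem1_ge0 y : 0 <= cos_rem 1 y.
Proof.
rewrite cos_remS /cos_rem expr0 fact0 divr1 mul1r /cos_poly /taylor_poly horner_poly big_ord0.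
by rewrite subr0 subr_ge0 cos_le1.
Qed.

(** Integrate [cos <= 1] from 0 again and again. *)
Lemma cos_rem_ge0_pos j y : 0 <= y -> 0 <= cos_rem j.+1 y.
Proof.
elim: j y => [|j IH] y y0; first exact: cos_rem1_ge0.
pose S (w : R) : R := (-1) ^+ j.+1 * (sin w - (taylor_poly im_ipow j.+1.*2.+1).[w]).
have dS (w : R) : is_derive w 1 S (cos_rem j.+1 w).
  have := @is_derive_sub_taylor _ sin cos im_ipow j.+1.*2 w (is_derive_sin w).
  rewrite (eq_taylor_poly _ im_ipowS) => /(@is_deriveZ _ _ _ _ ((-1) ^+ j.+1)).
  exact.
have S0 : S 0 = 0.
  rewrite /S sin0 horner_taylor_poly0 ?subr0 ?mulr0//.
have Sge0 w : 0 <= w -> 0 <= S w by exact: ge0_from0 dS S0 IH w.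
have dC (w : R) : is_derive w 1 (cos_rem j.+2) (S w).
  have := @is_derive_sub_taylor _ cos (fun x => - sin x) re_ipow j.+1.*2.+1 w (is_derive_cos w).
  move=> /(@is_deriveZ _ _ _ _ ((-1) ^+ j.+2)).
  move/is_derive_eq; apply.
  rewrite (eq_taylor_poly _ re_ipowS) /S exprS /GRing.scale/=.
  rewrite -[X in X = _]mulrA mulN1r.
  have -> : (taylor_poly (fun k => - im_ipow k) j.+1.*2.+1).[w] = - (taylor_poly im_ipow j.+1.*2.+1).[w].
    by rewrite /taylor_poly !horner_poly -sumrN; apply: eq_bigr => k _; rewrite !mulNr.
  ring.
have C0 : cos_rem j.+2 0 = 0.
  by rewrite /cos_rem /cos_poly doubleS horner_taylor_polyS0 cos0 /re_ipow expr0 subrr mulr0.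
exact: ge0_from0 dC C0 Sge0 y y0.
Qed.

Lemma cos_rem_ge0 j y : 0 <= cos_rem j.+1 y.
Proof.
have [y0|/ltW y0] := leP 0 y; first exact: cos_rem_ge0_pos.
by rewrite -cos_remN cos_rem_ge0_pos// oppr_ge0.
Qed.

Lemma cos_rem_bounds j y :
  0 <= cos_rem j.+1 y <= y ^+ j.+1.*2 / (j.+1.*2)`!%:R.
Proof.
by rewrite cos_rem_ge0/= -subr_ge0 -cos_remS cos_rem_ge0.
Qed.

(** Let t tend to 0 to kill the constant coefficient, then divide by t. *)
Lemma jet_unique c N (B : R) :
  (forall t, 0 < t <= 1 -> `|\sum_(k < N) c k * t ^+ k| <= B * t ^+ N) ->
  forall k, (k < N)%N -> c k = 0.
Proof.
elim: N c => [//|N IH] c H.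
have B0 : 0 <= B.
  by have := H 1; rewrite ltr01 lexx => /(_ isT); rewrite expr1n mulr1; apply: le_trans.
have sumE t : \sum_(k < N.+1) c k * t ^+ k = c 0%N + t * \sum_(k < N) c k.+1 * t ^+ k.
  rewrite big_ord_recl expr0 mulr1 mulr_sumr; congr (_ + _).
  by apply: eq_bigr => k _; rewrite exprS; ring.
have c0 : c 0%N = 0.
  apply/eqP; rewrite -normr_le0; apply/ler_addgt0Pr => e e0; rewrite add0r.
  pose K := B + \sum_(k < N) `|c k.+1| + 1.
  have K0 : 0 < K by rewrite ltr_wpDl// addr_ge0// sumr_ge0.
  pose t := Num.min 1 (e / K).
  have t0 : 0 < t by rewrite lt_min ltr01 divr_gt0.
  have t1 : t <= 1 by rewrite ge_min lexx.
  have te : t * K <= e by rewrite -ler_pdivlMr// ge_min lexx orbT.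
  have := H t; rewrite t0 t1 => /(_ isT); rewrite sumE => h.
  rewrite (le_trans _ te)// -[c 0%N](addrK (t * \sum_(k < N) c k.+1 * t ^+ k)).
  rewrite (le_trans (ler_normB _ _))//.
  apply: (@le_trans _ _ (t * B + t * \sum_(k < N) `|c k.+1|)); last first.
    by rewrite -mulrDr ler_pM2l// lerDl.
  apply: lerD.
    rewrite (le_trans h)// mulrC ler_wpM2r//.
    by rewrite -[leRHS]expr1 ler_wiXn2l// ltW.
  rewrite normrM gtr0_norm// ler_pM2l// (le_trans (ler_norm_sum _ _ _))//.
  apply: ler_sum => k _; rewrite normrM ler_piMr// normrX exprn_ile1//.
  by rewrite gtr0_norm.
have {}IH := IH (fun k => c k.+1); case=> [//|k]; rewrite ltnS; apply: IH.
move=> t t01; have := H t t01; rewrite sumE c0 add0r normrM exprS.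
case/andP: t01 => t0 _; rewrite gtr0_norm// mulrCA ler_pM2l//.
Qed.

End Trig.

(** * Moments from the characteristic function *)

Section RealIntegrals.
Context {R : realType} d (T : measurableType d) (P : probability T R).
Implicit Types (g h : T -> R).

Local Notation integ g := (P.-integrable setT (EFin \o g)).

Lemma integrable_measurable g : integ g -> measurable_fun setT g.
Proof. by move=> /integrableP[/measurable_EFinP]. Qed.

Lemma integrable_le g h : measurable_fun setT g ->
  (forall w, `|g w| <= h w) -> integ h -> integ g.
Proof.
move=> mg gh ih; apply: (le_integrable _ _ _ ih) => //; first exact/measurable_EFinP.
by move=> w _; rewrite lee_fin (le_trans (gh w))// ler_norm.
Qed.

Lemma integrable_cst (c : R) : integ (fun=> c).
Proof. exact: finite_measure_integrable_cst. Qed.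

Lemma Rintegral_prob_cst (c : R) : \int[P]_w c = c.
Proof. by rewrite Rintegral_cst// [fine _](congr1 fine (probability_setT P)) mulr1. Qed.

Lemma integrable_bounded g (M : R) : measurable_fun setT g ->
  (forall w, `|g w| <= M) -> integ g.
Proof. by move=> mg gM; apply: (integrable_le mg gM); exact: integrable_cst. Qed.

Lemma integrableZ (c : R) g : integ g -> integ (fun w => c * g w).
Proof. by move=> ig; exact: (integrableZl _ c ig). Qed.

Lemma integrable_add g h : integ g -> integ h -> integ (fun w => g w + h w).
Proof. by move=> ig ih; exact: (integrableD _ ig ih). Qed.

Lemma integrable_sub g h : integ g -> integ h -> integ (fun w => g w - h w).
Proof. by move=> ig ih; exact: (integrableB _ ig ih). Qed.

Lemma integrable_lin (c : nat -> R) (F : nat -> T -> R) n :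
  (forall k, (k < n)%N -> integ (F k)) ->
  integ (fun w => \sum_(k < n) c k * F k w).
Proof.
elim: n => [|n IH] iF.
  apply: (eq_integrable _ (EFin \o (fun=> 0 : R))) => //; last exact: integrable_cst.
  by move=> w _ /=; rewrite big_ord0.
apply: (eq_integrable _ (EFin \o (fun w => \sum_(k < n) c k * F k w + c n * F n w))) => //.
  by move=> w _ /=; rewrite big_ord_recr.
apply: integrable_add; last by apply: integrableZ; exact: iF.
by apply: IH => k kn; apply: iF; rewrite ltnS ltnW.
Qed.

Lemma Rintegral_lin (c : nat -> R) (F : nat -> T -> R) n :
  (forall k, (k < n)%N -> integ (F k)) ->
  \int[P]_w (\sum_(k < n) c k * F k w) = \sum_(k < n) c k * \int[P]_w F k w.
Proof.
elim: n => [|n IH] iF.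
  rewrite big_ord0 -[RHS](Rintegral_prob_cst 0).
  by apply: eq_Rintegral => w _; rewrite big_ord0.
rewrite big_ord_recr/= -IH; last by move=> k kn; apply: iF; rewrite ltnS ltnW.
rewrite -RintegralZl//; last exact: iF.
rewrite -RintegralD//.
- by apply: eq_Rintegral => w _; rewrite big_ord_recr.
- by apply: integrable_lin => k kn; apply: iF; rewrite ltnS ltnW.
- by apply: integrableZ; exact: iF.
Qed.

Lemma Rintegral_fatou (g : T -> R) (F : nat -> T -> R) (c : R) :
  (forall n, integ (F n)) -> (forall n w, 0 <= F n w) ->
  (forall w, F n w @[n --> \oo] --> g w) ->
  (\int[P]_w F n w) @[n --> \oo] --> c ->
  integ g /\ \int[P]_w g w <= c.
Proof.
move=> iF F0 Fg Fc.
have mF n := integrable_measurable (iF n).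
have mg : measurable_fun setT g.
  by apply: (measurable_fun_cvg (h := F)) => // w _; exact: Fg.
have g0 w : 0 <= g w.
  apply: (ler_cvg_to (cvg_cst 0) (Fg w)); apply: nearW => n; exact: F0.
have fat : (\int[P]_w (g w)%:E <= c%:E)%E.
  have := @fatou _ _ _ P setT measurableT (fun n w => (F n w)%:E).
  have -> : limn_einf (fun n => \int[P]_w (F n w)%:E)%E = c%:E.
    have cv : (\int[P]_w (F n w)%:E)%E @[n --> \oo] --> c%:E.
      rewrite (_ : (fun n => (\int[P]_w (F n w)%:E)%E) = EFin \o (fun n => \int[P]_w F n w)).
        by apply/cvg_EFin => //; apply: nearW.
      by apply/funext => n /=; rewrite /Rintegral fineK//; apply: integrable_fin_num => //; exact: iF.
    by rewrite (cvg_limn_einf_sup cv).1.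
  move=> h; apply: le_trans (h _ _); last 2 first.
  - by move=> n; exact/measurable_EFinP.
  - by move=> n w _; rewrite lee_fin.
  rewrite le_eqVlt; apply/orP; left; apply/eqP; apply: eq_integral => w _.
  have cv : (F n w)%:E @[n --> \oo] --> (g w)%:E.
    by apply/cvg_EFin; [exact: nearW|exact: Fg].
  by rewrite (cvg_limn_einf_sup cv).1.
have ig : integ g.
  apply/integrableP; split; first exact/measurable_EFinP.
  apply: (le_lt_trans _ (ltry c)); apply: le_trans fat.
  rewrite le_eqVlt; apply/orP; left; apply/eqP; apply: eq_integral => w _ /=.
  by rewrite ger0_norm.
split => //; rewrite -lee_fin /Rintegral fineK//; exact: integrable_fin_num.
Qed.

End RealIntegrals.

Section CharMoments.
Local Open Scope complex_scope.
Local Notation normc := ComplexField.Normc.normc.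
Local Notation Re := complex.Re.
Local Notation Im := complex.Im.
Context {R : realType} d (T : measurableType d) (P : probability T R).
Variables (X : {RV P >-> R}) (a : nat -> R).
Hypothesis a0 : a 0%N = 1.
Hypothesis char_jet : forall n, exists2 B : R, 0 <= B & forall t, 0 < t <= 1 ->
  normc (char_fun X t - \sum_(k < n.+2) (a k)%:C * ('i * t%:C) ^+ k) <= B * t ^+ n.+2.

Local Notation integ g := (P.-integrable setT (EFin \o g)).

Let mX : measurable_fun setT (X : T -> R). Proof. exact: measurable_funP. Qed.

Lemma measurable_tX (t : R) : measurable_fun setT (fun w => t * X w).
Proof. by apply: measurable_funM => //; exact: measurable_cst. Qed.

Lemma measurable_cos_tX (t : R) : measurable_fun setT (fun w => cos (t * X w)).
Proof.
apply: measurableT_comp (measurable_tX t).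
by apply: continuous_measurable_fun; exact: continuous_cos.
Qed.

Lemma measurable_sin_tX (t : R) : measurable_fun setT (fun w => sin (t * X w)).
Proof.
apply: measurableT_comp (measurable_tX t).
by apply: continuous_measurable_fun; exact: continuous_sin.
Qed.

Lemma measurable_powX k : measurable_fun setT (fun w => X w ^+ k).
Proof. exact: measurable_funX. Qed.

Lemma integrable_cos_tX (t : R) : integ (fun w => cos (t * X w)).
Proof. exact: (integrable_bounded P (measurable_cos_tX t) (fun w => cos_max _)). Qed.

Lemma integrable_sin_tX (t : R) : integ (fun w => sin (t * X w)).
Proof. exact: (integrable_bounded P (measurable_sin_tX t) (fun w => sin_max _)). Qed.

Lemma Re_char_fun t : Re (char_fun X t) = \int[P]_w cos (t * X w).
Proof. by apply: eq_Rintegral => w _ /=; rewrite expR0 mul1r. Qed.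

Lemma Im_char_fun t : Im (char_fun X t) = \int[P]_w sin (t * X w).
Proof. by apply: eq_Rintegral => w _ /=; rewrite expR0 mul1r. Qed.

Lemma cos_sin_jet n : exists2 B : R, 0 <= B & forall t, 0 < t <= 1 ->
  `|\int[P]_w cos (t * X w) - \sum_(k < n.+2) re_ipow k * a k * t ^+ k| <= B * t ^+ n.+2 /\
  `|\int[P]_w sin (t * X w) - \sum_(k < n.+2) im_ipow k * a k * t ^+ k| <= B * t ^+ n.+2.
Proof.
have [B B0 HB] := char_jet n; exists B => // t t01; have {HB}h := HB t t01.
split.
- apply: le_trans h; apply: le_trans (Re_le_normc _).
  rewrite ReD ReN Re_sum Re_char_fun le_eqVlt; apply/orP; left; apply/eqP.
  congr `|_ - _|; apply: eq_bigr => k _.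
  by rewrite [X in _ = Re X]mulrC ReMr Re_itX; ring.
- apply: le_trans h; apply: le_trans (Im_le_normc _).
  rewrite ImD ImN Im_sum Im_char_fun le_eqVlt; apply/orP; left; apply/eqP.
  congr `|_ - _|; apply: eq_bigr => k _.
  by rewrite [X in _ = Im X]mulrC ImMr Im_itX; ring.
Qed.

Lemma sum_re_ipow_double (c : nat -> R) q :
  \sum_(k < q.*2) re_ipow k * c k = \sum_(i < q) (-1) ^+ i * c i.*2.
Proof.
elim: q => [|q IH]; first by rewrite double0 !big_ord0.
rewrite doubleS !big_ord_recr/= IH; have [h1 h2] := @ipow_double R q.
by rewrite re_ipowS h1 h2 oppr0 mul0r addr0.
Qed.

Lemma cos_remE j (t x : R) : cos_rem j (t * x) =
  (-1) ^+ j * cos (t * x) -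
  \sum_(i < j) ((-1) ^+ j * (-1) ^+ i / (i.*2)`!%:R * t ^+ i.*2) * x ^+ i.*2.
Proof.
rewrite /cos_rem horner_cos_poly mulrBr mulr_sumr; congr (_ - _).
by apply: eq_bigr => i _; rewrite exprMn; ring.
Qed.

Definition even_moment_eq j := integ (fun w => X w ^+ j.*2) /\
  \int[P]_w X w ^+ j.*2 = (j.*2)`!%:R * a j.*2.

Lemma integrable_cos_rem j (t : R) : (forall i, (i < j)%N -> even_moment_eq i) ->
  integ (fun w => cos_rem j (t * X w)).
Proof.
move=> IH.
apply: (eq_integrable _ (EFin \o (fun w => (-1) ^+ j * cos (t * X w) -
  \sum_(i < j) ((-1) ^+ j * (-1) ^+ i / (i.*2)`!%:R * t ^+ i.*2) * X w ^+ i.*2))) => //.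
  by move=> w _ /=; rewrite cos_remE.
apply: integrable_sub.
  by apply: integrableZ; exact: integrable_cos_tX.
apply: (@integrable_lin _ _ _ _ (fun i => (-1) ^+ j * (-1) ^+ i / (i.*2)`!%:R * t ^+ i.*2)
  (fun i w => X w ^+ i.*2)) => i ij.
by have [] := IH _ ij.
Qed.

Lemma Rintegral_cos_rem j (t : R) : (forall i, (i < j)%N -> even_moment_eq i) ->
  \int[P]_w cos_rem j (t * X w) =
  (-1) ^+ j * (\int[P]_w cos (t * X w) - \sum_(i < j) (-1) ^+ i * (a i.*2 * t ^+ i.*2)).
Proof.
move=> IH.
pose c i : R := (-1) ^+ j * (-1) ^+ i / (i.*2)`!%:R * t ^+ i.*2.
rewrite (@eq_Rintegral _ _ _ _ _ (fun w => (-1) ^+ j * cos (t * X w) -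
    \sum_(i < j) c i * X w ^+ i.*2)); last by move=> w _; rewrite cos_remE.
have iX i : (i < j)%N -> integ (fun w => X w ^+ i.*2) by move=> /IH[].
rewrite RintegralB//; last 2 first.
- by apply: integrableZ; exact: integrable_cos_tX.
- exact: (integrable_lin c iX).
rewrite RintegralZl//; last exact: integrable_cos_tX.
rewrite (Rintegral_lin c iX) mulrBr mulr_sumr; congr (_ - _).
apply: eq_bigr => i _; have [_ ->] := IH i (ltn_ord i).
by rewrite /c; field; exact: natfact_neq0.
Qed.

(** Assume the claim below [j].  The jet of the characteristic function then says
    that E cos_rem(tX) = a_(2j) t^(2j) + O(t^(2j+1)).  The integrand is
    nonnegative, and divided by t^(2j) it tends to X^(2j) / (2j)!, so Fatou's
    lemma shows that the moment is finite and bounds it from above.  By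
    [cos_rem_bounds] the limit is also an upper bound of the integrand, which
    gives the reverse inequality. *)
Lemma even_moments j : even_moment_eq j.
Proof.
elim/ltn_ind: j => -[_|j IH].
  split; first exact: integrable_cst.
  by rewrite /= fact0 a0 mulr1 Rintegral_prob_cst.
set q := j.+1 in IH *; pose D := q.*2.
have [B B0 HB] := cos_sin_jet j.*2.+1.
have DE : j.*2.+3 = D.+1 by rewrite /D /q doubleS.
pose I t := \int[P]_w cos_rem q (t * X w).
have HI t : 0 < t <= 1 -> `|I t - a D * t ^+ D| <= B * t ^+ D.+1.
  move=> t01; have [h _] := HB t t01; rewrite -DE.
  rewrite (le_trans _ h)// /I Rintegral_cos_rem// DE.
  under [in leRHS]eq_bigr do rewrite -mulrA.
  have sE : \sum_(k < D) re_ipow k * (a k * t ^+ k) =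
      \sum_(i < q) (-1) ^+ i * (a i.*2 * t ^+ i.*2).
    by rewrite /D (sum_re_ipow_double (fun k => a k * t ^+ k)).
  rewrite [X in _ <= `|_ - X|]big_ord_recr/= sE.
  have [h1 _] := @ipow_double R q; rewrite -/D in h1 *; rewrite h1.
  set c := \int[P]_w _; set S := \sum_(i < q) _.
  rewrite [leRHS](_ : _ = `|(-1) ^+ q * (c - (S + (-1) ^+ q * (a D * t ^+ D)))|); last first.
    by rewrite normrM normrX normrN1 expr1n mul1r.
  have e : (-1) ^+ q * (-1) ^+ q = 1 :> R by rewrite -expr2 sqrr_sign.
  rewrite (_ : (-1) ^+ q * (c - (S + (-1) ^+ q * (a D * t ^+ D))) =
    (-1) ^+ q * (c - S) - ((-1) ^+ q * (-1) ^+ q) * (a D * t ^+ D)); last by ring.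
  by rewrite e mul1r.
pose tn n : R := n.+1%:R^-1.
have tn01 n : 0 < tn n <= 1 by rewrite invr_gt0 ltr0n/= invf_le1 ?ltr0n// ler1n.
have tn0 n : 0 < tn n by case/andP: (tn01 n).
have tnc : tn n @[n --> \oo] --> (0 : R) by exact: cvg_harmonic.
have iD := integrable_cos_rem _ IH.
pose F n w := (tn n ^+ D)^-1 * cos_rem q (tn n * X w).
have iF n : integ (F n) by apply: integrableZ; exact: iD.
have F0 n w : 0 <= F n w.
  by rewrite mulr_ge0 ?invr_ge0 ?exprn_ge0 ?(ltW (tn0 n))// cos_rem_ge0.
have Fup n w : F n w <= (D`!%:R)^-1 * X w ^+ D.
  have /andP[_ h] := cos_rem_bounds j (tn n * X w).
  rewrite /F ler_pdivrMl ?exprn_gt0// (le_trans h)// exprMn -/q -/D.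
  by rewrite le_eqVlt; apply/orP; left; apply/eqP; ring.
have Fcv w : F n w @[n --> \oo] --> (D`!%:R)^-1 * X w ^+ D.
  apply/cvgrPdist_le => e e0.
  have K0 : 0 <= X w ^+ D.+2 by rewrite /D -doubleS -mul2n exprM exprn_ge0// sqr_ge0.
  pose K := X w ^+ D.+2 + 1.
  have eK : 0 < e / K by rewrite divr_gt0// ltr_wpDl.
  have h1 := (cvgrPdist_le _ _).1 tnc _ eK.
  near=> n.
  have Fn : (D`!%:R)^-1 * X w ^+ D - F n w = (tn n ^+ D)^-1 * cos_rem q.+1 (tn n * X w).
    rewrite cos_remS mulrBr; congr (_ - _); rewrite exprMn -/D.
    by field; rewrite natfact_neq0/= expf_neq0// gt_eqF.
  have /andP[h0 h] := cos_rem_bounds q (tn n * X w).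
  rewrite Fn ger0_norm; last by rewrite mulr_ge0 ?invr_ge0 ?exprn_ge0 ?(ltW (tn0 n)).
  rewrite ler_pdivrMl ?exprn_gt0// (le_trans h)// doubleS -/D.
  apply: (@le_trans _ _ ((tn n * X w) ^+ D.+2)).
    rewrite ler_piMr ?invf_le1 ?ltr0n ?ler1n ?fact_gt0//.
    by rewrite /D -doubleS -mul2n exprM exprn_ge0// sqr_ge0.
  rewrite exprMn -addn2 exprD -mulrA ler_pM2l ?exprn_gt0//.
  apply: (@le_trans _ _ (tn n * K)).
    rewrite addn2; apply: ler_pM => //; last by rewrite lerDl.
      by rewrite exprn_ge0// ltW.
    by rewrite -[leRHS]expr1 ler_wiXn2l ?(ltW (tn0 n))//; case/andP: (tn01 n).
  rewrite -ler_pdivlMr; last by rewrite ltr_wpDl.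
  suff : `|0 - tn n| <= e / K by rewrite sub0r normrN gtr0_norm.
  by near: n; exact: h1.
have Icv : (\int[P]_w F n w) @[n --> \oo] --> a D.
  apply/cvgrPdist_le => e e0.
  have B1 : 0 < B + 1 by rewrite ltr_wpDl.
  have eB : 0 < e / (B + 1) by rewrite divr_gt0.
  have h1 := (cvgrPdist_le _ _).1 tnc _ eB.
  near=> n.
  rewrite /F RintegralZl; [|exact: measurableT|exact: iD].
  have h := HI _ (tn01 n).
  have tD : 0 < tn n ^+ D by rewrite exprn_gt0.
  rewrite distrC -(ler_pM2l tD) -[X in X * `|_| <= _]gtr0_norm// -normrM.
  rewrite mulrBr mulVKf ?gt_eqF// -/(I _) (mulrC _ (a D)) (le_trans h)//.
  rewrite exprSr mulrCA ler_pM2l//.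
  apply: (@le_trans _ _ ((B + 1) * tn n)); first by rewrite ler_pM2r// lerDl.
  rewrite mulrC -ler_pdivlMr//.
  suff : `|0 - tn n| <= e / (B + 1) by rewrite sub0r normrN gtr0_norm.
  by near: n; exact: h1.
have [ig gle] := Rintegral_fatou iF F0 Fcv Icv.
have iXD : integ (fun w => X w ^+ D).
  apply: (eq_integrable _ (EFin \o (fun w => D`!%:R * ((D`!%:R)^-1 * X w ^+ D)))) => //.
    by move=> w _ /=; rewrite mulVKf// natfact_neq0.
  exact: integrableZ.
split; rewrite -/D//.
have f0 := natfact_neq0 D.
rewrite RintegralZl// in gle; set M := Rintegral _ _ _ in gle *.
suff : a D <= (D`!%:R)^-1 * M.
  move=> h; have -> : a D = (D`!%:R)^-1 * M by apply/eqP; rewrite eq_le h gle.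
  by rewrite mulVKf.
have gM : (D`!%:R)^-1 * M = \int[P]_w ((D`!%:R)^-1 * X w ^+ D) by rewrite RintegralZl.
apply: (ler_cvg_to Icv (cvg_cst _)); apply: nearW => n.
by rewrite gM; apply: le_Rintegral.
Unshelve. all: end_near. Qed.

Lemma integrable_powX k : integ (fun w => X w ^+ k).
Proof.
apply: (@integrable_le _ _ _ _ _ (fun w => 1 + X w ^+ k.*2)).
- exact: measurable_powX.
- move=> w; rewrite -mul2n mulnC exprM; set v := X w ^+ k.
  rewrite -(real_normK (num_real v)).
  have := sqr_ge0 (`|v| - 1); have := normr_ge0 v; rewrite sqrrB1 -mulr_natr; lra.
- apply: integrable_add; first exact: integrable_cst.
  by have [] := even_moments k.
Qed.

Lemma integrable_normX k : integ (fun w => `|X w| ^+ k).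
Proof.
have := integrable_norm (integrable_powX k).
by apply: eq_integrable => // w _ /=; rewrite normrX.
Qed.

Lemma trig_moments_close (trig : R -> R) (c : nat -> R) N t :
  0 < t -> integ (fun w => trig (t * X w)) ->
  (forall y, `|trig y - (taylor_poly c N).[y]| <= `|y| ^+ N) ->
  `|\int[P]_w trig (t * X w) -
    \sum_(k < N) c k * ((k`!%:R)^-1 * \int[P]_w X w ^+ k) * t ^+ k|
  <= (\int[P]_w `|X w| ^+ N) * t ^+ N.
Proof.
move=> t0 it tay.
pose b k : R := c k * (k`!%:R)^-1 * t ^+ k.
have iX k : (k < N)%N -> integ (fun w => X w ^+ k) by move=> _; exact: integrable_powX.
have -> : \sum_(k < N) c k * ((k`!%:R)^-1 * \int[P]_w X w ^+ k) * t ^+ k =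
    \int[P]_w (\sum_(k < N) b k * X w ^+ k).
  by rewrite (Rintegral_lin b iX); apply: eq_bigr => k _; rewrite /b; ring.
have ib := integrable_lin b iX.
rewrite -RintegralB// (le_trans (le_normr_Rintegral _ _))//; first exact: integrable_sub.
rewrite -RintegralZr//; last exact: integrable_normX.
apply: le_Rintegral => //.
- exact: (integrable_norm (integrable_sub it ib)).
- apply: (eq_integrable _ (EFin \o (fun w => t ^+ N * `|X w| ^+ N))) => //.
    by move=> w _ /=; rewrite mulrC.
  by apply: integrableZ; exact: integrable_normX.
- move=> w _; have := tay (t * X w).
  rewrite normrM (gtr0_norm t0) exprMn (mulrC (t ^+ N)) /taylor_poly horner_poly => h.
  rewrite (le_trans _ h)// le_eqVlt; apply/orP; left; apply/eqP.
  by congr `|_ - _|; apply: eq_bigr => k _; rewrite /b exprMn; ring.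
Qed.

(** Once all moments are finite, Taylor's formula gives jets of E cos(tX) and
    E sin(tX) in terms of the moments, and jets are unique. *)
Lemma moments_coef k : (k`!%:R)^-1 * \int[P]_w X w ^+ k = a k.
Proof.
have [B B0 HB] := cos_sin_jet k.
set N := k.+2 in HB; pose A := \int[P]_w `|X w| ^+ N.
pose M j : R := (j`!%:R)^-1 * \int[P]_w X w ^+ j.
have close (v : R) (b : nat -> R) t :
    `|v - \sum_(j < N) b j * a j * t ^+ j| <= B * t ^+ N ->
    `|v - \sum_(j < N) b j * M j * t ^+ j| <= A * t ^+ N ->
    `|\sum_(j < N) (b j * (M j - a j)) * t ^+ j| <= (B + A) * t ^+ N.
  move=> h1 h2; rewrite mulrDl (le_trans _ (lerD h1 h2))//.
  rewrite (le_trans _ (ler_normB _ _))// le_eqVlt; apply/orP; left; apply/eqP.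
  set S := \sum_(j < N) b j * a j * t ^+ j; set S' := \sum_(j < N) b j * M j * t ^+ j.
  rewrite (_ : v - S - (v - S') = S' - S); last by ring.
  by rewrite -sumrB; congr `|_|; apply: eq_bigr => j _; ring.
have hc := @cos_sin_taylor R N.
have re0 := @jet_unique R (fun j => re_ipow j * (M j - a j)) N (B + A).
have im0 := @jet_unique R (fun j => im_ipow j * (M j - a j)) N (B + A).
apply/eqP; rewrite -subr_eq0 -/(M k); apply/eqP.
have kN : (k < N)%N by rewrite /N ltnW.
have {re0} : re_ipow k * (M k - a k) = 0.
  apply: re0 => // t t01; have /andP[t0 _] := t01; have [h _] := HB t t01.
  apply: close h _; apply: trig_moments_close => //; first exact: integrable_cos_tX.
  by move=> y; have [] := hc y.
have {im0} : im_ipow k * (M k - a k) = 0.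
  apply: im0 => // t t01; have /andP[t0 _] := t01; have [_ h] := HB t t01.
  apply: close h _; apply: trig_moments_close => //; first exact: integrable_sin_tX.
  by move=> y; have [] := hc y.
move=> /eqP; rewrite mulf_eq0 => /orP[/eqP i0|/eqP//].
move=> /eqP; rewrite mulf_eq0 => /orP[/eqP r0|/eqP//].
by case: (ipow_neq0 r0 i0).
Qed.

End CharMoments.

(** * The moment generating function of the Levy law *)

Section ExpPoly.
Context {R : realType}.
Implicit Types (y : R).

Lemma exp_polyE N y : (exp_poly N).[y] = \sum_(k < N) (k`!%:R)^-1 * y ^+ k.
Proof.
by rewrite /exp_poly /taylor_poly horner_poly; apply: eq_bigr => k _; rewrite div1r.
Qed.

Lemma cvg_exp_poly y : (exp_poly N).[y] @[N --> \oo] --> expR y.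
Proof.
rewrite (_ : (fun N => (exp_poly N).[y]) = series (exp_coeff y)).
  exact: is_cvg_series_exp_coeff.
apply/funext => N; rewrite exp_polyE /series /= big_mkord.
by apply: eq_bigr => k _; rewrite /exp_coeff mulrC.
Qed.

End ExpPoly.

Section NonnegPoly.
Context {R : realType}.
Implicit Types (p q : {poly R}) (s u : R) (m : nat -> R).

Definition nneg_coef p := forall k, 0 <= p`_k.

Lemma nneg_coefD p q : nneg_coef p -> nneg_coef q -> nneg_coef (p + q).
Proof. by move=> p0 q0 k; rewrite coefD addr_ge0. Qed.

Lemma nneg_coefM p q : nneg_coef p -> nneg_coef q -> nneg_coef (p * q).
Proof. by move=> p0 q0 k; rewrite coefM; apply: sumr_ge0 => i _; rewrite mulr_ge0. Qed.

Lemma nneg_coefX p n : nneg_coef p -> nneg_coef (p ^+ n).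
Proof.
move=> p0; elim: n => [|n IH]; last by rewrite exprS; exact: nneg_coefM.
by move=> k; rewrite expr0 coef1.
Qed.

Lemma nneg_coefZ (c : R) p : 0 <= c -> nneg_coef p -> nneg_coef (c *: p).
Proof. by move=> c0 p0 k; rewrite coefZ mulr_ge0. Qed.

Lemma nneg_coef_sum I (r : seq I) (F : I -> {poly R}) :
  (forall i, nneg_coef (F i)) -> nneg_coef (\sum_(i <- r) F i).
Proof. by move=> F0 k; rewrite coef_sum sumr_ge0// => i _; exact: F0. Qed.

Lemma horner_ge0 p s : nneg_coef p -> 0 <= s -> 0 <= p.[s].
Proof.
move=> p0 s0; rewrite horner_coef; apply: sumr_ge0 => k _.
by rewrite mulr_ge0 ?exprn_ge0.
Qed.

Lemma levy_poly_nneg m N : (forall k, 0 <= m k) -> nneg_coef (levy_poly m N).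
Proof. by move=> m0 k; rewrite coef_poly; do 2 case: ifP => // _; rewrite divr_ge0. Qed.

Lemma exp_levy_poly_nneg u m N : 0 <= u -> (forall k, 0 <= m k) ->
  nneg_coef (exp_levy_poly u m N).
Proof.
move=> u0 m0; apply: nneg_coef_sum => j; apply: nneg_coefZ.
  by rewrite divr_ge0 ?exprn_ge0.
by apply: nneg_coefX; exact: levy_poly_nneg.
Qed.

Lemma nneg_coef_subX p q j : nneg_coef p -> nneg_coef (q - p) ->
  nneg_coef (q ^+ j - p ^+ j).
Proof.
move=> p0 qp0; have q0 : nneg_coef q by rewrite -(subrK p q); exact: nneg_coefD.
rewrite subrXX; apply: nneg_coefM => //; apply: nneg_coef_sum => i.
by apply: nneg_coefM; apply: nneg_coefX.
Qed.

Lemma horner_exp_levy_poly u m N s :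
  (exp_levy_poly u m N).[s] = (exp_poly N).[u * (levy_poly m N).[s]].
Proof.
rewrite /exp_levy_poly horner_sum exp_polyE; apply: eq_bigr => j _.
by rewrite hornerZ horner_exp exprMn mulrA [_ / _]mulrC.
Qed.

Lemma exp_poly_le N (y : R) : 0 <= y -> (exp_poly N).[y] <= expR y.
Proof. by move=> /(expR_taylor N)/andP[]; rewrite subr_ge0. Qed.

Lemma sum_coef_le p n s : nneg_coef p -> 0 <= s ->
  \sum_(k < n) p`_k * s ^+ k <= p.[s].
Proof.
move=> p0 s0.
have h N : (n <= N)%N -> \sum_(k < n) p`_k * s ^+ k <= \sum_(k < N) p`_k * s ^+ k.
  move=> nN; rewrite -(subnKC nN) big_split_ord/= lerDl; apply: sumr_ge0 => k _.
  by rewrite mulr_ge0 ?exprn_ge0.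
apply: le_trans (h (maxn n (size p)) (leq_maxl _ _)) _.
by rewrite -horner_coef_wide// leq_maxr.
Qed.

(** The terms of order at least [N] are dominated by those of s^N e^A / A^2. *)
Lemma levy_poly_tail m (A : R) N n s : 0 < A -> (forall k, 0 <= m k <= A ^+ k) ->
  0 <= s <= 1 ->
  (levy_poly m n).[s] <= (levy_poly m N).[s] + expR A / A ^+ 2 * s ^+ N.
Proof.
move=> A0 mA /andP[s0 s1].
have c0 k : 0 <= (if (1 < k)%N then m (k - 2)%N / k`!%:R else 0) :> R.
  by case: ifP => // _; have /andP[m0 _] := mA (k - 2)%N; rewrite divr_ge0.
pose c k : R := if (1 < k)%N then m (k - 2)%N / k`!%:R else 0.
have hE M : (levy_poly m M).[s] = \sum_(k < M) c k * s ^+ k by rewrite horner_poly.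
have T0 M : 0 <= expR A / A ^+ 2 * s ^+ M.
  by rewrite mulr_ge0 ?exprn_ge0// divr_ge0 ?expR_ge0 ?exprn_ge0// ltW.
have [nN|Nn] := leqP n N.
  rewrite (@le_trans _ _ (levy_poly m N).[s]) ?lerDl//.
  rewrite !hE -(subnKC nN) big_split_ord/= lerDl; apply: sumr_ge0 => k _.
  by rewrite mulr_ge0 ?exprn_ge0 ?c0.
rewrite !hE -(subnKC (ltnW Nn)) big_split_ord/= lerD2l.
apply: (@le_trans _ _ (\sum_(k < n - N) (A ^+ 2)^-1 * ((N + k)`!%:R^-1 * A ^+ (N + k)) * s ^+ N)).
  apply: ler_sum => k _; apply: ler_pM => //; [exact: c0|exact: exprn_ge0| |].
    rewrite /c; case: ifP => k1; last first.
      by rewrite !mulr_ge0 ?invr_ge0 ?exprn_ge0 ?(ltW A0).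
    have /andP[_ h] := mA (N + k - 2)%N.
    rewrite (_ : _ * (_ * _) = A ^+ (N + k - 2) / (N + k)`!%:R) ?ler_wpM2r ?invr_ge0//.
    have e : A ^+ (N + k) = A ^+ (N + k - 2) * A ^+ 2 by rewrite -exprD subnK.
    have := @natfact_neq0 R (N + k).
    rewrite e; set Y := A ^+ (N + k - 2); set F := _`!%:R => F0; field.
    by rewrite F0 gt_eqF.
  by rewrite exprD ler_piMr ?exprn_ge0// exprn_ile1.
rewrite -mulr_suml ler_wpM2r ?exprn_ge0// -mulr_sumr mulrC ler_wpM2r ?invr_ge0 ?exprn_ge0 ?(ltW A0)//.
apply: le_trans (exp_poly_le n (ltW A0)).
rewrite exp_polyE (_ : \sum_(k < n) _ =
    \sum_(k < N + (n - N)) (k`!%:R)^-1 * A ^+ k); last by rewrite subnKC ?(ltnW Nn).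
rewrite big_split_ord/= lerDr.
by apply: sumr_ge0 => k _; rewrite mulr_ge0 ?invr_ge0 ?exprn_ge0 ?(ltW A0).
Qed.

End NonnegPoly.

Section MgfFromMoments.
Context {R : realType} d (T : measurableType d) (P : probability T R).
Variables (X : {RV P >-> R}) (a : nat -> R).
Local Notation integ g := (P.-integrable setT (EFin \o g)).
Hypothesis iX : forall k, integ (fun w => X w ^+ k).
Hypothesis aE : forall k, (k`!%:R)^-1 * \int[P]_w X w ^+ k = a k.
Hypothesis a0 : forall k, 0 <= a k.

Lemma Rintegral_exp_poly (c : nat -> R) n s :
  \int[P]_w (\sum_(k < n) (c k * s ^+ k / k`!%:R) * X w ^+ k) =
  \sum_(k < n) c k * (a k * s ^+ k).
Proof.
rewrite (@Rintegral_lin _ _ _ P (fun k => c k * s ^+ k / k`!%:R) (fun k w => X w ^+ k))//.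
by apply: eq_bigr => k _; rewrite -aE; ring.
Qed.

(** e^(sX) is at most e^(sX) + e^(-sX), whose Taylor polynomials involve even
    powers only and hence are nonnegative: Fatou's lemma applies to them. *)
Lemma mgf_upper s K : 0 <= s -> (forall n, \sum_(k < n) a k * s ^+ k <= K) ->
  integ (fun w => expR (s * X w)) /\ \int[P]_w expR (s * X w) <= 2 * K.
Proof.
move=> s0 aK.
pose c k : R := 1 + (-1) ^+ k.
have c0 k : 0 <= c k.
  by rewrite /c -signr_odd; case: (odd k); rewrite ?expr0 ?expr1; lra.
have c2 k : c k <= 2.
  by rewrite /c -signr_odd; case: (odd k); rewrite ?expr0 ?expr1; lra.
pose F n w := \sum_(k < n) (c k * s ^+ k / k`!%:R) * X w ^+ k.
have FE n w : F n w = (exp_poly n).[s * X w] + (exp_poly n).[- (s * X w)].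
  rewrite !exp_polyE -big_split/=; apply: eq_bigr => k _.
  by rewrite exprNn exprMn /c; ring.
have iF n : integ (F n) by exact: (@integrable_lin _ _ _ P (fun k => c k * s ^+ k / k`!%:R) (fun k w => X w ^+ k) n (fun k _ => iX k)).
have F0 n w : 0 <= F n w.
  apply: sumr_ge0 => k _; set y := X w.
  rewrite (_ : _ * y ^+ k = (k`!%:R)^-1 * (c k * (s * y) ^+ k)); last first.
    by rewrite exprMn; ring.
  rewrite mulr_ge0 ?invr_ge0// /c -signr_odd -[in (s * y) ^+ _](odd_double_half k).
  case: (odd k) => /=; first by rewrite expr1 subrr mul0r.
  by rewrite add0n expr0 mulr_ge0 ?addr_ge0// -mul2n exprM exprn_ge0// sqr_ge0.
have Fcv w : F n w @[n --> \oo] --> expR (s * X w) + expR (- (s * X w)).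
  under eq_fun do rewrite FE.
  by apply: cvgD; exact: cvg_exp_poly.
pose I n := \int[P]_w F n w.
have IE n : I n = \sum_(k < n) c k * (a k * s ^+ k) by exact: Rintegral_exp_poly.
have IK n : I n <= 2 * K.
  rewrite IE; apply: le_trans (_ : \sum_(k < n) 2 * (a k * s ^+ k) <= _).
    by apply: ler_sum => k _; rewrite ler_wpM2r ?mulr_ge0 ?exprn_ge0.
  by rewrite -mulr_sumr ler_pM2l.
have Ind : nondecreasing_seq I.
  apply/nondecreasing_seqP => n; rewrite !IE big_ord_recr/= lerDl.
  by rewrite !mulr_ge0 ?exprn_ge0.
have Icv : cvgn I.
  by apply: nondecreasing_is_cvgn => //; exists (2 * K) => _ [n _ <-].
have [ig gle] := Rintegral_fatou iF F0 Fcv Icv.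
have lK : limn I <= 2 * K by apply: limr_le => //; apply: nearW.
have mX : measurable_fun setT (X : T -> R) by exact: measurable_funP.
have me : measurable_fun setT (fun w => expR (s * X w)).
  by apply: measurableT_comp => //; exact: measurable_tX.
have ie : integ (fun w => expR (s * X w)).
  apply: (integrable_le me _ ig) => w.
  by rewrite ger0_norm ?expR_ge0// lerDl expR_ge0.
split => //; apply: le_trans lK; apply: le_trans gle; apply: le_Rintegral => // w _.
by rewrite lerDl expR_ge0.
Qed.

Lemma mgf_lower s n : integ (fun w => expR (s * X w)) -> 0 <= s ->
  \sum_(k < n) a k * s ^+ k <= \int[P]_w expR (s * X w).
Proof.
move=> ie s0.
apply: (@le_trans _ _ (\sum_(k < n.*2) a k * s ^+ k)).
  rewrite -addnn big_split_ord/= lerDl; apply: sumr_ge0 => k _.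
  by rewrite mulr_ge0 ?exprn_ge0.
have -> : \sum_(k < n.*2) a k * s ^+ k = \int[P]_w (\sum_(k < n.*2) (1 * s ^+ k / k`!%:R) * X w ^+ k).
  by rewrite (Rintegral_exp_poly (fun=> 1)); apply: eq_bigr => k _; rewrite mul1r.
apply: le_Rintegral => //; first exact: (@integrable_lin _ _ _ P (fun k => 1 * s ^+ k / k`!%:R) (fun k w => X w ^+ k) n.*2 (fun k _ => iX k)).
move=> w _; apply: le_trans (le_exp_poly_double n (s * X w)).
rewrite exp_polyE le_eqVlt; apply/orP; left; apply/eqP; apply: eq_bigr => k _.
by rewrite exprMn mul1r; ring.
Qed.

End MgfFromMoments.

Section LevyLaw.
Local Open Scope complex_scope.
Local Notation normc := ComplexField.Normc.normc.
Local Notation Re := complex.Re.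
Local Notation Im := complex.Im.
Context {R : realType} (Psi : cumulativeBounded (0 : R) (1 : R)) (alpha : R).
Hypotheses (alpha0 : 0 < alpha) (Psi_supp : Psi alpha - Psi 0 = 1).
Context d (T : measurableType d) (P : probability T R) (X : {RV P >-> R}).
Variable (u : R).
Hypotheses (u0 : 0 < u) (law : is_Z_Psi Psi u X).

Let m := moment Psi.
Let E n := exp_levy_poly u m n.+2.

Let m_bounds k : 0 <= m k <= alpha ^+ k.
Proof. exact: moment_bounds. Qed.
Let m_ge0 k : 0 <= m k. Proof. by case/andP: (m_bounds k). Qed.

Lemma char_levy_jet n : exists2 B : R, 0 <= B & forall t, 0 < t <= 1 ->
  normc (char_fun X t - \sum_(k < n.+2) ((E n)`_k)%:C * ('i * t%:C) ^+ k)
    <= B * t ^+ n.+2.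
Proof.
have [B B0 HB] := levy_jet alpha0 Psi_supp n.
have [B' B'0 HB'] := cexp_levy_jet u0 B0 HB.
by exists B' => // t /HB'; rewrite law.
Qed.

(** Both polynomials are jets of one characteristic function. *)
Lemma exp_levy_coef_stable n n' k : (n <= n')%N -> (k < n.+2)%N ->
  (E n)`_k = (E n')`_k.
Proof.
move=> nn' kn.
have [B B0 HB] := char_levy_jet n; have [B' B'0 HB'] := char_levy_jet n'.
pose K := \sum_(k < n'.+2) `|(E n')`_k|.
have H t : 0 < t <= 1 ->
    normc (\sum_(k < n.+2) ((E n)`_k - (E n')`_k)%:C * ('i * t%:C) ^+ k)
    <= (B + B' + K) * t ^+ n.+2.
  move=> t01; have /andP[t0 t1] := t01.
  have h := HB t t01; have h' := HB' t t01.
  have tn : t ^+ n'.+2 <= t ^+ n.+2 by rewrite ler_wiXn2l// ltW.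
  set c := char_fun X t in h h'; set w := 'i * t%:C in h h' *.
  have nw : normc w = t by rewrite /w normc_it// ltW.
  pose S := \sum_(k < n.+2) ((E n)`_k)%:C * w ^+ k.
  pose S1 := \sum_(k < n.+2) ((E n')`_k)%:C * w ^+ k.
  pose S2 := \sum_(k < n'.+2) ((E n')`_k)%:C * w ^+ k.
  have -> : \sum_(k < n.+2) ((E n)`_k - (E n')`_k)%:C * w ^+ k = (c - S2) - (c - S) + (S2 - S1).
    rewrite (_ : _ - _ + _ = S - S1); last by ring.
    by rewrite /S /S1 -sumrB; apply: eq_bigr => j _; rewrite rmorphB mulrBl.
  rewrite mulrDl (le_trans (le_normcD _ _))// lerD//.
    rewrite (le_trans (le_normcD _ _))// normcN mulrDl addrC lerD//.
    by rewrite (le_trans h')// ler_wpM2l.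
  have nn2 : (n.+2 <= n'.+2)%N by [].
  have -> : S2 - S1 = \sum_(j < n'.+2 - n.+2) ((E n')`_(n.+2 + j))%:C * w ^+ (n.+2 + j).
    rewrite /S2 /S1 (_ : \sum_(k < n'.+2) _ =
      \sum_(k < n.+2 + (n'.+2 - n.+2)) ((E n')`_k)%:C * w ^+ k); last by rewrite subnKC.
    by rewrite big_split_ord/= addrAC subrr add0r.
  rewrite (le_trans (normc_sum _ _ _))//.
  apply: (@le_trans _ _ ((\sum_(j < n'.+2 - n.+2) `|(E n')`_(n.+2 + j)|) * t ^+ n.+2)).
    rewrite mulr_suml; apply: ler_sum => j _.
    rewrite ComplexField.Normc.normcM normc_real normcX nw ler_wpM2l//.
    by rewrite ler_wiXn2l ?leq_addr// ltW.
  rewrite ler_wpM2r ?exprn_ge0 ?(ltW t0)//.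
  rewrite /K (_ : \sum_(k < n'.+2) _ =
      \sum_(k < n.+2 + (n'.+2 - n.+2)) `|(E n')`_k|); last by rewrite subnKC.
  by rewrite big_split_ord/= lerDr sumr_ge0.
pose D j := (E n)`_j - (E n')`_j.
have re0 : re_ipow k * D k = 0.
  apply: (@jet_unique R (fun j => re_ipow j * D j) n.+2 (B + B' + K) _ k kn) => t t01.
  apply: le_trans (H t t01); apply: le_trans (Re_le_normc _).
  rewrite Re_sum le_eqVlt; apply/orP; left; apply/eqP; congr `|_|.
  by apply: eq_bigr => j _; rewrite [X in _ = Re X]mulrC ReMr Re_itX /D; ring.
have im0 : im_ipow k * D k = 0.
  apply: (@jet_unique R (fun j => im_ipow j * D j) n.+2 (B + B' + K) _ k kn) => t t01.
  apply: le_trans (H t t01); apply: le_trans (Im_le_normc _).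
  rewrite Im_sum le_eqVlt; apply/orP; left; apply/eqP; congr `|_|.
  by apply: eq_bigr => j _; rewrite [X in _ = Im X]mulrC ImMr Im_itX /D; ring.
apply/eqP; rewrite -subr_eq0; apply/eqP.
move: re0 im0 => /eqP; rewrite mulf_eq0 => /orP[/eqP r0|/eqP//].
move=> /eqP; rewrite mulf_eq0 => /orP[/eqP i0|/eqP//].
by case: (ipow_neq0 r0 i0).
Qed.

Definition levy_coef k : R := (E k)`_k.

Lemma levy_coefE n k : (k < n.+2)%N -> (E n)`_k = levy_coef k.
Proof.
move=> kn; have [nk|/ltnW kn'] := leqP n k; first exact: exp_levy_coef_stable.
by rewrite /levy_coef (@exp_levy_coef_stable k n)// ltnW.
Qed.

Lemma levy_coef_ge0 k : 0 <= levy_coef k.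
Proof. exact: (exp_levy_poly_nneg k.+2 (ltW u0) m_ge0). Qed.

Lemma levy_coef0 : levy_coef 0 = 1.
Proof.
rewrite /levy_coef -horner_coef0 horner_exp_levy_poly horner_coef0 coef_poly/= mulr0.
by rewrite exp_polyE !big_ord_recl big_ord0 expr0 expr0n/= mulr0 !addr0 fact0 invr1 mulr1.
Qed.

Lemma levy_coef_jet n : exists2 B : R, 0 <= B & forall t, 0 < t <= 1 ->
  normc (char_fun X t - \sum_(k < n.+2) (levy_coef k)%:C * ('i * t%:C) ^+ k)
    <= B * t ^+ n.+2.
Proof.
have [B B0 HB] := char_levy_jet n; exists B => // t /HB; apply: le_trans.
rewrite le_eqVlt; apply/orP; left; apply/eqP; congr (normc (_ - _)).
by apply: eq_bigr => k _; rewrite (levy_coefE (ltn_ord k)).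
Qed.

(** Upper bound: the partial sums of sum a_k s^k are below the value at s of the
    truncated exponential, all coefficients being nonnegative.  Lower bound: every
    partial sum of the exponential series of [u * levy_poly m N] is dominated,
    coefficient by coefficient, by a large enough truncation. *)
Lemma levy_law_mgf N (s : R) : 0 <= s <= 1 ->
  [/\ P.-integrable setT (EFin \o (fun w => expR (s * X w))),
    expR (u * (levy_poly m N).[s]) <= \int[P]_w expR (s * X w) &
    \int[P]_w expR (s * X w) <=
      2 * expR (u * ((levy_poly m N).[s] + expR alpha / alpha ^+ 2 * s ^+ N))].
Proof.
move=> s01; have /andP[s0 s1] := s01.
have iX := integrable_powX levy_coef0 levy_coef_jet.
have aE := moments_coef levy_coef0 levy_coef_jet.
have up n : \sum_(k < n) levy_coef k * s ^+ k <=
    expR (u * ((levy_poly m N).[s] + expR alpha / alpha ^+ 2 * s ^+ N)).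
  apply: (@le_trans _ _ (E n).[s]).
    apply: le_trans (sum_coef_le n (exp_levy_poly_nneg n.+2 (ltW u0) m_ge0) s0).
    apply: ler_sum => k _; rewrite -/(E n) levy_coefE//.
    by rewrite (leq_trans (ltn_ord k))// -addn2 leq_addr.
  rewrite horner_exp_levy_poly (le_trans (exp_poly_le _ _))//.
    by rewrite mulr_ge0 ?(ltW u0)// horner_ge0//; exact: levy_poly_nneg.
  by rewrite ler_expR ler_pM2l//; exact: levy_poly_tail.
have [ie le] := mgf_upper iX aE levy_coef_ge0 s0 up.
split => //.
have lo J : (exp_poly J).[u * (levy_poly m N).[s]] <= \int[P]_w expR (s * X w).
  pose Q : {poly R} := \sum_(j < J) (u ^+ j / j`!%:R) *: levy_poly m N ^+ j.
  have -> : (exp_poly J).[u * (levy_poly m N).[s]] = Q.[s].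
    rewrite /Q horner_sum exp_polyE; apply: eq_bigr => j _.
    by rewrite hornerZ horner_exp exprMn mulrA [_ / _]mulrC.
  pose n := (size Q + (J + N))%N.
  apply: (@le_trans _ _ (\sum_(k < size Q) levy_coef k * s ^+ k)); last first.
    exact: (mgf_lower iX aE levy_coef_ge0 (size Q) ie s0).
  rewrite horner_coef; apply: ler_sum => k _; rewrite ler_wpM2r ?exprn_ge0//.
  rewrite -(@levy_coefE n); last first.
    by rewrite (leq_trans (ltn_ord k))// /n -addn2 -addnA leq_addr.
  have Jn : (J <= n.+2)%N by rewrite /n; lia.
  have Nn : (N <= n.+2)%N by rewrite /n; lia.
  have LN : nneg_coef (levy_poly m n.+2 - levy_poly m N).
    move=> j; rewrite coefB !coef_poly; set c := (if (1 < j)%N then _ else _).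
    have c0 : 0 <= c by rewrite /c; case: ifP => // _; rewrite divr_ge0.
    have [jN|_] := ltnP j N; first by rewrite (leq_trans jN Nn) subrr.
    by rewrite subr0; case: ifP.
  have dE : nneg_coef (E n - Q).
    have -> : E n = \sum_(j < J + (n.+2 - J)) (u ^+ j / j`!%:R) *: levy_poly m n.+2 ^+ j.
      by rewrite subnKC.
    rewrite big_split_ord/= addrAC; apply: nneg_coefD.
      rewrite /Q -sumrB; apply: nneg_coef_sum => j; rewrite -scalerBr.
      apply: nneg_coefZ; first by rewrite divr_ge0 ?exprn_ge0 ?(ltW u0).
      by apply: nneg_coef_subX => //; exact: levy_poly_nneg.
    apply: nneg_coef_sum => j; apply: nneg_coefZ.
      by rewrite divr_ge0 ?exprn_ge0 ?(ltW u0).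
    by apply: nneg_coefX; exact: levy_poly_nneg.
  by have := dE k; rewrite coefB subr_ge0.
apply: (ler_cvg_to (@cvg_exp_poly _ _) (cvg_cst _)); apply: nearW => J; exact: lo.
Qed.

End LevyLaw.

(** * Comparing generating functions through tails *)

Section Grid.
Context {R : realType}.
Implicit Types (s y v : R) (J j : nat) (p M : R -> R).

(** From one grid point to the next e^(s y) grows by the factor e. *)
Definition grid y s j : R := y + j%:R / s.

Lemma expR_gridS s y j : 0 < s ->
  expR (s * grid y s j.+1) = expR 1 * expR (s * grid y s j).
Proof.
by move=> s0; rewrite -expRD; congr expR; rewrite /grid -natr1; field; rewrite gt_eqF.
Qed.

Lemma expR1_ge2 : 2 <= expR 1 :> R.
Proof. by have := expR_ge1Dx (1 : R); lra. Qed.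

Lemma sum_expR_grid s y J : 0 < s ->
  \sum_(j < J) expR (s * grid y s j) <= expR (s * grid y s J).
Proof.
move=> s0; elim: J => [|J IH]; first by rewrite big_ord0 expR_ge0.
rewrite big_ord_recr/= expR_gridS// (le_trans (lerD IH (lexx _)))//.
by have := expR1_ge2; have := expR_gt0 (s * grid y s J); nra.
Qed.

Lemma sum_expR_grid_below s y J v : 0 < s ->
  \sum_(j < J) expR (s * grid y s j) * (grid y s j <= v)%R%:R <= 2 * expR (s * v).
Proof.
move=> s0; elim: J => [|J IH]; first by rewrite big_ord0 mulr_ge0 ?expR_ge0.
rewrite big_ord_recr/=; case: (boolP (grid y s J <= v)) => [yv|_]; last by rewrite mulr0 addr0.
rewrite mulr1; have h1 : \sum_(j < J) expR (s * grid y s j) * (grid y s j <= v)%R%:R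
    <= expR (s * grid y s J).
  apply: le_trans (sum_expR_grid _ _ s0); apply: ler_sum => j _.
  by rewrite ler_piMr ?expR_ge0// lern1 leq_b1.
have h2 : expR (s * grid y s J) <= expR (s * v) by rewrite ler_expR ler_pM2l.
lra.
Qed.

Lemma expR_le_grid s y J v : 0 < s ->
  expR (s * v) <= expR (s * y) +
    \sum_(j < J) expR (s * grid y s j.+1) * (grid y s j <= v)%R%:R +
    expR (- (s * grid y s J)) * expR (2 * s * v).
Proof.
move=> s0.
have S0 : 0 <= \sum_(j < J) expR (s * grid y s j.+1) * (grid y s j <= v)%R%:R.
  by apply: sumr_ge0 => j _; rewrite mulr_ge0 ?expR_ge0.
have e1 := expR_ge0 (s * y); have e2 := expR_ge0 (- (s * grid y s J)).
have e3 := expR_ge0 (2 * s * v); have e4 := mulr_ge0 e2 e3.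
have [vy|yv] := ltP v y.
  have : expR (s * v) <= expR (s * y) by rewrite ler_expR ler_pM2l// ltW.
  lra.
have [Jv|vJ] := leP (grid y s J) v.
  suff : expR (s * v) <= expR (- (s * grid y s J)) * expR (2 * s * v) by lra.
  rewrite -expRD ler_expR.
  have : s * grid y s J <= s * v by rewrite ler_pM2l.
  lra.
pose j := Num.truncn ((v - y) * s).
have /andP[j1 j2] : j%:R <= (v - y) * s < j.+1%:R.
  by apply: truncn_itv; rewrite mulr_ge0 ?subr_ge0 ?(ltW s0).
have jv : grid y s j <= v by rewrite /grid addrC -lerBrDr ler_pdivrMr.
have vj : v <= grid y s j.+1.
  by rewrite /grid addrC -lerBlDr ler_pdivlMr// ltW.
have jJ : (j < J)%N.
  rewrite -(ltr_nat R) (le_lt_trans j1)//.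
  by rewrite -ltr_pdivlMr// ltrBlDr addrC.
suff : expR (s * v) <= \sum_(j < J) expR (s * grid y s j.+1) * (grid y s j <= v)%R%:R by lra.
rewrite (bigD1 (Ordinal jJ))//= jv mulr1 ler_wpDr//.
  by apply: sumr_ge0 => i _; rewrite mulr_ge0 ?expR_ge0.
by rewrite ler_expR ler_pM2l.
Qed.

(** Satisfied when [p] is the tail and [M] the moment generating function of one
    law; the last term is Chernoff's bound for the values beyond the grid. *)
Definition tail_mgf_upper p M := forall s y J, 0 < s -> 2 * s <= 1 ->
  M s <= expR (s * y) + \sum_(j < J) expR (s * grid y s j.+1) * p (grid y s j)
       + expR (- (s * grid y s J)) * M (2 * s).

Definition tail_mgf_lower p M := forall s y J, 0 < s -> 2 * s <= 1 ->
  \sum_(j < J) expR (s * grid y s j) * p (grid y s j) <= 2 * M s.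

Definition cumulant_control_at (V : R) (m : nat -> R) M (C0 s0 : R) N (B : R) :=
  forall s, 0 <= s <= s0 ->
   expR (V * (levy_poly m N).[s]) <= C0 * M s /\
   M s <= C0 * expR (V * ((levy_poly m N).[s] + B * s ^+ N)).

Lemma levy_poly2 (m : nat -> R) s : (levy_poly m 2).[s] = 0.
Proof. by rewrite horner_poly !big_ord_recl big_ord0/= !mul0r !addr0. Qed.

Lemma levy_poly3 (m : nat -> R) s : (levy_poly m 3).[s] = m 0%N / 2 * s ^+ 2.
Proof. by rewrite horner_poly !big_ord_recl big_ord0/= !mul0r !add0r addr0. Qed.

(** The grid runs from [sg] to about 4 B2 s sg^2.  Below it, e^(s sg) is at most
    e^((s sg)^2 / 2), which [MB] controls; on it the tails are comparable; beyond
    it, Chernoff's bound with [2 * s] leaves a constant. *)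
Lemma mgf_compare (sg s C0 s0 B2 B3 : R) (mA mB : nat -> R) (pA pB MA MB : R -> R) :
  1 <= C0 -> s0 <= 1 -> 0 <= B2 ->
  tail_mgf_upper pA MA -> tail_mgf_lower pB MB ->
  cumulant_control_at (sg ^+ 2) mA MA C0 s0 2 B2 ->
  cumulant_control_at (sg ^+ 2) mB MB C0 s0 3 B3 ->
  mB 0%N = 1 -> 0 < s -> 2 * s <= s0 -> 2 <= s * sg ->
  (forall y, sg <= y -> y <= (1 + 4 * B2) * (s * sg) * sg -> pA y <= 2 * pB y) ->
  MA s <= (C0 + 4 * expR 1 + C0 ^+ 2) * MB s.
Proof.
move=> C1 s01 B20 upA loB cA cB mB0 sp s2 ssg pAB.
have s21 : 2 * s <= 1 by exact: le_trans s2 s01.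
have ss0 : 0 <= s <= s0 by rewrite ltW//=; lra.
have C00 : 0 < C0 by lra.
have sg0 : 0 < sg by rewrite -(pmulr_rgt0 _ sp); lra.
(* the number of steps that makes Chernoff's term at most C0 *)
pose J := (Num.truncn (4 * B2 * (s * sg) ^+ 2)).+1.
have /andP[j1 j2] : (Num.truncn (4 * B2 * (s * sg) ^+ 2))%:R <= 4 * B2 * (s * sg) ^+ 2
     < (Num.truncn (4 * B2 * (s * sg) ^+ 2)).+1%:R.
  by apply: truncn_itv; rewrite mulr_ge0 ?exprn_ge0// ?mulr_ge0 ?(ltW sp) ?(ltW sg0).
have lowB : expR (s * sg) <= C0 * MB s.
  have [h _] := cB s ss0; apply: le_trans h; rewrite ler_expR levy_poly3 mB0.
  rewrite (_ : sg ^+ 2 * _ = (s * sg) * (s * sg) / 2); last by rewrite !expr2; field.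
  nra.
have oneB : 1 <= C0 * MB s.
  by apply: le_trans lowB; rewrite -expR0 ler_expR; lra.
have MB0 : 0 <= MB s by rewrite -(pmulr_rge0 _ C00); lra.
have := upA s sg J sp s21.
have T3 : expR (- (s * grid sg s J)) * MA (2 * s) <= C0.
  have s2' : 0 <= 2 * s <= s0 by rewrite mulr_ge0 ?(ltW sp).
  have [_ h] := cA _ s2'.
  apply: le_trans (ler_wpM2l (expR_ge0 _) h) _.
  rewrite mulrCA -expRD -[leRHS]mulr1 ler_wpM2l ?(ltW C00)// expR_le1.
  rewrite levy_poly2 add0r /grid mulrDr [s * (_ / s)]mulrCA mulfV ?gt_eqF// mulr1.
  have : sg ^+ 2 * (B2 * (2 * s) ^+ 2) = 4 * B2 * (s * sg) ^+ 2 by ring.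
  move=> ->.
  rewrite {1}/J; have := ltW j2; lra.
have T2 : \sum_(j < J) expR (s * grid sg s j.+1) * pA (grid sg s j) <= 4 * expR 1 * MB s.
  apply: (@le_trans _ _ (\sum_(j < J) (2 * expR 1) * (expR (s * grid sg s j) * pB (grid sg s j)))).
    apply: ler_sum => j _; rewrite expR_gridS//.
    rewrite (_ : _ * (_ * _) = (expR 1 * expR (s * grid sg s j)) * (2 * pB (grid sg s j))); last by ring.
    rewrite ler_wpM2l ?mulr_ge0 ?expR_ge0//; apply: pAB.
      by rewrite lerDl divr_ge0// ltW.
    have jJ : (j%:R : R) <= 4 * B2 * (s * sg) ^+ 2.
      by apply: le_trans j1; rewrite ler_nat -ltnS; exact: ltn_ord.
    rewrite /grid; have h : j%:R / s <= 4 * B2 * (s * sg) * sg.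
      by rewrite ler_pdivrMr// (le_trans jJ)// le_eqVlt; apply/orP; left; apply/eqP; ring.
    have : sg <= s * sg * sg by nra.
    lra.
  rewrite -mulr_sumr (_ : 4 * expR 1 * MB s = (2 * expR 1) * (2 * MB s)); last by ring.
  by rewrite ler_wpM2l ?mulr_ge0 ?expR_ge0//; exact: loB.
move=> h; apply: le_trans h _; rewrite [leRHS]mulrDl [X in _ <= X + _]mulrDl.
have : C0 <= C0 ^+ 2 * MB s by rewrite expr2 -mulrA ler_peMr// ltW.
lra.
Qed.

Lemma cumulant_diff (sg s C0 s0 B C1 : R) N (mA mB : nat -> R) (MA MB : R -> R) :
  1 <= C0 -> 1 <= C1 -> 
  cumulant_control_at (sg ^+ 2) mA MA C0 s0 N B ->
  cumulant_control_at (sg ^+ 2) mB MB C0 s0 N B ->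
  0 <= s <= s0 -> MA s <= C1 * MB s ->
  sg ^+ 2 * ((levy_poly mA N).[s] - (levy_poly mB N).[s]) <=
    ln (C0 ^+ 2 * C1) + sg ^+ 2 * (B * s ^+ N).
Proof.
move=> C01 C11 cA cB ss0 MAB.
have [hA _] := cA s ss0; have [_ hB] := cB s ss0.
have C00 : 0 < C0 by lra. have C10 : 0 < C1 by lra.
have CC : 0 < C0 ^+ 2 * C1 by rewrite mulr_gt0 ?exprn_gt0.
suff : expR (sg ^+ 2 * (levy_poly mA N).[s]) <=
    expR (ln (C0 ^+ 2 * C1) + sg ^+ 2 * ((levy_poly mB N).[s] + B * s ^+ N)).
  rewrite ler_expR; lra.
rewrite expRD lnK ?posrE// (le_trans hA)// expr2.
set E := expR _ in hB *; rewrite (_ : C0 * C0 * C1 * E = C0 * (C1 * (C0 * E))); last by ring.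
by rewrite ler_pM2l// (le_trans MAB)// ler_pM2l.
Qed.

End Grid.

(** * Convergence of the moments *)

Section MomentConvergence.
Context {R : realType}.

Lemma cumulant_control_le (V : R) m M (C0 s0 : R) N (B B' : R) :
  0 <= V -> 0 <= C0 -> B <= B' ->
  cumulant_control_at V m M C0 s0 N B -> cumulant_control_at V m M C0 s0 N B'.
Proof.
move=> V0 C00 BB c s ss0; have [h1 h2] := c s ss0; split => //.
apply: le_trans h2 _; rewrite ler_wpM2l// ler_expR ler_wpM2l// lerD2l.
by rewrite ler_wpM2r// exprn_ge0//; case/andP: ss0.
Qed.

Variables (sg : R -> R) (mA : R -> nat -> R) (mB : nat -> R).
Variables (MA MB pA pB : R -> R -> R) (C0 s0 : R).
Hypothesis sg_infty : sg x @[x --> +oo] --> +oo.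
Hypotheses (C01 : 1 <= C0) (s0_gt0 : 0 < s0) (s01 : s0 <= 1).
Hypothesis ctrlA : forall N, (1 < N)%N -> exists2 B, 0 <= B &
  \forall x \near +oo, cumulant_control_at (sg x ^+ 2) (mA x) (MA x) C0 s0 N B.
Hypothesis ctrlB : forall N, (1 < N)%N -> exists2 B, 0 <= B &
  \forall x \near +oo, cumulant_control_at (sg x ^+ 2) mB (MB x) C0 s0 N B.
Hypothesis upA : \forall x \near +oo, tail_mgf_upper (pA x) (MA x).
Hypothesis loA : \forall x \near +oo, tail_mgf_lower (pA x) (MA x).
Hypothesis upB : \forall x \near +oo, tail_mgf_upper (pB x) (MB x).
Hypothesis loB : \forall x \near +oo, tail_mgf_lower (pB x) (MB x).
Hypothesis tails : forall e K : R, 0 < e -> 0 < K -> \forall x \near +oo, forall y,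
  sg x <= y -> y <= K * sg x `^ (1 - e) * sg x ->
  pA x y <= 2 * pB x y /\ pB x y <= 2 * pA x y.
Hypotheses (mA0 : \forall x \near +oo, mA x 0%N = 1) (mB0 : mB 0%N = 1).

Lemma sg_ge (c : R) : \forall x \near +oo, c <= sg x.
Proof. by move/cvgryPge : sg_infty; exact. Qed.

Lemma scale_small (e c : R) : 0 < e -> 0 < c ->
  \forall x \near +oo, sg x `^ (- e) <= c.
Proof.
move=> e0 c0; near=> x.
have sg1 : 1 <= sg x by near: x; exact: sg_ge.
have h : c `^ (- e^-1) <= sg x by near: x; exact: sg_ge.
rewrite powRN -[leRHS]invrK lef_pV2 ?posrE ?invr_gt0//; last first.
  by rewrite powR_gt0// (lt_le_trans ltr01).
apply: le_trans (ge0_ler_powR (ltW e0) _ _ h); rewrite ?nnegrE ?powR_ge0//; last first.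
  by rewrite (le_trans ler01).
by rewrite -powRrM mulNr mulVf ?gt_eqF// powR_inv1// ltW.
Unshelve. all: end_near. Qed.

(** At s = sg^-e the grid of [mgf_compare] covers sg <= y <= K sg^(1-e) sg. *)
Lemma cumulant_close (e : R) N : 0 < e -> e <= 2^-1 -> (1 < N)%N ->
  exists L B : R, [/\ 0 <= L, 0 <= B & \forall x \near +oo,
    sg x ^+ 2 * `|(levy_poly (mA x) N).[sg x `^ (- e)] - (levy_poly mB N).[sg x `^ (- e)]|
      <= L + sg x ^+ 2 * (B * (sg x `^ (- e)) ^+ N)].
Proof.
move=> e0 e2 N1.
have C00 : 0 <= C0 by exact: le_trans ler01 C01.
have [BA BA0 cA] := ctrlA N1; have [BB BB0 cB] := ctrlB N1.
have [BA2 BA20 cA2] := ctrlA (erefl : (1 < 2)%N).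
have [BB2 BB20 cB2] := ctrlB (erefl : (1 < 2)%N).
have [BA3 BA30 cA3] := ctrlA (erefl : (1 < 3)%N).
have [BB3 BB30 cB3] := ctrlB (erefl : (1 < 3)%N).
pose B := Num.max BA BB; pose B2 := Num.max BA2 BB2.
pose C1 := C0 + 4 * expR 1 + C0 ^+ 2.
have C11 : 1 <= C1.
  have := expR_ge0 (1 : R); have : 0 <= C0 ^+ 2 by rewrite exprn_ge0.
  by have := C01; rewrite /C1; set z := C0 ^+ 2; lra.
have CC1 : 1 <= C0 ^+ 2 * C1.
  by rewrite -[1]mulr1 ler_pM// exprn_ege1.
exists (ln (C0 ^+ 2 * C1)), B; split.
- by rewrite ln_ge0.
- by rewrite le_max BA0.
have K0 : 0 < 1 + 4 * B2 by rewrite ltr_wpDr// mulr_ge0// le_max BA20.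
have B20 : 0 <= B2 by rewrite le_max BA20.
have s02 : 0 < s0 / 2 by rewrite divr_gt0.
have tl := tails e0 K0.
near=> x.
set s := sg x `^ (- e).
have sg4 : 4 <= sg x by near: x; exact: sg_ge.
have sg0 : 0 < sg x by lra.
have sp : 0 < s by exact: powR_gt0.
have s2 : 2 * s <= s0.
  by rewrite mulrC -ler_pdivlMr// ?/s; near: x; apply: scale_small => //.
have ssgE : s * sg x = sg x `^ (1 - e).
  by rewrite /s -{2}(powRr1 (ltW sg0)) -powRD ?(gt_eqF sg0) ?implybT// addrC.
have ssg : 2 <= s * sg x.
  rewrite ssgE; apply: (@le_trans _ _ (4 `^ 2^-1)).
    by rewrite (_ : 4 = 2 ^+ 2); [rewrite -powR_mulrn// -powRrM mulfV// powRr1|lra].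
  apply: (@le_trans _ _ (sg x `^ 2^-1)).
    by apply: ge0_ler_powR; rewrite ?nnegrE// ltW.
  by apply: ler_powR; lra.
have sg20 : 0 <= sg x ^+ 2 by exact: sqr_ge0.
have ss0 : 0 <= s <= s0 by rewrite ltW//=; lra.
have tlx : forall y, sg x <= y -> y <= (1 + 4 * B2) * (s * sg x) * sg x ->
   pA x y <= 2 * pB x y /\ pB x y <= 2 * pA x y.
  by rewrite ssgE; near: x; exact: tl.
have hAB : MA x s <= C1 * MB x s.
  apply: (mgf_compare C01 s01 B20 (pA := pA x) (pB := pB x) (mA := mA x) (mB := mB) (B3 := BB3) (sg := sg x)) => //.
  - by near: x.
  - by near: x.
  - apply: (@cumulant_control_le _ _ _ _ _ _ BA2) => //; first by rewrite le_max lexx.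
    by near: x.
  - by near: x.
  - by move=> y h1 h2; have [] := tlx y h1 h2.
have hBA : MB x s <= C1 * MA x s.
  apply: (mgf_compare C01 s01 B20 (pA := pB x) (pB := pA x) (mA := mB) (mB := mA x) (B3 := BA3) (sg := sg x)) => //.
  - by near: x.
  - by near: x.
  - apply: (@cumulant_control_le _ _ _ _ _ _ BB2) => //; first by rewrite le_max lexx orbT.
    by near: x.
  - by near: x.
  - by near: x.
  - by move=> y h1 h2; have [] := tlx y h1 h2.
have cAx : cumulant_control_at (sg x ^+ 2) (mA x) (MA x) C0 s0 N B.
  apply: (@cumulant_control_le _ _ _ _ _ _ BA) => //; first by rewrite le_max lexx.
  by near: x.
have cBx : cumulant_control_at (sg x ^+ 2) mB (MB x) C0 s0 N B.
  apply: (@cumulant_control_le _ _ _ _ _ _ BB) => //; first by rewrite le_max lexx orbT.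
  by near: x.
have d1 := cumulant_diff C01 C11 cAx cBx ss0 hAB.
have d2 := cumulant_diff C01 C11 cBx cAx ss0 hBA.
rewrite -{1}(ger0_norm sg20) -normrM ler_norml d1 andbT lerNl -mulrN opprB.
exact: d2.
Unshelve. all: end_near. Qed.

Lemma levy_poly_diff (m m' : nat -> R) k (s : R) :
  (levy_poly m k.+3).[s] - (levy_poly m' k.+3).[s] =
  \sum_(i < k.+1) (m i - m' i) / (i.+2)`!%:R * s ^+ i.+2.
Proof.
rewrite !horner_poly -sumrB [LHS]big_ord_recl [X in _ + X = _]big_ord_recl/=.
rewrite !mul0r !subr0 !add0r.
apply: eq_bigr => i _.
by rewrite /bump/= !add1n subSS subSS subn0; ring.
Qed.

(** Choose e = kappa / (k+3), so that s^(k+3) = sg^-kappa for s = sg^-e.  Then the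
    differences of lower index, the O(1) of [cumulant_close] divided by sg^2
    and its O(s^(k+3)) are all O(s^(k+3)), whereas the difference of index [k]
    comes with the factor s^(k+2): it is O(s). *)
Lemma moments_rate k : exists kappa B : R,
  [/\ 0 < kappa, kappa <= 2^-1, 0 <= B & \forall x \near +oo,
    forall i, (i < k)%N -> `|mA x i - mB i| <= B * sg x `^ (- kappa)].
Proof.
elim: k => [|k [kappa [B [k0 k2 B0 IH]]]].
  by exists 2^-1, 0; split => //; near=> x.
pose e := kappa / k.+3%:R.
have e0 : 0 < e by rewrite divr_gt0.
have ek : e <= kappa by rewrite ler_piMr ?(ltW k0)// invf_le1// ler1n.
have e2 : e <= 2^-1 by exact: le_trans ek k2.
have [L [B' [L0 B'0 H]]] := cumulant_close e0 e2 (isT : (1 < k.+3)%N).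
pose B1 := B + (k.+2)`!%:R * (L + B' + k%:R * B).
have f0 : 0 <= (k.+2)`!%:R :> R by [].
exists e, B1; split => //.
  by rewrite addr_ge0// mulr_ge0// !addr_ge0// mulr_ge0.
near=> x.
set s := sg x `^ (- e).
have sg1 : 1 <= sg x by near: x; exact: sg_ge.
have sg0 : 0 < sg x by lra.
have sp : 0 < s by exact: powR_gt0.
have s1 : s <= 1 by rewrite /s; near: x; exact: scale_small.
have sk : sg x `^ (- kappa) = s ^+ k.+3.
  rewrite -powR_mulrn ?(ltW sp)// /s -powRrM; congr powR.
  by rewrite /e mulNr mulfVK// pnatr_eq0.
have IHx : forall i, (i < k)%N -> `|mA x i - mB i| <= B * s ^+ k.+3.
  by rewrite -sk; near: x.
have Hx : sg x ^+ 2 * `|(levy_poly (mA x) k.+3).[s] - (levy_poly mB k.+3).[s]|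
   <= L + sg x ^+ 2 * (B' * s ^+ k.+3) by rewrite /s; near: x.
have ss : s ^+ k.+3 <= s by rewrite -[leRHS]expr1 ler_wiXn2l// ltW.
have sk2 : 0 < s ^+ k.+2 by rewrite exprn_gt0.
have sk3 : s ^+ k.+3 = s * s ^+ k.+2 by rewrite exprS.
have K0 : 0 <= L + B' + k%:R * B by rewrite !addr_ge0// mulr_ge0.
move=> i; rewrite ltnS leq_eqVlt => /predU1P[->{i}|ik]; last first.
  apply: le_trans (IHx i ik) _; apply: (@le_trans _ _ (B * s)); first by rewrite ler_wpM2l.
  by rewrite ler_wpM2r ?(ltW sp)// /B1 lerDl mulr_ge0.
have V1 : (sg x ^+ 2)^-1 <= s * s ^+ k.+2.
  rewrite -sk3 -sk powRN lef_pV2 ?posrE ?exprn_gt0 ?powR_gt0// -powR_mulrn ?(ltW sg0)//.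
  by apply: ler_powR => //; lra.
have V0 : 0 < sg x ^+ 2 by rewrite exprn_gt0.
have P1 : `|(levy_poly (mA x) k.+3).[s] - (levy_poly mB k.+3).[s]| <= (L + B') * (s * s ^+ k.+2).
  rewrite -(ler_pM2l V0) (le_trans Hx)// -sk3 mulrDl mulrDr lerD2r.
  rewrite mulrCA ler_peMr// -ler_pdivrMl// mulr1 sk3//.
have P2 : `|\sum_(i < k) (mA x i - mB i) / (i.+2)`!%:R * s ^+ i.+2| <= k%:R * B * (s * s ^+ k.+2).
  rewrite (le_trans (ler_norm_sum _ _ _))// -mulrA mulr_natl.
  rewrite -[k in _ *+ k]card_ord -sumr_const; apply: ler_sum => i _.
  have p0 : 0 <= s ^+ i.+2 by rewrite exprn_ge0 ?(ltW sp).
  have p1 : s ^+ i.+2 <= 1 by rewrite exprn_ile1 ?(ltW sp).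
  move: p0 p1; set p := s ^+ i.+2; clearbody p => p0 p1.
  rewrite -sk3 !normrM (le_trans _ (IHx i (ltn_ord i)))// -[leRHS]mulr1 -mulrA.
  rewrite ler_wpM2l// normfV normr_nat (ger0_norm p0).
  by rewrite mulr_ile1 ?invr_ge0// invf_le1 ?ltr0n ?ler1n ?fact_gt0.
rewrite levy_poly_diff big_ord_recr/= in P1.
set p := s ^+ k.+2 in P1 P2 sk2 *; clearbody p.
set S := \sum_(i < k) _ in P1 P2; set Dk := mA x k - mB k in P1 *.
have P3 : `|Dk / (k.+2)`!%:R * p| <= (L + B' + k%:R * B) * s * p.
  rewrite -[X in `|X|](addKr S) addrC (le_trans (ler_normB _ _))//.
  by rewrite (le_trans (lerD P1 P2))// -mulrDl mulrA.
move: P3; rewrite !normrM (gtr0_norm sk2) ler_pM2r// normfV normr_nat.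
rewrite ler_pdivrMr ?ltr0n ?fact_gt0// => h; apply: le_trans h _.
by rewrite mulrC mulrA ler_wpM2r ?(ltW sp)// /B1 lerDr.
Unshelve. all: end_near. Qed.

Lemma moments_converge k : mA x k @[x --> +oo] --> mB k.
Proof.
have [kappa [B [k0 k2 B0 H]]] := moments_rate k.+1.
apply/cvgrPdist_le => e e0.
have B1 : 0 < B + 1 by lra.
have eB : 0 < e / (B + 1) by rewrite divr_gt0.
near=> x.
have Hx : `|mA x k - mB k| <= B * sg x `^ (- kappa).
  have : forall i, (i < k.+1)%N -> `|mA x i - mB i| <= B * sg x `^ (- kappa) by near: x.
  exact.
rewrite distrC (le_trans Hx)//.
apply: (@le_trans _ _ ((B + 1) * sg x `^ (- kappa))).
  by rewrite ler_wpM2r ?powR_ge0// lerDl.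
by rewrite mulrC -ler_pdivlMr// ?/s; near: x; apply: scale_small => //.
Unshelve. all: end_near. Qed.

End MomentConvergence.

(** * From moments to weak convergence *)

Section StepPoly.
Context {R : realType}.
Implicit Types (u b c w A eta : R).

Lemma bernoulli_ge w M : 0 <= 1 + w -> 1 + M%:R * w <= (1 + w) ^+ M.
Proof.
move=> w1; elim: M => [|M IH]; first by rewrite mul0r addr0.
rewrite exprS (le_trans _ (ler_wpM2l w1 IH))// -natr1.
have : 0 <= M%:R * (w * w) by rewrite mulr_ge0// -expr2 sqr_ge0.
lra.
Qed.

Lemma power_step_bounds w M : 0 <= w <= 1 ->
  1 - M%:R * w <= (1 - w) ^+ M /\ (1 - w) ^+ M * (1 + M%:R * w) <= 1.
Proof.
move=> /andP[w0 w1]; split; first by have := @bernoulli_ge (- w) M; rewrite mulrN subr_ge0; exact.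
have w1' : 0 <= 1 - w by lra.
apply: le_trans (ler_wpM2l (exprn_ge0 M w1') (bernoulli_ge M _)) _; first by lra.
by rewrite -exprMn exprn_ile1// ?mulr_ge0//; nra.
Qed.

Lemma expr_lt_eventually (q eta : R) : 0 <= q -> q < 1 -> 0 < eta ->
  exists n, q ^+ n <= eta.
Proof.
move=> q0 q1 eta0; have : `|q| < 1 by rewrite ger0_norm.
move=> /cvg_expr /cvgrPdist_le /(_ _ eta0) [n _ /(_ n (leqnn n))].
by rewrite /= sub0r normrN ger0_norm ?exprn_ge0// => h; exists n.
Qed.

(** Take p(u) = (1 - (u/(Kc))^n)^(K^n) with b < c < b' and K c >= A, so that
    u/(Kc) stays in [0, 1].  By Bernoulli's inequality p(u) is at least
    1 - (u/c)^n and at most (c/u)^n, and n large finishes. *)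
Lemma step_poly (b b' A eta : R) : 0 < b -> b < b' -> 0 <= A -> 0 < eta ->
  exists p : {poly R}, forall u, 0 <= u <= A ->
    (u <= b)%R%:R - eta <= p.[u] <= (u <= b')%R%:R + eta.
Proof.
move=> b0 bb' A0 eta0.
(* the step takes place at c *)
pose c := (b + b') / 2.
have bc : b < c by rewrite /c; lra.
have cb' : c < b' by rewrite /c; lra.
have c0 : 0 < c by lra.
pose K := (Num.truncn (A / c)).+1.
have KA : A <= K%:R * c.
  have /andP[_ h] : (Num.truncn (A / c))%:R <= A / c < K%:R.
    by apply: truncn_itv; rewrite divr_ge0// ltW.
  by rewrite -ler_pdivrMr// ltW.
have q1 : 0 <= b / c by rewrite divr_ge0// ltW.
have q2 : 0 <= c / b' by rewrite divr_ge0 ?ltW//; lra.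
have [n1 h1] : exists n, (b / c) ^+ n <= eta.
  by apply: expr_lt_eventually => //; rewrite ltr_pdivrMr// mul1r.
have [n2 h2] : exists n, (c / b') ^+ n <= eta.
  by apply: expr_lt_eventually => //; rewrite ltr_pdivrMr ?mul1r//; lra.
pose n := (n1 + n2)%N.
have hn1 : (b / c) ^+ n <= eta.
  apply: le_trans h1; apply: ler_wiXn2l => //; last exact: leq_addr.
  by rewrite ler_pdivrMr// mul1r ltW.
have hn2 : (c / b') ^+ n <= eta.
  apply: le_trans h2; apply: ler_wiXn2l => //; last exact: leq_addl.
  by rewrite ler_pdivrMr ?mul1r ?ltW//; lra.
have K0 : 0 < K%:R * c by rewrite mulr_gt0.
exists ((1 - ((K%:R * c)^-1 *: 'X) ^+ n) ^+ (K ^ n)) => u /andP[u0 uA].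
rewrite horner_exp hornerD hornerN hornerC horner_exp hornerZ hornerX.
set w := ((K%:R * c)^-1 * u) ^+ n.
have v01 : 0 <= (K%:R * c)^-1 * u <= 1.
  by rewrite mulr_ge0 ?invr_ge0 ?(ltW K0)//= ler_pdivrMl// mulr1 (le_trans uA).
have w01 : 0 <= w <= 1.
  by case/andP: v01 => v0 v1; rewrite exprn_ge0// exprn_ile1.
have Mw : (K ^ n)%:R * w = (u / c) ^+ n.
  rewrite /w natrX -exprMn; congr (_ ^+ n); field; rewrite gt_eqF//=.
  by rewrite pnatr_eq0.
have [lo hi] := power_step_bounds (K ^ n) w01.
have p0 : 0 <= (1 - w) ^+ (K ^ n) by rewrite exprn_ge0// subr_ge0; case/andP: w01.
have p1 : (1 - w) ^+ (K ^ n) <= 1 by rewrite exprn_ile1//; case/andP: w01; lra.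
rewrite Mw in lo hi; set p := (1 - w) ^+ _ in lo hi p0 p1 *.
apply/andP; split.
- case: (leP u b) => ub /=; last by lra.
  have : (u / c) ^+ n <= (b / c) ^+ n.
    have ucb : u / c <= b / c by rewrite ler_pM2r ?invr_gt0.
    by apply: lerXn2r => //; rewrite nnegrE divr_ge0 ?(ltW c0).
  by move: lo; rewrite mulr1n; lra.
- case: (leP u b') => ub /=; first by rewrite mulr1n; lra.
  rewrite mulr0n add0r (le_trans _ hn2)//.
  have u0' : 0 < u by lra.
  have uc0 : 0 < (u / c) ^+ n by rewrite exprn_gt0// divr_gt0.
  have h3 : p <= (c / u) ^+ n.
    rewrite -[c / u]invf_div exprVn -[leRHS]mul1r ler_pdivlMr//.
    by apply: le_trans hi; rewrite ler_wpM2l// lerDr.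
  apply: le_trans h3 _; apply: lerXn2r; rewrite ?nnegrE ?q2 ?(divr_ge0 (ltW c0) (ltW u0'))//.
  have b'0 : 0 < b' by lra.
  by rewrite ler_pM2l// lef_pV2 ?posrE// ltW.
Qed.

End StepPoly.

Section CumulativeFacts.
Context {R : realType} (Psi : cumulativeBounded (0 : R) (1 : R)).

Lemma Psi_nondecreasing (a b : R) : a <= b -> Psi a <= Psi b.
Proof. exact: cumulative_is_nondecreasing. Qed.

Lemma Psi_ge0 t : 0 <= Psi t.
Proof.
apply: (ler_cvg_to (cumulativeNy Psi) (cvg_cst (Psi t))).
near=> y; apply: Psi_nondecreasing; near: y; exact: nbhs_ninfty_le.
Unshelve. all: end_near. Qed.

Lemma Psi_le1 t : Psi t <= 1.
Proof.
apply: (ler_cvg_to (cvg_cst (Psi t)) (cumulativey Psi)).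
near=> y; apply: Psi_nondecreasing; near: y; exact: nbhs_pinfty_ge.
Unshelve. all: end_near. Qed.

Variable alpha : R.
Hypotheses (alpha0 : 0 < alpha) (Psi_supp : Psi alpha - Psi 0 = 1).

Lemma Psi_alpha : Psi alpha = 1.
Proof. by have := Psi_supp; have := Psi_le1 alpha; have := Psi_ge0 0; lra. Qed.

Lemma Psi_le0 t : t <= 0 -> Psi t = 0.
Proof.
move=> /Psi_nondecreasing h; by have := Psi_supp; have := Psi_le1 alpha; have := Psi_ge0 t; lra.
Qed.

Let mu := lebesgue_stieltjes_measure Psi.
Let D : set R := `]0, alpha].

Lemma measurable_le_cst (t : R) : measurable_fun [set: R] (fun u : R => (u <= t)%R%:R : R).
Proof.
rewrite (_ : (fun u : R => _) = \1_(`]-oo, t] : set R)).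
  exact: measurable_indic.
by apply/funext => u; rewrite indicE mem_setE in_itv/=.
Qed.

Lemma Rintegral_le_cst t : 0 < t -> \int[mu]_(u in D) (u <= t)%R%:R = Psi t.
Proof.
move=> t0.
have -> : Psi t = Psi (Num.min t alpha).
  rewrite /Num.min; case: ltP => // at_.
  by apply/eqP; rewrite eq_le (Psi_nondecreasing at_) Psi_alpha Psi_le1.
rewrite (@eq_Rintegral _ _ _ mu D (\1_(`]-oo, t] : set R))); last first.
  by move=> u _; rewrite indicE mem_setE in_itv/=.
rewrite /Rintegral integral_indic//; last exact: measurable_itv.
have -> : `]-oo, t]%classic `&` D = `]0, Num.min t alpha]%classic.
  apply/seteqP; split => u; rewrite /D /= !in_itv /= le_min.
    by move=> [ut /andP[u0 ua]]; rewrite u0 ut.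
  by move=> /and3P[u0 ut ua]; rewrite u0 ut.
have m0 : 0 <= Num.min t alpha by rewrite le_min !ltW.
by rewrite [X in fine X](stieltjes_itv Psi m0)/= (Psi_le0 (lexx 0)) subr0.
Qed.

Lemma moment_poly_upper (p : {poly R}) t eta : 0 < t ->
  (forall u, 0 <= u <= alpha -> p.[u] <= (u <= t)%R%:R + eta) ->
  \sum_(k < size p) p`_k * moment Psi k <= Psi t + eta.
Proof.
move=> t0 H; rewrite -(Rintegral_poly alpha0 Psi_supp).
have i1 : mu.-integrable D (EFin \o (fun u : R => (u <= t)%R%:R : R)).
  apply: (integrable_supp alpha0 Psi_supp (measurable_le_cst t) (M := 1)) => u _.
  by case: (u <= t)%R; rewrite ?normr1 ?normr0.
have i2 : mu.-integrable D (EFin \o (fun=> eta)).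
  by apply: (integrable_supp alpha0 Psi_supp _ (M := `|eta|)) => //; exact: measurable_cst.
have measurable_support' : measurable D by exact: measurable_itv.
rewrite -(Rintegral_le_cst t0) -[X in _ + X](Rintegral_cst_supp alpha0 Psi_supp).
rewrite -RintegralD//; apply: le_Rintegral => //.
- rewrite (_ : horner p = (fun x => \sum_(k < size p) p`_k * x ^+ k)).
    exact: integrable_sum_pow.
  by apply/funext => x; rewrite horner_coef.
- exact: (integrableD _ i1 i2).
- by move=> u; rewrite /D/= in_itv/= => /andP[/ltW u0 ua]; apply: H; rewrite u0.
Qed.

Lemma moment_poly_lower (p : {poly R}) t eta : 0 < t ->
  (forall u, 0 <= u <= alpha -> (u <= t)%R%:R - eta <= p.[u]) ->
  Psi t - eta <= \sum_(k < size p) p`_k * moment Psi k.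
Proof.
move=> t0 H; rewrite -(Rintegral_poly alpha0 Psi_supp).
have i1 : mu.-integrable D (EFin \o (fun u : R => (u <= t)%R%:R : R)).
  apply: (integrable_supp alpha0 Psi_supp (measurable_le_cst t) (M := 1)) => u _.
  by case: (u <= t)%R; rewrite ?normr1 ?normr0.
have i2 : mu.-integrable D (EFin \o (fun=> eta)).
  by apply: (integrable_supp alpha0 Psi_supp _ (M := `|eta|)) => //; exact: measurable_cst.
have measurable_support' : measurable D by exact: measurable_itv.
rewrite -(Rintegral_le_cst t0) -[X in _ - X](Rintegral_cst_supp alpha0 Psi_supp).
rewrite -RintegralB//; apply: le_Rintegral => //.
- exact: (integrableB _ i1 i2).
- rewrite (_ : horner p = (fun x => \sum_(k < size p) p`_k * x ^+ k)).
    exact: integrable_sum_pow.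
  by apply/funext => x; rewrite horner_coef.
- by move=> u; rewrite /D/= in_itv/= => /andP[/ltW u0 ua]; apply: H; rewrite u0.
Qed.

End CumulativeFacts.

Section PrimeCdf.
Context {R : realType} (f : nat -> R) (C : R).
Hypothesis fC : forall p : nat, prime p -> 0 <= f p <= C.

Let weight (p : nat) : R := f p ^+ 2 / p%:R * (1 - p%:R^-1).

Lemma weight_ge0 p : prime p -> 0 <= weight p.
Proof.
move=> pp; rewrite mulr_ge0 ?divr_ge0 ?sqr_ge0// subr_ge0.
by rewrite invf_le1 ?ler1n ?ltr0n prime_gt0.
Qed.

Lemma add_varianceE x : add_variance f x = \sum_(p <- primes_upto (Num.truncn x)) weight p.
Proof. by rewrite /add_variance sum_primes_upto. Qed.

Lemma prime_values_cdfE x t : prime_values_cdf f x t =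
  (add_variance f x)^-1 * \sum_(p <- primes_upto (Num.truncn x)) (f p <= t)%R%:R * weight p.
Proof.
rewrite /prime_values_cdf big_mkcondr sum_primes_upto; congr (_ * _).
by apply: eq_bigr => p _; case: (f p <= t)%R; rewrite ?mul1r ?mul0r.
Qed.

Lemma prime_moment_poly x (p : {poly R}) :
  \sum_(k < size p) p`_k * prime_moment f x k =
  (add_variance f x)^-1 * \sum_(q <- primes_upto (Num.truncn x)) p.[f q] * weight q.
Proof.
under eq_bigr do rewrite /prime_moment sum_primes_upto mulrCA mulr_sumr.
rewrite -mulr_sumr exchange_big/=; congr (_ * _); apply: eq_bigr => q _.
rewrite horner_coef mulr_suml; apply: eq_bigr => k _.
by rewrite /weight -addn2 exprD; ring.
Qed.

Lemma le_weighted_sum x (F G : nat -> R) : 0 < add_variance f x ->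
  (forall p, prime p -> F p <= G p) ->
  (add_variance f x)^-1 * \sum_(q <- primes_upto (Num.truncn x)) F q * weight q <=
  (add_variance f x)^-1 * \sum_(q <- primes_upto (Num.truncn x)) G q * weight q.
Proof.
move=> V0 FG; rewrite ler_pM2l ?invr_gt0// big_seq_cond [leRHS]big_seq_cond.
apply: ler_sum => q; rewrite mem_filter => /andP[/andP[qp _] _].
by rewrite ler_wpM2r ?weight_ge0// FG.
Qed.

Lemma weighted_sum_cst x (F : nat -> R) eta : 0 < add_variance f x ->
  (add_variance f x)^-1 * \sum_(q <- primes_upto (Num.truncn x)) (F q + eta) * weight q =
  (add_variance f x)^-1 * (\sum_(q <- primes_upto (Num.truncn x)) F q * weight q) + eta.
Proof.
move=> V0; under eq_bigr do rewrite mulrDl.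
by rewrite big_split/= -mulr_sumr -add_varianceE mulrDr [eta * _]mulrC mulKf// gt_eqF.
Qed.

Lemma prime_moment_poly_upper x (p : {poly R}) t eta : 0 < add_variance f x ->
  (forall u, 0 <= u <= C -> p.[u] <= (u <= t)%R%:R + eta) ->
  \sum_(k < size p) p`_k * prime_moment f x k <= prime_values_cdf f x t + eta.
Proof.
move=> V0 H; rewrite prime_moment_poly prime_values_cdfE -weighted_sum_cst//.
by apply: le_weighted_sum => // q /fC; exact: H.
Qed.

Lemma prime_moment_poly_lower x (p : {poly R}) t eta : 0 < add_variance f x ->
  (forall u, 0 <= u <= C -> (u <= t)%R%:R - eta <= p.[u]) ->
  prime_values_cdf f x t - eta <= \sum_(k < size p) p`_k * prime_moment f x k.
Proof.
move=> V0 H; rewrite prime_moment_poly prime_values_cdfE -weighted_sum_cst//.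
by apply: le_weighted_sum => // q /fC; exact: H.
Qed.

Lemma prime_values_cdf_le0 x t : t <= 0 -> prime_values_cdf f x t = 0.
Proof.
move=> t0; rewrite prime_values_cdfE big_seq_cond big1 ?mulr0// => q.
rewrite mem_filter => /andP[/andP[/fC/andP[f0 _] _] _].
case: leP => ft; last by rewrite mul0r.
have f00 : f q = 0 by apply/eqP; rewrite eq_le f0 (le_trans ft).
by rewrite /weight f00 expr2 !mul0r mulr0.
Qed.

Variables (Psi : cumulativeBounded (0 : R) (1 : R)) (alpha : R).
Hypotheses (alpha0 : 0 < alpha) (Psi_supp : Psi alpha - Psi 0 = 1).
Hypothesis V_pos : \forall x \near +oo, 0 < add_variance f x.
Hypothesis moments_cvg : forall k, prime_moment f x k @[x --> +oo] --> moment Psi k.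

Lemma poly_moments_cvg (p : {poly R}) :
  \sum_(k < size p) p`_k * prime_moment f x k @[x --> +oo] -->
  \sum_(k < size p) p`_k * moment Psi k.
Proof.
apply: cvg_big => [|k _]; first exact: add_continuous.
by apply: cvgM; [exact: cvg_cst|exact: moments_cvg].
Qed.

(** Step polynomials sandwich each distribution function at a point between the
    values of the other at neighbouring points, up to a small error; continuity
    of [Psi] at [t] closes the gap.  For t <= 0 both functions vanish. *)
Lemma weak_convergence t : {for t, continuous Psi} ->
  prime_values_cdf f x t @[x --> +oo] --> Psi t.
Proof.
move=> ct; have [t0|t0] := leP t 0.
  rewrite (Psi_le0 Psi_supp t0); under eq_fun do rewrite prime_values_cdf_le0//.
  exact: cvg_cst.
apply/cvgrPdist_le => e e0.
pose A := Num.max (Num.max C alpha) 0.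
have A0 : 0 <= A by rewrite /A le_max lexx orbT.
have CA : C <= A by rewrite /A !le_max lexx.
have aA : alpha <= A by rewrite /A !le_max lexx orbT.
have e4 : 0 < e / 4 by lra.
have [r r0 Hr] : exists2 r : R, 0 < r & forall y, `|t - y| <= r -> `|Psi t - Psi y| <= e / 4.
  move/cvgrPdist_le : ct => /(_ _ e4) /nbhs_ballP [r /= r0 H].
  exists (r / 2); first by rewrite divr_gt0.
  by move=> y ty; apply: H; rewrite /ball/=; apply: le_lt_trans ty _; rewrite ltr_pdivrMr//; lra.
(* the maximum keeps b positive, as the step polynomials require *)
pose b := Num.max (t - r) (t / 2); pose b' := t + r.
have b0 : 0 < b by rewrite lt_max; apply/orP; right; rewrite divr_gt0.
have bt : b < t by rewrite gt_max; apply/andP; split; lra.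
have btr : t - r <= b by rewrite le_max lexx.
have tb' : t < b' by rewrite /b'; lra.
have Psib : `|Psi t - Psi b| <= e / 4 by apply: Hr; rewrite ger0_norm; lra.
have Psib' : `|Psi t - Psi b'| <= e / 4.
  by apply: Hr; rewrite /b' opprD addrA subrr sub0r normrN gtr0_norm.
have [p Hp] := step_poly b0 bt A0 e4.
have [q Hq] := step_poly t0 tb' A0 e4.
have b'0 : 0 < b' by lra.
have Pp := moment_poly_lower alpha0 Psi_supp (p := p) (eta := e / 4) b0.
have Pq := moment_poly_upper alpha0 Psi_supp (p := q) (eta := e / 4) b'0.
have cp : \forall x \near +oo, `|\sum_(k < size p) p`_k * moment Psi k - \sum_(k < size p) p`_k * prime_moment f x k| <= e / 4.
  by move: (@poly_moments_cvg p) => /cvgrPdist_le; exact.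
have cq : \forall x \near +oo, `|\sum_(k < size q) q`_k * moment Psi k - \sum_(k < size q) q`_k * prime_moment f x k| <= e / 4.
  by move: (@poly_moments_cvg q) => /cvgrPdist_le; exact.
have {}Pp : Psi b - e / 4 <= \sum_(k < size p) p`_k * moment Psi k.
  apply: Pp => u /andP[u0 ua]; have uA : 0 <= u <= A by rewrite u0 (le_trans ua).
  by have /andP[] := Hp u uA.
have {}Pq : \sum_(k < size q) q`_k * moment Psi k <= Psi b' + e / 4.
  apply: Pq => u /andP[u0 ua]; have uA : 0 <= u <= A by rewrite u0 (le_trans ua).
  by have /andP[] := Hq u uA.
near=> x.
have V0 : 0 < add_variance f x by near: x.
have F1 : \sum_(k < size p) p`_k * prime_moment f x k <= prime_values_cdf f x t + e / 4.
  apply: prime_moment_poly_upper => // u /andP[u0 uC].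
  have uA : 0 <= u <= A by rewrite u0 (le_trans uC).
  by have /andP[] := Hp u uA.
have F2 : prime_values_cdf f x t - e / 4 <= \sum_(k < size q) q`_k * prime_moment f x k.
  apply: prime_moment_poly_lower => // u /andP[u0 uC].
  have uA : 0 <= u <= A by rewrite u0 (le_trans uC).
  by have /andP[] := Hq u uA.
have G1 : `|\sum_(k < size p) p`_k * moment Psi k - \sum_(k < size p) p`_k * prime_moment f x k| <= e / 4.
  by near: x.
have G2 : `|\sum_(k < size q) q`_k * moment Psi k - \sum_(k < size q) q`_k * prime_moment f x k| <= e / 4.
  by near: x.
move: G1 G2 Psib Psib'; rewrite !ler_norml => /andP[G1 G1'] /andP[G2 G2'] /andP[P1 P1'] /andP[P2 P2'].
apply/andP; split; lra.
Unshelve. all: end_near. Qed.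

End PrimeCdf.

(** * The tails of the two laws, and the theorem *)

Section RandomVariableTails.
Context {R : realType} d (T : measurableType d) (P : probability T R).
Variable X : {RV P >-> R}.
Hypothesis integrable_exp : forall s, 0 <= s <= 1 ->
  P.-integrable setT (EFin \o (fun w => expR (s * X w))).

Let mgf (s : R) : R := \int[P]_w expR (s * X w).
Let tail (y : R) : R := fine (P [set w | y <= X w]).

Lemma measurable_ge_set (y : R) : measurable [set w | y <= X w].
Proof.
rewrite (_ : [set w | y <= X w] = setT `&` X @^-1` `[y, +oo[%classic).
  exact: (measurable_funP X measurableT _ (measurable_itv _)).
by apply/seteqP; split => w /=; rewrite in_itv/= andbT; [split|move=> []].
Qed.

Lemma measurable_indic_ge (y : R) :
  measurable_fun setT (fun w => (y <= X w)%R%:R : R).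
Proof.
rewrite (_ : (fun w => _) = \1_([set w | y <= X w])).
  by apply: measurable_indic; exact: measurable_ge_set.
by apply/funext => w; rewrite indicE mem_setE.
Qed.

Lemma integrable_indic_ge (y : R) :
  P.-integrable setT (EFin \o (fun w => (y <= X w)%R%:R : R)).
Proof.
apply: (integrable_bounded P (measurable_indic_ge y) (M := 1)) => w.
by case: (y <= X w)%R; rewrite ?normr1 ?normr0.
Qed.

Lemma Rintegral_indic_ge (y : R) : \int[P]_w (y <= X w)%R%:R = tail y.
Proof.
have mS := measurable_ge_set y.
rewrite (@eq_Rintegral _ _ _ P setT (\1_([set w | y <= X w]))); last first.
  by move=> w _; rewrite indicE mem_setE.
by rewrite /Rintegral integral_indic// setIT.
Qed.

Lemma Rintegral_indic_sum (c : nat -> R) (y s : R) J :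
  \int[P]_w (\sum_(j < J) c j * (grid y s j <= X w)%R%:R) =
  \sum_(j < J) c j * tail (grid y s j).
Proof.
rewrite (Rintegral_lin c (F := fun j w => (grid y s j <= X w)%R%:R)).
  by apply: eq_bigr => j _; rewrite Rintegral_indic_ge.
by move=> j _; exact: integrable_indic_ge.
Qed.

Lemma integrable_indic_sum (c : nat -> R) (y s : R) J :
  P.-integrable setT (EFin \o (fun w => \sum_(j < J) c j * (grid y s j <= X w)%R%:R)).
Proof.
apply: (integrable_lin c (F := fun j w => (grid y s j <= X w)%R%:R)) => j _.
exact: integrable_indic_ge.
Qed.

Lemma RV_tail_upper : tail_mgf_upper tail mgf.
Proof.
move=> s y J s0 s2.
have is1 : P.-integrable setT (EFin \o (fun w => expR (s * X w))).
  by apply: integrable_exp; apply/andP; split; lra.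
have is2 : P.-integrable setT (EFin \o (fun w => expR (2 * s * X w))).
  by apply: integrable_exp; apply/andP; split; lra.
pose c j := expR (s * grid y s j.+1).
rewrite -(Rintegral_indic_sum c) -[X in X + _ + _](Rintegral_prob_cst P).
rewrite /mgf -RintegralZl// -RintegralD//; last 2 first.
- exact: integrable_cst.
- exact: (@integrable_indic_sum c).
rewrite -RintegralD//; last 2 first.
- by apply: integrable_add; [exact: integrable_cst|exact: (@integrable_indic_sum c)].
- exact: integrableZ.
apply: le_Rintegral => //.
  apply: integrable_add; last exact: integrableZ.
  by apply: integrable_add; [exact: integrable_cst|exact: (@integrable_indic_sum c)].
by move=> w _; exact: expR_le_grid.
Qed.

Lemma RV_tail_lower : tail_mgf_lower tail mgf.
Proof.
move=> s y J s0 s2.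
have is1 : P.-integrable setT (EFin \o (fun w => expR (s * X w))).
  by apply: integrable_exp; apply/andP; split; lra.
rewrite -(Rintegral_indic_sum (fun j => expR (s * grid y s j))) /mgf -RintegralZl//.
apply: le_Rintegral => //; first exact: (@integrable_indic_sum (fun j => expR (s * grid y s j))).
  exact: integrableZ.
by move=> w _; exact: sum_expR_grid_below.
Qed.

End RandomVariableTails.

Section AdditiveTails.
Context {R : realType} (f : nat -> R).

Definition additive_tail (x y : R) : R :=
  (\sum_(1 <= n < (Num.truncn x).+1) (y <= f n - add_mean f x)%R%:R) / x.

Lemma tail_densityE x y : 0 < add_sigma f x ->
  tail_density f x (y / add_sigma f x) = additive_tail x y.
Proof.
move=> s0; rewrite /tail_density /additive_tail -sum1_count natr_sum big_mkcond/=.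
congr (_ / _); apply: eq_bigr => n _.
by rewrite ler_pM2r ?invr_gt0//; case: (y <= _)%R.
Qed.

Lemma additive_tail_upper x : 1 <= x ->
  tail_mgf_upper (additive_tail x) (additive_mgf f x).
Proof.
move=> x1 s y J s0 _; have x0 : 0 < x by lra.
have x0' : 0 <= x by lra.
rewrite /additive_mgf /additive_tail ler_pdivrMr// [leRHS]mulrDl [X in _ <= X + _]mulrDl.
set N := Num.truncn x.
apply: (@le_trans _ _ (\sum_(1 <= n < N.+1) (expR (s * y) +
    \sum_(j < J) expR (s * grid y s j.+1) * (grid y s j <= f n - add_mean f x)%R%:R +
    expR (- (s * grid y s J)) * expR (2 * s * (f n - add_mean f x))))).
  by apply: ler_sum => n _; exact: expR_le_grid.
rewrite !big_split/=; apply: lerD; first apply: lerD.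
- rewrite sumr_const_nat subn1/= -mulr_natr ler_wpM2l ?expR_ge0//.
  by have /andP[] := truncn_itv x0'.
- rewrite exchange_big/= mulr_suml; apply: ler_sum => j _.
  by rewrite -mulr_sumr -mulrA mulfVK ?gt_eqF.
- by rewrite -mulr_sumr -mulrA mulfVK ?gt_eqF.
Qed.

Lemma additive_tail_lower x : 1 <= x ->
  tail_mgf_lower (additive_tail x) (additive_mgf f x).
Proof.
move=> x1 s y J s0 _; have x0 : 0 < x by lra.
rewrite /additive_mgf /additive_tail mulrA ler_pdivlMr//.
rewrite mulr_suml; under eq_bigr do rewrite -mulrA mulfVK ?gt_eqF// mulr_sumr.
rewrite exchange_big/= mulr_sumr; apply: ler_sum => n _.
exact: sum_expR_grid_below.
Qed.

End AdditiveTails.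

Theorem theorem2p6 (R : realType) (f : nat -> R)
    (Psi : cumulativeBounded (0 : R) (1 : R))
    (d : measure_display) (T : measurableType d) (P : probability T R)
    (Z : R -> {RV P >-> R})
    (f_additive : strongly_additive f)
    (variance_infty : add_variance f x @[x --> +oo] --> +oo)
    (f_bounded : exists C : R, forall p : nat, prime p -> 0 <= f p <= C)
    (Psi_support : exists2 alpha : R, 0 < alpha & Psi alpha - Psi 0 = 1)
    (Z_law : forall u : R, 0 < u -> is_Z_Psi Psi u (Z u))
    (tails_equiv : equiv_uniformly (add_sigma f)
       (tail_density f)
       (fun x Delta => fine (P [set w |
          Delta * add_sigma f x <= Z (add_variance f x) w]))) :
  forall t : R, {for t, continuous Psi} ->
    prime_values_cdf f x t @[x --> +oo] --> Psi t.
Proof.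
case: f_bounded => C fC; case: Psi_support => alpha alpha0 Psi_supp.
have V_ge c : \forall x \near +oo, c <= add_variance f x.
  by move/cvgryPge : variance_infty; exact.
have V_pos : \forall x \near +oo, 0 < add_variance f x.
  near=> x; apply: (@lt_le_trans _ _ 1) => //; near: x; exact: V_ge.
have sgV : \forall x \near +oo, add_sigma f x ^+ 2 = add_variance f x.
  by near=> x; rewrite sqr_sqrtr// ltW//; near: x.
apply: (weak_convergence fC alpha0 Psi_supp V_pos) => k.
have [s0 [s00 s01 Hf]] := additive_mgf_bounds f_additive fC.
have e1 := @expR1_ge2 R.
apply: (@moments_converge R (add_sigma f) (prime_moment f) (moment Psi)
  (additive_mgf f) (fun x s => \int[P]_w expR (s * Z (add_variance f x) w))
  (additive_tail f) (fun x y => fine (P [set w | y <= Z (add_variance f x) w]))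
  (8 * expR 1) s0) => //.
- apply/cvgryPge => c; near=> x.
  have h : c ^+ 2 <= add_variance f x by near: x; exact: V_ge.
  by rewrite (le_trans (ler_norm _))// -sqrtr_sqr ler_sqrt// (le_trans _ h)// sqr_ge0.
- lra.
- move=> N N1; have [B B0 HB] := Hf N N1; exists B => //; near=> x.
  have -> : add_sigma f x ^+ 2 = add_variance f x by near: x.
  by move=> s ss; apply: HB => //; near: x => //; exact: nbhs_pinfty_ge.
- move=> N N1; exists (expR alpha / alpha ^+ 2).
    by rewrite divr_ge0 ?expR_ge0 ?exprn_ge0// ltW.
  near=> x.
  have -> : add_sigma f x ^+ 2 = add_variance f x by near: x.
  have V0 : 0 < add_variance f x by near: x.
  move=> s /andP[sge sle].
  have s1 : 0 <= s <= 1 by rewrite sge (le_trans sle).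
  have [_ lo up] := levy_law_mgf alpha0 Psi_supp V0 (Z_law _ V0) N s1.
  split.
    rewrite (le_trans lo)// ler_peMl//; last by lra.
    by apply: Rintegral_ge0 => w _; exact: expR_ge0.
  by rewrite (le_trans up)// ler_wpM2r ?expR_ge0//; lra.
- near=> x; apply: additive_tail_upper; near: x; exact: nbhs_pinfty_ge.
- near=> x; apply: additive_tail_lower; near: x; exact: nbhs_pinfty_ge.
- near=> x; apply: RV_tail_upper => s s1.
  have V0 : 0 < add_variance f x by near: x.
  by have [] := levy_law_mgf alpha0 Psi_supp V0 (Z_law _ V0) 2 s1.
- near=> x; apply: RV_tail_lower => s s1.
  have V0 : 0 < add_variance f x by near: x.
  by have [] := levy_law_mgf alpha0 Psi_supp V0 (Z_law _ V0) 2 s1.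
- move=> e K e0 K0.
  have half : (0 : R) < 2^-1 by rewrite invr_gt0.
  have H := tails_equiv e K e0 K0 _ half.
  near=> x.
  have Hx : forall D : R, 1 <= D -> D <= K * add_sigma f x `^ (1 - e) ->
    `| tail_density f x D / fine (P [set w | D * add_sigma f x <= Z (add_variance f x) w]) - 1 | < 2^-1.
    by near: x.
  have s1 : 0 < add_sigma f x.
    by rewrite sqrtr_gt0; near: x.
  move=> y y1 y2.
  have := Hx (y / add_sigma f x); rewrite ler_pdivlMr// mul1r => /(_ y1).
  rewrite ler_pdivrMr// => /(_ y2).
  rewrite tail_densityE// divfK ?gt_eqF//.
  set M := fine _; set L := additive_tail f x y.
  have M0 : 0 <= M by rewrite fine_ge0.
  have [->|Mn0] := eqVneq M 0; first by rewrite invr0 mulr0 sub0r normrN normr1; lra.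
  have Mp : 0 < M by rewrite lt_neqAle eq_sym Mn0.
  rewrite ltr_norml ltrBrDr ltrBlDr ltr_pdivlMr// ltr_pdivrMr// => /andP[h1 h2].
  by split; lra.
- near=> x.
  have V0 : 0 < add_variance f x by near: x.
  by rewrite /prime_moment mulVf// gt_eqF.
- exact: moment0 alpha0 Psi_supp.
Unshelve. all: end_near. Qed.
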